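(* Let $A,N_1,\dots,N_q\in\mathbb R^{n\times n}$, $B\in\mathbb R^{n\times m}$, $C\in\mathbb R^{p\times n}$ be such that $(A,B,N_i)$ is stabilizable and $(A,C,N_i)$ is observable. Let $P>0$ satisfy $$A^\top P^{-1}+P^{-1}A+\sum_{i,j=1}^q N_i^\top P^{-1}N_jk_{ij}-C^\top C+P^{-1}BB^\top P^{-1}\le 0,$$ and let $Q>0$ be the stabilizing solution of $$A^\top Q+QA+\sum_{i,j=1}^q N_i^\top QN_jk_{ij}+C^\top C-QBB^\top Q=0.$$ Let $1\le r<n$, let $\sigma_1\ge\dots\ge\sigma_n>0$ be the square roots of the eigenvalues of $PQ$, and let $(A_r,B_r,C_r,N_{i,r})$ be the coefficients of the reduced system obtained by LQG balanced truncation, with $\Sigma_r=\operatorname{diag}(\sigma_1,\dots,\sigma_r)$. Let $T>0$, $u\in L^2_T$, and let $x,y$ be the state and output of the full system with control $u$ and $x(0)=0$. Let $x_r,y_r$ be the state and output of the reduced system with $x_r(0)=0$ and control $$u_r(t)=-B_r^\top\Sigma_rx_r(t)+B^\top Qx(t)+u(t).$$ Then $$\left\|\begin{bmatrix}u-u_r\\ y-y_r\end{bmatrix}\right\|_{L^2_T}\le 2\sum_{k=r+1}^n\frac{\sigma_k}{\sqrt{1+\sigma_k^2}}\left(\left\|\begin{bmatrix}u\\ y\end{bmatrix}\right\|_{L^2_T}^2+\mathbb E\left[x(T)^\top Qx(T)\right]\right)^{1/2}.$$ If, furthermore, $u\in L^2$ and $x\in L^2$, then $$\left\|\begin{bmatrix}u-u_r\\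 y-y_r\end{bmatrix}\right\|_{L^2}\le 2\sum_{k=r+1}^n\frac{\sigma_k}{\sqrt{1+\sigma_k^2}}\left\|\begin{bmatrix}u\\ y\end{bmatrix}\right\|_{L^2}.$$
   Context: Probability setting: $(\Omega,\mathcal F,(\mathcal F_t)_{t\ge0},\mathbb P)$ is a filtered probability space with right-continuous complete filtration; $W=(W_1,\dots,W_q)^\top$ is an adapted $\mathbb R^q$-valued mean-zero Wiener process with covariance matrix $K=(k_{ij})$, i.e. $\mathbb E[W(t)W(t)^\top]=Kt$, whose increments $W(t+h)-W(t)$ are independent of $\mathcal F_t$. For adapted processes, $\|v\|_{L^2_T}^2=\mathbb E\int_0^T\|v(s)\|_2^2ds$; $v\in L^2_T$ means this is finite, and $L^2$ denotes the case $T=\infty$. Controls are adapted and belong to $L^2_T$ for every $T>0$ considered. Full system: $dx(t)=[Ax(t)+Bu(t)]dt+\sum_{i=1}^qN_ix(t)dW_i(t)$, $x(0)=x_0\in\mathbb R^n$, $y(t)=Cx(t)$. Its state and output are written $x(\cdot,x_0,u)$, $y(\cdot,x_0,u)$. Definitions: $(A,N_i)$ is stable (mean square asymptotically) if there are $M\ge1$, $c>0$ with $\mathbb E\|x(t,x_0,0)\|_2^2\le Me^{-ct}\|x_0\|_2^2$ for all $x_0$, $t\ge0$. $(A,B,N_i)$ is stabilizable if for every $x_0$ there is $u\in L^2$ with $x(\cdot,x_0,u)\in L^2$. $(A,C,N_i)$ is observable if $y(t,x_0,0)=0$ a.s. for all $t\ge0$ implies $x_0=0$. A solution $Q$ of the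 Riccati equation is stabilizing if $(A-BB^\top Q,N_i)$ is stable; under the assumptions of the claim a stabilizing solution exists and is positive definite. LQG balanced truncation: choose a nonsingular $S_b\in\mathbb R^{n\times n}$ with $S_bPS_b^\top=S_b^{-\top}QS_b^{-1}=\Sigma_n=\operatorname{diag}(\sigma_1,\dots,\sigma_n)$, and put $(A_n,N_{i,n},B_n,C_n)=(S_bAS_b^{-1},S_bN_iS_b^{-1},S_bB,CS_b^{-1})$. Then $A_r,N_{i,r}$ are the upper-left $r\times r$ blocks of $A_n,N_{i,n}$, $B_r$ consists of the first $r$ rows of $B_n$, and $C_r$ of the first $r$ columns of $C_n$. The reduced system with control $w$ is $dx_r(t)=[A_rx_r(t)+B_rw(t)]dt+\sum_{i=1}^qN_{i,r}x_r(t)dW_i(t)$, $y_r(t)=C_rx_r(t)$. In the claim the control $w=u_r$ depends on $x_r$, so $x_r$ is the solution of the resulting linear SDE $dx_r=[(A_r-B_rB_r^\top\Sigma_r)x_r+B_r(B^\top Qx+u)]dt+\sum_iN_{i,r}x_rdW_i$. *)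

(* Defs.v *)
From mathcomp Require Export all_boot all_order all_algebra.
From mathcomp Require Export all_classical all_reals all_analysis.
Export numFieldNormedType.Exports.

Set Implicit Arguments.
Unset Strict Implicit.
Unset Printing Implicit Defensive.

Import Order.TTheory GRing.Theory Num.Theory.

Local Open Scope classical_set_scope.
Local Open Scope ring_scope.

Section Matrices.
Context {R : realType}.

Definition quad {n} (S : 'M[R]_n) (x : 'cV[R]_n) : R := (x^T *m S *m x) 0 0.

Definition sqnorm {n} (x : 'cV[R]_n) : R := \sum_i x i 0 ^+ 2.

(* [S > 0] and [S <= 0] in the Loewner order; both include symmetry. *)
Definition posdef {n} (S : 'M[R]_n) : Prop :=
  S^T = S /\ forall x, x != 0 -> 0 < quad S x.

Definition negsemidef {n} (S : 'M[R]_n) : Prop :=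
  S^T = S /\ forall x, quad S x <= 0.

Definition noise_term {n q} (K : 'M[R]_q) (N : 'I_q -> 'M[R]_n)
    (X : 'M[R]_n) : 'M[R]_n :=
  \sum_i \sum_j K i j *: ((N i)^T *m X *m N j).

Definition riccati_ineq {n m p q} (K : 'M[R]_q) (A : 'M[R]_n)
    (N : 'I_q -> 'M[R]_n) (B : 'M[R]_(n, m)) (C : 'M[R]_(p, n))
    (P : 'M[R]_n) : Prop :=
  negsemidef (A^T *m invmx P + invmx P *m A + noise_term K N (invmx P)
              - C^T *m C + invmx P *m B *m B^T *m invmx P).

Definition riccati_eq {n m p q} (K : 'M[R]_q) (A : 'M[R]_n)
    (N : 'I_q -> 'M[R]_n) (B : 'M[R]_(n, m)) (C : 'M[R]_(p, n))
    (Q : 'M[R]_n) : Prop :=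
  A^T *m Q + Q *m A + noise_term K N Q + C^T *m C - Q *m B *m B^T *m Q = 0.

(* [s 0 >= ... >= s (n - 1) > 0] are the square roots of the eigenvalues of
   [M], counted with algebraic multiplicity. *)
Definition sqrt_eigenvalues {n} (M : 'M[R]_n) (s : 'I_n -> R) : Prop :=
  [/\ forall i, 0 < s i,
      forall i j : 'I_n, (i <= j)%N -> s j <= s i &
      char_poly M = \prod_i ('X - (s i ^+ 2)%:P)].

Definition diag {n} (s : 'I_n -> R) : 'M[R]_n := diag_mx (\row_i s i).

Definition balancing {n} (S P Q : 'M[R]_n) (s : 'I_n -> R) : Prop :=
  [/\ S \in unitmx,
      S *m P *m S^T = diag s &
      (invmx S)^T *m Q *m invmx S = diag s].

Section Truncation.
Context {n r : nat} (le_rn : (r <= n)%N) (S : 'M[R]_n).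
Let emb : 'I_r -> 'I_n := widen_ord le_rn.

Definition trunc_state (A : 'M[R]_n) : 'M[R]_r :=
  mxsub emb emb (S *m A *m invmx S).

Definition trunc_input {m} (B : 'M[R]_(n, m)) : 'M[R]_(r, m) :=
  rowsub emb (S *m B).

Definition trunc_output {p} (C : 'M[R]_(p, n)) : 'M[R]_(p, r) :=
  colsub emb (C *m invmx S).

Definition trunc_diag (s : 'I_n -> R) : 'M[R]_r := diag (fun k => s (emb k)).
End Truncation.

End Matrices.

(* Processes and filtrations are indexed by all of [R], but only their values at
   [t >= 0] matter. *)

Definition upto {R : realType} (T : R) : set R := `[0, T].
Definition halfline {R : realType} : set R := `[0, +oo[.

Section Processes.
Context {R : realType} {d : measure_display} {Omega : measurableType d}.
Variable P : probability Omega R.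
Implicit Types (F : R -> set (set Omega)) (I : set R).

Definition usual_filtration F : Prop :=
  [/\ forall t, 0 <= t -> sigma_algebra setT (F t),
      forall t, 0 <= t -> F t `<=` measurable,
      forall s t, 0 <= s -> s <= t -> F s `<=` F t,
      forall t, 0 <= t -> \bigcap_(s in [set s | t < s]) F s = F t &
      forall Z, P.-negligible Z -> F 0 Z].

Definition measurable_wrt (G : set (set Omega)) (X : Omega -> R) : Prop :=
  forall Y, measurable Y -> G (X @^-1` Y).

(* Adapted and jointly measurable on the time set [I]; joint measurability is
   what gives a meaning to the time integrals of the process. *)
Definition adapted_process F I {n} (X : R -> Omega -> 'cV[R]_n) : Prop :=
  forall i : 'I_n,
    (forall t, I t -> measurable_wrt (F t) (fun w => X t w i 0)) /\
    measurable_fun (I `*` setT) (fun z : R * Omega => X z.1 z.2 i 0).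

Definition continuous_paths I {n} (X : R -> Omega -> 'cV[R]_n) : Prop :=
  {ae P, forall w, forall i,
    {within I, continuous (fun t => X t w i 0 : R)}}.

(* The squared norm E[int_I |v(s)|_2^2 ds] and its square root. With
   [I = upto T] this is the norm of L^2_T, with [I = halfline] that of L^2. *)
Definition L2sq I {n} (v : R -> Omega -> 'cV[R]_n) : \bar R :=
  (\int[P]_w \int[lebesgue_measure]_(s in I) (sqnorm (v s w))%:E)%E.

Definition L2norm I {n} (v : R -> Omega -> 'cV[R]_n) : \bar R :=
  sqrte (L2sq I v).

Definition in_L2 F I {n} (v : R -> Omega -> 'cV[R]_n) : Prop :=
  adapted_process F I v /\ (L2sq I v < +oo)%E.

Definition sigma_rv {n} (X : Omega -> 'cV[R]_n) : set (set Omega) :=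
  <<s [set E | exists (i : 'I_n) (Y : set R),
         measurable Y /\ E = (fun w => X w i 0) @^-1` Y] >>.

Definition independent_of (G : set (set Omega)) {n}
    (X : Omega -> 'cV[R]_n) : Prop :=
  forall E E', G E -> sigma_rv X E' -> P (E `&` E') = (P E * P E')%E.

(* The law of [X] is N(0, v), where N(0, 0) is the Dirac mass at [0]. The case
   split is needed because [normal_prob m 0] is not a Dirac mass. *)
Definition centered_gaussian (X : Omega -> R) (v : R) : Prop :=
  forall Y : set R, measurable Y ->
    P (X @^-1` Y) = if 0 < v then normal_prob 0 (Num.sqrt v) Y
                    else \d_(0 : R) Y.

(* The moments are those of the Gaussian law; they are kept next to it because
   they are what defines [K]. [K] may be singular, hence the description of
   multivariate Gaussian increments by their one-dimensional projections. *)
Definition wiener F {q} (K : 'M[R]_q) (W : R -> Omega -> 'cV[R]_q) : Prop :=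
  [/\ adapted_process F halfline W,
      {ae P, forall w, W 0 w = 0} /\ continuous_paths halfline W,
      forall t : R, 0 <= t ->
        (forall i, ('E_P[fun w => (W t w i 0)%R] = 0)%E) /\
        (forall i j,
           ('E_P[fun w => (W t w i 0 * W t w j 0)%R] = (t * K i j)%:E)%E),
      forall (t h : R) (a : 'cV[R]_q), 0 <= t -> 0 <= h ->
        centered_gaussian (fun w => (a^T *m (W (t + h) w - W t w)) 0 0)
                          (h * quad K a) &
      forall t h : R, 0 <= t -> 0 <= h ->
        independent_of (F t) (fun w => W (t + h) w - W t w)].

(* The process [sum_(j < k) xi_j 1_(t_j, t_(j+1)]]. *)
Record simple_process := SimpleProcess {
  sp_size : nat;
  sp_time : nat -> R;
  sp_coef : nat -> Omega -> R }.

Definition simple_adapted F (S : simple_process) : Prop :=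
  [/\ 0 <= sp_time S 0,
      forall j, sp_time S j <= sp_time S j.+1,
      forall j, measurable_wrt (F (sp_time S j)) (sp_coef S j) &
      forall j, exists M, forall w, `|sp_coef S j w| <= M].

Definition simple_val (S : simple_process) (s : R) (w : Omega) : R :=
  \sum_(j < sp_size S)
     sp_coef S j w * \1_(`]sp_time S j, sp_time S j.+1]) s.

Definition simple_integral (b : R -> Omega -> R) (S : simple_process) (t : R)
    (w : Omega) : R :=
  \sum_(j < sp_size S)
     sp_coef S j w * (b (Num.min (sp_time S j.+1) t) w
                      - b (Num.min (sp_time S j) t) w).

(* [J] is a version of the Ito integral of [H] over [0, t] against the scalar
   Brownian motion [b], obtained as the L^2(P) limit of the integrals of simple
   processes approximating [H]. By the Ito isometry the limit does not depend on
   the approximation, and it exists when [H] is adapted, jointly measurable and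
   square integrable on [0, t], which is how it is used below. *)
Definition ito_integral F (b H : R -> Omega -> R) (t : R) (J : Omega -> R) :
    Prop :=
  measurable_fun setT J /\
  exists S : nat -> simple_process,
    [/\ forall k, simple_adapted F (S k),
        (fun k => \int[P]_w \int[lebesgue_measure]_(s in upto t)
                    ((simple_val (S k) s w - H s w) ^+ 2)%:E)%E
          @ \oo --> 0%E &
        (fun k => 'E_P[fun w => ((simple_integral b (S k) t w - J w) ^+ 2)%R])%E
          @ \oo --> 0%E].

Section Systems.
Variables (F : R -> set (set Omega)) (q : nat) (W : R -> Omega -> 'cV[R]_q).

(* [x] is a strong solution on [I] (an interval with left end point 0) of
   dx = [A x + f] dt + sum_i N_i x dW_i, x(0) = x0; [f] is to be square
   integrable on bounded subintervals. Solutions are unique up to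
   indistinguishability, so quantifying over solutions pins down x(., x0, u). *)
Definition sde_solution I {n} (A : 'M[R]_n) (N : 'I_q -> 'M[R]_n)
    (f : R -> Omega -> 'cV[R]_n) (x0 : 'cV[R]_n)
    (x : R -> Omega -> 'cV[R]_n) : Prop :=
  [/\ adapted_process F I x,
      continuous_paths I x,
      forall t, I t -> (L2sq (upto t) x < +oo)%E &
      forall t, I t -> exists J : 'I_q -> Omega -> 'cV[R]_n,
        (forall i k, ito_integral F (fun s w => W s w i 0)
                       (fun s w => (N i *m x s w) k 0) t
                       (fun w => J i w k 0)) /\
        {ae P, forall w, x t w = x0
          + \col_k (\int[lebesgue_measure]_(s in upto t)
                      ((A *m x s w + f s w) k 0))
          + \sum_i J i w}].

Definition state I {n m} (A : 'M[R]_n) (N : 'I_q -> 'M[R]_n)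
    (B : 'M[R]_(n, m)) (x0 : 'cV[R]_n) (u : R -> Omega -> 'cV[R]_m)
    (x : R -> Omega -> 'cV[R]_n) : Prop :=
  sde_solution I A N (fun s w => B *m u s w) x0 x.

Definition uncontrolled_state {n} (A : 'M[R]_n) (N : 'I_q -> 'M[R]_n)
    (x0 : 'cV[R]_n) (x : R -> Omega -> 'cV[R]_n) : Prop :=
  sde_solution halfline A N (fun _ _ => 0) x0 x.

Definition ms_stable {n} (A : 'M[R]_n) (N : 'I_q -> 'M[R]_n) : Prop :=
  exists M c : R, [/\ 1 <= M, 0 < c &
    forall x0 x, uncontrolled_state A N x0 x -> forall t, 0 <= t ->
      ('E_P[fun w => sqnorm (x t w)] <=
        (M * expR (- (c * t)) * sqnorm x0)%:E)%E].

Definition stabilizable {n m} (A : 'M[R]_n) (B : 'M[R]_(n, m))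
    (N : 'I_q -> 'M[R]_n) : Prop :=
  forall x0, exists u x,
    [/\ in_L2 F halfline u, state halfline A N B x0 u x &
        in_L2 F halfline x].

Definition observable {n p} (A : 'M[R]_n) (C : 'M[R]_(p, n))
    (N : 'I_q -> 'M[R]_n) : Prop :=
  forall x0 x, uncontrolled_state A N x0 x ->
    (forall t, 0 <= t -> {ae P, forall w, C *m x t w = 0}) -> x0 = 0.

Definition stabilizing_solution {n m p} (K : 'M[R]_q) (A : 'M[R]_n)
    (N : 'I_q -> 'M[R]_n) (B : 'M[R]_(n, m)) (C : 'M[R]_(p, n))
    (Q : 'M[R]_n) : Prop :=
  riccati_eq K A N B C Q /\ ms_stable (A - B *m B^T *m Q) N.

End Systems.

Definition vstack {m p} (a : R -> Omega -> 'cV[R]_m)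
    (b : R -> Omega -> 'cV[R]_p) : R -> Omega -> 'cV[R]_(m + p) :=
  fun t w => col_mx (a t w) (b t w).

Definition vsub {m} (a b : R -> Omega -> 'cV[R]_m) : R -> Omega -> 'cV[R]_m :=
  fun t w => a t w - b t w.

Definition output {n p} (C : 'M[R]_(p, n)) (x : R -> Omega -> 'cV[R]_n) :
    R -> Omega -> 'cV[R]_p :=
  fun t w => C *m x t w.

Definition reduced_control {n m r} (B : 'M[R]_(n, m)) (Q : 'M[R]_n)
    (Br : 'M[R]_(r, m)) (Sr : 'M[R]_r) (x : R -> Omega -> 'cV[R]_n)
    (xr : R -> Omega -> 'cV[R]_r) (u : R -> Omega -> 'cV[R]_m) :
    R -> Omega -> 'cV[R]_m :=
  fun t w => - (Br^T *m Sr *m xr t w) + B^T *m Q *m x t w + u t w.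

End Processes.

(* Main.v *)
(* Put [v = u + B^T Q x]. In terms of [v] both systems are linear with the same
   input: [dx = [(A - B B^T Q) x + B v] dt + ...], and likewise for [x_r]; the
   error [u - u_r; y - y_r] is the difference of their outputs. So the reduced
   system is the balanced truncation of the closed loop from [v] to [u; y], whose
   Gramians are [Q] and [(P^-1 + Q)^-1], with singular values
   [sigma_k / sqrt (1 + sigma_k^2)], and the energy balance of [x^T Q x] gives
   [|v|^2 = |u; y|^2 + E x(T)^T Q x(T)].

   Removing one state of singular value [th] costs [2 th |v|]: the quadratic form
   [Q(x - x_r) + th^2 (P^-1 + Q)(x + x_r)] is a storage function for the pair.
   Storage functions of consecutive truncations are combined by minimising their
   weighted sum over the intermediate state, which avoids solving the
   intermediate stochastic equations. A storage function yields the bound through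
   [d E z^T X z], obtained not from Ito's formula but from the Ito isometry and
   the orthogonality of stochastic integrals to the past.

   On the half-line, [E x(T)^T Q x(T)] is small along a sequence of times [T]
   tending to infinity because [x] is in [L^2]. *)

Require Import Defs.
From mathcomp Require Import measurable_realfun ring lra.

Set Implicit Arguments.
Unset Strict Implicit.
Unset Printing Implicit Defensive.

Import Order.TTheory GRing.Theory Num.Theory.

Local Open Scope classical_set_scope.
Local Open Scope ring_scope.

(** * Square-integrable functions *)

(** The feedback form pays off because $|Cx|^2$ has opposite signs in the two Riccati relations.
    With $b = B^T Q x$ and $c = B^T P^{-1} x$, the drift of $x^T Q x$ along the closed loop is $2
    b\cdot v - |b|^2 - |Cx|^2$, and that of $x^T P^{-1} x$ is at most $2 c\cdot (v - b) - |c|^2 +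
    |Cx|^2$. They add up to $|v|^2 - |v - b - c|^2$, so $P^{-1} + Q$ limits what the input can
    store. In balancing coordinates $Q$ and $P^{-1} + Q$ become $\sigma_k$ and $\sigma_k^{-1} +
    \sigma_k$ on the diagonal; their ratio is the square of $\sigma_k / \sqrt{1 + \sigma_k^2}$.

    The probabilistic half is shaped by [ito_integral], which describes the integral at one fixed
    time as an $L^2$ limit and gives no process in time. What is provable at fixed times is
    bilinear: the isometry, and equality of the integrals up to $s$ and up to $t$ when paired with
    an [F s]-measurable variable. Hence everything is phrased through inner products on [Omega] and
    on time times [Omega], for pairs of scalar coordinates; quadratic forms are assembled from these
    pairs at the end. *)

Section SquareIntegrable.
Context {d} {T : measurableType d} {R : realType}.
Variable mu : {measure set T -> \bar R}.
Implicit Types f g h : T -> R.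

(** Functions are not identified almost everywhere; [ip_eq_ae] and [sqint_eq_ae] do the replacing
    where an equation holds only almost surely. *)
Definition sqint f : Prop :=
  measurable_fun setT f /\ (\int[mu]_x (f x ^+ 2)%:E < +oo)%E.

Definition ip f g : R := \int[mu]_x (f x * g x).

Lemma sqint_measurable f : sqint f -> measurable_fun setT f.
Proof. by case. Qed.

Lemma sqint_integrable_sqr f : sqint f -> mu.-integrable setT (fun x => (f x ^+ 2)%:E).
Proof.
move=> [mf fi]; apply/integrableP; split.
  by apply/measurable_EFinP; exact: measurable_funX.
by under eq_integral do rewrite gee0_abs ?lee_fin ?sqr_ge0//.
Qed.

Lemma sqint_mul f g : sqint f -> sqint g ->
  mu.-integrable setT (fun x => (f x * g x)%:E).
Proof.
move=> hf hg.
have hfg : mu.-integrable setT (fun x => (f x ^+ 2 + g x ^+ 2)%:E).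
  have := integrableD measurableT (sqint_integrable_sqr hf) (sqint_integrable_sqr hg).
  by apply: eq_integrable => //.
apply: le_integrable hfg => //.
  apply/measurable_EFinP; apply: measurable_funM; first by case: hf.
  by case: hg.
move=> x _; rewrite /= lee_fin normrM [leRHS]ger0_norm ?addr_ge0 ?sqr_ge0//.
rewrite -[f x ^+ 2]real_normK ?num_real// -[g x ^+ 2]real_normK ?num_real//.
have := normr_ge0 (f x); have := normr_ge0 (g x).
have := sqr_ge0 (`|f x| - `|g x|); nra.
Qed.

Lemma sqintD f g : sqint f -> sqint g -> sqint (fun x => f x + g x).
Proof.
move=> hf hg; split; first by apply: measurable_funD; [case: hf|case: hg].
have hi : mu.-integrable setT (fun x => (2 * (f x ^+ 2) + 2 * (g x ^+ 2))%:E).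
  have := integrableD measurableT (integrableZl measurableT 2 (sqint_integrable_sqr hf))
    (integrableZl measurableT 2 (sqint_integrable_sqr hg)).
  by apply: eq_integrable.
have := integrable_lty measurableT hi; apply: le_lt_trans.
apply: ge0_le_integral => //=.
- by move=> x _; rewrite lee_fin sqr_ge0.
- apply/measurable_EFinP; apply: measurable_funX.
  by apply: measurable_funD; [case: hf|case: hg].
- exact: measurable_int hi.
- by move=> x _; rewrite lee_fin; have := sqr_ge0 (f x - g x); nra.
Qed.

Lemma sqintZ a f : sqint f -> sqint (fun x => a * f x).
Proof.
move=> hf; split; first by apply: measurable_funM => //; case: hf.
have := integrable_lty measurableT (integrableZl measurableT (a ^+ 2) (sqint_integrable_sqr hf)).
by under eq_integral do rewrite -EFinM -exprMn.
Qed.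

Lemma sqintN f : sqint f -> sqint (fun x => - f x).
Proof. by move=> /(sqintZ (-1)); under eq_fun do rewrite mulN1r. Qed.

Lemma sqintB f g : sqint f -> sqint g -> sqint (fun x => f x - g x).
Proof. by move=> hf /sqintN; exact: sqintD. Qed.

Lemma sqint0 : sqint (fun=> 0).
Proof.
split => //; under eq_integral do rewrite expr0n/=.
by rewrite integral0 ltry.
Qed.

Lemma sqint_sum I (s : seq I) (F : I -> T -> R) :
  (forall i, sqint (F i)) -> sqint (fun x => \sum_(i <- s) F i x).
Proof.
move=> hF; elim: s => [|i s IH].
  by under eq_fun do rewrite big_nil; exact: sqint0.
by under eq_fun do rewrite big_cons; exact: sqintD.
Qed.

Lemma sqint_le f g : measurable_fun setT f -> sqint g ->
  (forall x, `|f x| <= `|g x|) -> sqint f.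
Proof.
move=> mf hg fg; split => //; case: (hg) => mg; apply: le_lt_trans.
apply: ge0_le_integral => //.
- by move=> x _; rewrite lee_fin sqr_ge0.
- by apply/measurable_EFinP; exact: measurable_funX.
- by apply/measurable_EFinP; exact: measurable_funX.
- move=> x _; rewrite lee_fin -[f x ^+ 2]real_normK ?num_real//.
  by rewrite -[g x ^+ 2]real_normK ?num_real// lerXn2r ?nnegrE.
Qed.

Lemma Rintegral_sum I (s : seq I) (F : I -> T -> R) :
  (forall i, mu.-integrable setT (fun x => (F i x)%:E)) ->
  \int[mu]_x (\sum_(i <- s) F i x) = \sum_(i <- s) \int[mu]_x F i x.
Proof.
move=> hF; elim: s => [|i s IH].
  by rewrite big_nil; under eq_Rintegral do rewrite big_nil; rewrite Rintegral_cst// mul0r.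
rewrite big_cons -IH -RintegralD//.
  by apply: eq_Rintegral => x _; rewrite big_cons.
- exact: hF.
rewrite (_ : EFin \o (fun x => \sum_(i <- s) F i x) = fun x => (\sum_(i <- s) (F i x)%:E)%E); last first.
  by apply/funext => x /=; rewrite sumEFin.
exact: integrable_sum.
Qed.

Lemma ipC f g : ip f g = ip g f.
Proof. by apply: eq_Rintegral => x _; rewrite mulrC. Qed.

Lemma ipDl f g h : sqint f -> sqint g -> sqint h ->
  ip (fun x => f x + g x) h = ip f h + ip g h.
Proof.
move=> hf hg hh; rewrite /ip -RintegralD//; [|exact: sqint_mul..].
by apply: eq_Rintegral => x _; rewrite mulrDl.
Qed.

Lemma ipZl a f h : sqint f -> sqint h -> ip (fun x => a * f x) h = a * ip f h.
Proof.
move=> hf hh; rewrite /ip -RintegralZl//; last exact: sqint_mul.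
by apply: eq_Rintegral => x _; rewrite mulrA.
Qed.

Lemma ipBl f g h : sqint f -> sqint g -> sqint h ->
  ip (fun x => f x - g x) h = ip f h - ip g h.
Proof.
move=> hf hg hh; rewrite /ip -RintegralB//; [|exact: sqint_mul..].
by apply: eq_Rintegral => x _; rewrite mulrBl.
Qed.

Lemma ipDr f g h : sqint f -> sqint g -> sqint h ->
  ip h (fun x => f x + g x) = ip h f + ip h g.
Proof. by move=> *; rewrite ipC ipDl// ipC [ip g h]ipC. Qed.

Lemma ipZr a f h : sqint f -> sqint h -> ip h (fun x => a * f x) = a * ip h f.
Proof. by move=> *; rewrite ipC ipZl// ipC. Qed.

Lemma ipBr f g h : sqint f -> sqint g -> sqint h ->
  ip h (fun x => f x - g x) = ip h f - ip h g.
Proof. by move=> *; rewrite ipC ipBl// ipC [ip g h]ipC. Qed.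

Lemma ip0l h : ip (fun=> 0) h = 0.
Proof.
rewrite /ip; under eq_Rintegral do rewrite mul0r.
by rewrite /Rintegral integral0.
Qed.

Lemma ip_suml I (s : seq I) (F : I -> T -> R) h :
  (forall i, sqint (F i)) -> sqint h ->
  ip (fun x => \sum_(i <- s) F i x) h = \sum_(i <- s) ip (F i) h.
Proof.
move=> hF hh; elim: s => [|i s IH].
  by rewrite big_nil; under eq_fun do rewrite big_nil; rewrite ip0l.
rewrite big_cons -IH; under eq_fun do rewrite big_cons.
by rewrite ipDl//; exact: sqint_sum.
Qed.

Lemma ip_sumr I (s : seq I) (F : I -> T -> R) h :
  (forall i, sqint (F i)) -> sqint h ->
  ip h (fun x => \sum_(i <- s) F i x) = \sum_(i <- s) ip h (F i).
Proof.
by move=> hF hh; rewrite ipC ip_suml//; apply: eq_bigr => i _; rewrite ipC.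
Qed.

Lemma ip_ge0 f : 0 <= ip f f.
Proof. by apply: Rintegral_ge0 => x _; rewrite -expr2 sqr_ge0. Qed.

Lemma EFin_ip f g : sqint f -> sqint g ->
  (ip f g)%:E = (\int[mu]_x (f x * g x)%:E)%E.
Proof.
by move=> hf hg; rewrite /ip /Rintegral fineK//; exact/integrable_fin_num/sqint_mul.
Qed.

Lemma EFin_ipff f : sqint f -> (ip f f)%:E = (\int[mu]_x (f x ^+ 2)%:E)%E.
Proof. by move=> hf; rewrite EFin_ip//; under eq_integral do rewrite -expr2. Qed.

Lemma ip_cauchy_schwarz f g : sqint f -> sqint g ->
  ip f g ^+ 2 <= ip f f * ip g g.
Proof.
move=> hf hg.
have key a b : 0 <= a ^+ 2 * ip f f - 2 * a * b * ip f g + b ^+ 2 * ip g g.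
  have := ip_ge0 (fun x => a * f x - b * g x).
  have haf := sqintZ a hf; have hbg := sqintZ b hg.
  rewrite ipBl//; last exact: sqintB.
  rewrite !ipBr// !ipZl// !ipZr// [ip g f]ipC.
  by congr (0 <= _); ring.
have [g0|g0] := eqVneq (ip g g) 0.
  rewrite g0 mulr0; have [->|fg0] := eqVneq (ip f g) 0; first by rewrite expr0n.
  (* The second weight is chosen to make the nonnegative form equal to $-1$, which rules out
     $\langle f, g\rangle \neq 0$ when $\langle g, g\rangle = 0$. *)
  have := key 1 ((ip f f + 1) / (2 * ip f g)); rewrite g0 mulr0 addr0.
  have -> : 1 ^+ 2 * ip f f - 2 * 1 * ((ip f f + 1) / (2 * ip f g)) * ip f g = -1.
    by field.
  lra.
have gp : 0 < ip g g by rewrite lt_def g0 ip_ge0.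
have := key (ip g g) (ip f g).
have -> : ip g g ^+ 2 * ip f f - 2 * ip g g * ip f g * ip f g + ip f g ^+ 2 * ip g g
  = ip g g * (ip f f * ip g g - ip f g ^+ 2) by ring.
by rewrite pmulr_rge0// subr_ge0.
Qed.

Lemma ip_eq_ae f g h : measurable_fun setT f -> measurable_fun setT g ->
  measurable_fun setT h -> {ae mu, forall x, f x = g x} -> ip f h = ip g h.
Proof.
move=> mf mg mh fg; rewrite /ip /Rintegral; congr fine.
apply: ae_eq_integral => //.
- by apply/measurable_EFinP; exact: measurable_funM.
- by apply/measurable_EFinP; exact: measurable_funM.
- by apply: filterS fg => x ->.
Qed.

Lemma sqint_eq_ae f g : sqint f -> measurable_fun setT g ->
  {ae mu, forall x, f x = g x} -> sqint g.
Proof.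
move=> [mf hf] mg fg; split=> //.
rewrite (@ae_eq_integral _ _ _ mu setT (fun x => (f x ^+ 2)%:E))//.
- by apply/measurable_EFinP; exact: measurable_funX.
- by apply/measurable_EFinP; exact: measurable_funX.
- by apply: filterS fg => x ->.
Qed.

Definition L2cvg (f_ : nat -> T -> R) f : Prop :=
  (fun k => ip (fun x => f_ k x - f x) (fun x => f_ k x - f x)) @ \oo --> 0.

(** Cauchy-Schwarz and a squeeze. An eventual bound on the second factor is enough, so that a
    sequence tending to zero qualifies too. *)
Lemma cvg0_ip (f_ g_ : nat -> T -> R) (M : R) :
  (forall k, sqint (f_ k)) -> (forall k, sqint (g_ k)) ->
  (fun k => ip (f_ k) (f_ k)) @ \oo --> 0 ->
  (\forall k \near \oo, ip (g_ k) (g_ k) <= M) ->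
  (fun k => ip (f_ k) (g_ k)) @ \oo --> 0.
Proof.
move=> hf hg f0 gM.
have p0 : (fun k => ip (f_ k) (f_ k) * `|M|) @ \oo --> 0.
  by rewrite -[X in _ --> X](mul0r `|M|); exact: cvgM f0 (cvg_cst _).
have s0 : (fun k => Num.sqrt (ip (f_ k) (f_ k) * `|M|)) @ \oo --> 0.
  have := cvg_comp _ _ p0 (@sqrt_continuous R 0).
  by rewrite sqrtr0.
apply/norm_cvg0P.
apply: (squeeze_cvgr _ (cvg_cst 0) s0).
near=> k; rewrite /= normr_ge0/= -sqrtr_sqr ler_wsqrtr//.
apply: le_trans (ip_cauchy_schwarz (hf k) (hg k)) _.
apply: ler_wpM2l; first exact: ip_ge0.
apply: le_trans (ler_norm M); near: k; exact: gM.
Unshelve. all: by end_near. Qed.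

Lemma ip_cvg (f_ g_ : nat -> T -> R) f g :
  (forall k, sqint (f_ k)) -> (forall k, sqint (g_ k)) -> sqint f -> sqint g ->
  L2cvg f_ f -> L2cvg g_ g -> (fun k => ip (f_ k) (g_ k)) @ \oo --> ip f g.
Proof.
move=> hf_ hg_ hf hg fc gc.
have hdf k : sqint (fun x => f_ k x - f x) by exact: sqintB.
have hdg k : sqint (fun x => g_ k x - g x) by exact: sqintB.
have E k : ip (f_ k) (g_ k) = ip (fun x => f_ k x - f x) (fun x => g_ k x - g x)
   + ip (fun x => f_ k x - f x) g + ip (fun x => g_ k x - g x) f + ip f g.
  rewrite (ipBl (hf_ k) hf (hdg k)) (ipBl (hf_ k) hf hg) (ipBl (hg_ k) hg hf).
  rewrite (ipBr (hg_ k) hg (hf_ k)) (ipBr (hg_ k) hg hf).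
  by rewrite (ipC (g_ k) f) (ipC g f); ring.
have c1 : (fun k => ip (fun x => f_ k x - f x) (fun x => g_ k x - g x)) @ \oo --> 0.
  apply: (@cvg0_ip _ _ 1) => //.
  near=> k; apply/ltW; near: k; exact: (cvgr_lt 0).
have c2 : (fun k => ip (fun x => f_ k x - f x) g) @ \oo --> 0.
  by apply: (@cvg0_ip _ _ (ip g g)) => //; exact: nearW.
have c3 : (fun k => ip (fun x => g_ k x - g x) f) @ \oo --> 0.
  by apply: (@cvg0_ip _ _ (ip f f)) => //; exact: nearW.
have -> : (fun k => ip (f_ k) (g_ k)) = fun k =>
    ip (fun x => f_ k x - f x) (fun x => g_ k x - g x) +
    ip (fun x => f_ k x - f x) g + ip (fun x => g_ k x - g x) f + ip f g.
  by apply/funext => k; exact: E.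
have e : ip f g = 0 + 0 + 0 + ip f g by rewrite !add0r.
rewrite [X in _ --> X]e.
by apply: cvgD; [apply: cvgD; [exact: cvgD|]|exact: cvg_cst].
Unshelve. all: by end_near. Qed.

Lemma L2cvg_cst f : L2cvg (fun=> f) f.
Proof.
rewrite /L2cvg; under eq_fun do under eq_fun do rewrite subrr.
by under eq_fun do rewrite ip0l; exact: cvg_cst.
Qed.

(** Square integrability of the limit is a conclusion: [f] differs from some [f_ k] by a function
    whose second moment is below 1. *)
Lemma L2cvg_ereal (f_ : nat -> T -> R) f :
  (forall k, sqint (f_ k)) -> measurable_fun setT f ->
  (fun k => \int[mu]_x ((f_ k x - f x) ^+ 2)%:E)%E @ \oo --> 0%E ->
  sqint f /\ L2cvg f_ f.
Proof.
move=> hf_ mf c0.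
have [k _ /(_ k (leqnn k)) hk] : \forall k \near \oo,
    (\int[mu]_x ((f_ k x - f x) ^+ 2)%:E < 1)%E.
  apply: (c0 [set e | (e < 1)%E]); apply: open_nbhs_nbhs; split; last exact: lte01.
  exact: open_ereal_lt_ereal.
have hf : sqint f.
  have -> : f = fun x => f_ k x - (f_ k x - f x).
    by apply/funext => x; rewrite subKr.
  apply: sqintB => //; split; last by rewrite (lt_trans hk)// ltry.
  by apply: measurable_funB => //; case: (hf_ k).
split => //.
have E j : (ip (fun x => f_ j x - f x) (fun x => f_ j x - f x))%:E =
    (\int[mu]_x ((f_ j x - f x) ^+ 2)%:E)%E.
  by rewrite EFin_ipff//; exact: sqintB.
rewrite /L2cvg; have : (fun k => (ip (fun x => f_ k x - f x) (fun x => f_ k x - f x))%:E)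
   @ \oo --> 0%:E by under eq_fun do rewrite E.
by move/fine_cvg.
Qed.
End SquareIntegrable.

(** * Products of functions of separate variables *)

Section ProductIntegral.
Context {d1 d2} {T1 : measurableType d1} {T2 : measurableType d2} {R : realType}.
Variables (m1 : {sigma_finite_measure set T1 -> \bar R})
  (m2 : {sigma_finite_measure set T2 -> \bar R}).

Lemma integrable_prod_mul (f : T1 -> R) (g : T2 -> R) :
  m1.-integrable setT (fun x => (f x)%:E) -> m2.-integrable setT (fun y => (g y)%:E) ->
  (m1 \x m2)%E.-integrable setT (fun z => (f z.1 * g z.2)%:E).
Proof.
move=> fi gi.
have mf : measurable_fun setT f by apply/measurable_EFinP; exact: measurable_int fi.
have mg : measurable_fun setT g by apply/measurable_EFinP; exact: measurable_int gi.
have mfa : measurable_fun setT (fun x => `|(f x)%:E|)%E.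
  by apply: measurableT_comp => //; exact: measurable_int fi.
have mga : measurable_fun setT (fun y => `|(g y)%:E|)%E.
  by apply: measurableT_comp => //; exact: measurable_int gi.
apply/integrable12ltyP.
  apply/measurable_EFinP; apply: measurable_funM; first exact: measurableT_comp.
  exact: measurableT_comp.
have E x : (\int[m2]_y `|(f x * g y)%:E| = `|(f x)%:E| * \int[m2]_y `|(g y)%:E|)%E.
  rewrite -ge0_integralZl//.
  by apply: eq_integral => y _; rewrite EFinM abseM.
under eq_integral do rewrite E.
rewrite ge0_integralZr//; last exact: integral_ge0.
rewrite lte_mul_pinfty//; first exact: integral_ge0.
- exact/(integrable_fin_num _ (integrable_abse fi)).
- exact: (integrable_lty _ (integrable_abse gi)).
Qed.

Lemma Rintegral_prod_mul (f : T1 -> R) (g : T2 -> R) :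
  m1.-integrable setT (fun x => (f x)%:E) -> m2.-integrable setT (fun y => (g y)%:E) ->
  \int[(m1 \x m2)%E]_z (f z.1 * g z.2) = (\int[m1]_x f x) * (\int[m2]_y g y).
Proof.
move=> fi gi; have fgi := integrable_prod_mul fi gi.
have gfin := integrable_fin_num measurableT gi.
rewrite /Rintegral -fineM ?integrable_fin_num//; congr fine.
rewrite -(integral12_prod_meas1 fgi) /fubini_F.
transitivity (\int[m1]_x ((f x)%:E * \int[m2]_y (g y)%:E))%E.
  apply: eq_integral => x _; rewrite -integralZl//.
by rewrite -(fineK gfin) integralZr.
Qed.

End ProductIntegral.

(** * Independence *)

Section MeasurableWrt.
Context {d} {T : measurableType d} {R : realType}.
Implicit Types (G : set (set T)) (X Y : T -> R).

(** Makes the closure properties of measurable functions available for [measurable_wrt], by changing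
    the sigma-algebra of the source space. *)
Lemma measurable_wrtP G X : sigma_algebra setT G ->
  measurable_wrt G X <->
  measurable_fun (setT : set (g_sigma_algebraType G)) (X : g_sigma_algebraType G -> R).
Proof.
move=> sG; have GE : <<s G >> = G by exact: sigma_algebra_id.
split=> h; first by move=> _ Y mY; rewrite setTI /measurable/= GE; exact: h.
move=> Y mY; have := h measurableT Y mY.
by rewrite setTI /measurable/= GE.
Qed.

Lemma measurable_wrt_fun G X : G `<=` measurable -> measurable_wrt G X ->
  measurable_fun setT X.
Proof. by move=> GT h _ Y mY; rewrite setTI; exact/GT/h. Qed.

Lemma measurable_wrtS G G' X : G `<=` G' -> measurable_wrt G X -> measurable_wrt G' X.
Proof. by move=> GG' h Y /h/GG'. Qed.

Lemma measurable_wrt_cst G c : sigma_algebra setT G -> measurable_wrt G (fun=> c : R).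
Proof. by move=> sG; apply/measurable_wrtP => //; exact: measurable_cst. Qed.

Lemma measurable_wrtD G X Y : sigma_algebra setT G ->
  measurable_wrt G X -> measurable_wrt G Y -> measurable_wrt G (fun w => X w + Y w).
Proof.
move=> sG /measurable_wrtP -/(_ sG) hX /measurable_wrtP -/(_ sG) hY.
by apply/measurable_wrtP => //; exact: measurable_funD.
Qed.

Lemma measurable_wrtM G X Y : sigma_algebra setT G ->
  measurable_wrt G X -> measurable_wrt G Y -> measurable_wrt G (fun w => X w * Y w).
Proof.
move=> sG /measurable_wrtP -/(_ sG) hX /measurable_wrtP -/(_ sG) hY.
by apply/measurable_wrtP => //; exact: measurable_funM.
Qed.

End MeasurableWrt.

Section Independence.
Context {d} {T : measurableType d} {R : realType} (P : probability T R).

(** The law of the pair agrees with the product of the two laws on rectangles, hence everywhere; the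
    rest is Fubini for the function [z.1 * z.2] under that product law. *)
Lemma independent_mul (G1 G2 : set (set T)) (X Y : T -> R) :
  G1 `<=` measurable -> G2 `<=` measurable ->
  (forall E E', G1 E -> G2 E' -> P (E `&` E') = (P E * P E')%E) ->
  measurable_wrt G1 X -> measurable_wrt G2 Y ->
  P.-integrable setT (fun w => (X w)%:E) -> P.-integrable setT (fun w => (Y w)%:E) ->
  P.-integrable setT (fun w => (X w * Y w)%:E) /\
  \int[P]_w (X w * Y w) = (\int[P]_w X w) * (\int[P]_w Y w).
Proof.
move=> G1m G2m ind wX wY iX iY.
have mX := measurable_wrt_fun G1m wX; have mY := measurable_wrt_fun G2m wY.
have mXY : measurable_fun setT (fun w => (X w, Y w)) by exact: measurable_fun_pair.
pose X' : {mfun T >-> R} := mfun_Sub (mem_set mX).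
pose Y' : {mfun T >-> R} := mfun_Sub (mem_set mY).
pose XY : {mfun T >-> (R * R)%type} := mfun_Sub (mem_set mXY).
pose f (z : R * R) : \bar R := (z.1 * z.2)%:E.
have mf : measurable_fun setT f.
  by apply/measurable_EFinP; exact: measurable_funM.
have prodE A : measurable A -> distribution P XY A = (distribution P X' \x distribution P Y')%E A.
  move=> mA; apply/esym.
  apply: (@product_measure_unique _ _ _ _ _ (distribution P X') (distribution P Y')
    (distribution P XY)) => //.
  by move=> B C mB mC; exact: ind (wX _ mB) (wY _ mC).
have iX' : (distribution P X').-integrable setT (EFin : R -> \bar R).
  by apply: integrable_pushforward => //; exact: iX.
have iY' : (distribution P Y').-integrable setT (EFin : R -> \bar R).
  by apply: integrable_pushforward => //; exact: iY.
have if2 := integrable_prod_mul iX' iY'.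
have EM (g : R * R -> \bar R) : (\int[distribution P XY]_z g z =
    \int[distribution P X' \x distribution P Y']_z g z)%E.
  by apply: eq_measure_integral => A mA _; exact: prodE.
have if1 : (distribution P XY).-integrable setT f.
  apply/integrableP; split => //.
  by rewrite EM; case/integrableP : if2.
have iXY : P.-integrable setT (f \o XY).
  apply/integrableP; split; first exact: measurableT_comp.
  case/integrableP : if1 => _.
  rewrite ge0_integral_distribution//.
  by apply: measurableT_comp.
split; first exact: iXY.
have EX : (\int[distribution P X']_y y%:E = \int[P]_w (X w)%:E)%E.
  exact: integral_distribution.
have EY : (\int[distribution P Y']_y y%:E = \int[P]_w (Y w)%:E)%E.
  exact: integral_distribution.
have := Rintegral_prod_mul iX' iY'; rewrite /Rintegral EX EY => <-; congr fine.
by rewrite -[LHS](integral_distribution mf iXY) EM.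
Qed.

End Independence.

Section BoundedFactor.
Context {d} {T : measurableType d} {R : realType}.
Variable mu : {measure set T -> \bar R}.

Lemma sqint_bounded_mul (f g : T -> R) M : measurable_fun setT g ->
  (forall x, `|g x| <= M) -> sqint mu f -> sqint mu (fun x => g x * f x).
Proof.
move=> mg gM hf; have mf := sqint_measurable hf.
apply: (sqint_le _ (sqintZ M hf)); first exact: measurable_funM.
move=> x; rewrite !normrM ler_wpM2r// (le_trans (gM x))//.
by rewrite ler_norm.
Qed.

Lemma integrable_bounded_mul (f g : T -> R) M : measurable_fun setT g ->
  (forall x, `|g x| <= M) -> mu.-integrable setT (fun x => (f x)%:E) ->
  mu.-integrable setT (fun x => (g x * f x)%:E).
Proof.
move=> mg gM hf.
have mf : measurable_fun setT f by apply/measurable_EFinP; exact: measurable_int hf.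
have hMf : mu.-integrable setT (fun x => (M * f x)%:E).
  by apply: eq_integrable (integrableZl measurableT M hf).
apply: le_integrable hMf => //.
  by apply/measurable_EFinP; exact: measurable_funM.
move=> x _; rewrite /= lee_fin !normrM ler_wpM2r// (le_trans (gM x))//.
by rewrite ler_norm.
Qed.

End BoundedFactor.

Section FiniteMeasure.
Context {d} {T : measurableType d} {R : realType} (P : probability T R).

Lemma sqint_cst (c : R) : sqint P (fun=> c).
Proof.
split => //; apply: integrable_lty => //.
exact: (finite_measure_integrable_cst P (c ^+ 2)).
Qed.

Lemma sqint_integrable (f : T -> R) : sqint P f -> P.-integrable setT (fun x => (f x)%:E).
Proof.
move=> hf; have := sqint_mul (sqint_cst 1) hf.
by under eq_fun do rewrite mul1r.
Qed.

Lemma bounded_sqint (f : T -> R) M : measurable_fun setT f -> (forall x, `|f x| <= M) ->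
  sqint P f.
Proof.
move=> mf fM; have := sqint_bounded_mul mf fM (sqint_cst 1).
by under eq_fun do rewrite mulr1.
Qed.

End FiniteMeasure.

(** * Wiener increments *)

Section WienerIncrements.
Context {R : realType} {d : measure_display} {Omega : measurableType d}.
Variables (Pr : probability Omega R) (F : R -> set (set Omega)).
Variables (q : nat) (K : 'M[R]_q) (W : R -> Omega -> 'cV[R]_q).
Hypotheses (hF : usual_filtration Pr F) (hW : wiener Pr F K W).

Lemma filtration_sigma (t : R) : 0 <= t -> sigma_algebra setT (F t).
Proof. by move=> t0; have [h _ _ _ _] := hF; exact: h. Qed.

Lemma filtration_measurable (t : R) : 0 <= t -> F t `<=` measurable.
Proof. by move=> t0; have [_ h _ _ _] := hF; exact: h. Qed.

Lemma filtrationS (s t : R) : 0 <= s -> s <= t -> F s `<=` F t.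
Proof. by move=> s0 st; have [_ _ h _ _] := hF; exact: h. Qed.

Lemma wiener_wrt i (t : R) : 0 <= t -> measurable_wrt (F t) (fun w => W t w i 0).
Proof.
move=> t0; have [h _ _ _ _] := hW; have [h1 _] := h i.
by apply: h1; rewrite /halfline/= in_itv/= t0.
Qed.

Lemma wiener_sqint i (t : R) : 0 <= t -> sqint Pr (fun w => W t w i 0).
Proof.
move=> t0; split.
  exact: measurable_wrt_fun (filtration_measurable t0) (wiener_wrt i t0).
have [_ _ /(_ t t0) [_ h] _ _] := hW.
suff -> : (\int[Pr]_w (W t w i 0 ^+ 2)%:E = (t * K i i)%:E)%E by rewrite ltry.
by rewrite -h unlock; apply: eq_integral => w _; rewrite expr2.
Qed.

Lemma wiener_cov (t : R) i j : 0 <= t ->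
  ip Pr (fun w => W t w i 0) (fun w => W t w j 0) = t * K i j.
Proof.
move=> t0; have [_ _ /(_ t t0) [_ h] _ _] := hW.
by have := h i j; rewrite unlock /ip /Rintegral => ->.
Qed.

Definition incr i s t w : R := W t w i 0 - W s w i 0.

Lemma incr_sqint i (s t : R) : 0 <= s -> s <= t -> sqint Pr (incr i s t).
Proof. by move=> s0 st; apply: sqintB; apply: wiener_sqint => //; exact: le_trans st. Qed.

Let sigI s t := sigma_rv (fun w => W t w - W s w).

Let sigI_incr i s t : measurable_wrt (sigI s t) (incr i s t).
Proof.
move=> Y mY; apply: sub_sigma_algebra; exists i, Y; split => //.
by apply/seteqP; split => w /=; rewrite /incr !mxE.
Qed.

Let sigI_sigma s t : sigma_algebra setT (sigI s t).
Proof. exact: smallest_sigma_algebra. Qed.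

Let sigI_measurable (s t : R) : 0 <= s -> s <= t -> sigI s t `<=` measurable.
Proof.
move=> s0 st; apply: smallest_sub; first exact: sigma_algebra_measurable.
move=> _ [i [Y [mY ->]]].
have := (sqint_measurable (incr_sqint i s0 st)) measurableT Y mY.
rewrite setTI; congr (measurable _).
by apply/seteqP; split => w /=; rewrite /incr !mxE.
Qed.

Let incr_indep (s t : R) E E' : 0 <= s -> s <= t -> F s E -> sigI s t E' ->
  Pr (E `&` E') = (Pr E * Pr E')%E.
Proof.
move=> s0 st hE; have [_ _ _ _ h] := hW.
have ts : 0 <= t - s by rewrite subr_ge0.
by have := h s (t - s) s0 ts E E' hE; rewrite [s + _]addrC subrK; apply.
Qed.

Lemma Rintegral_wiener (t : R) i : 0 <= t -> \int[Pr]_w W t w i 0 = 0.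
Proof.
move=> t0; have [_ _ /(_ t t0) [h _] _ _] := hW.
by have := h i; rewrite unlock /Rintegral => ->.
Qed.

(** The increment is independent of [F s], so the expectation factors, and it is centred. *)
Lemma incr_mul i (s t : R) Y : 0 <= s -> s <= t -> measurable_wrt (F s) Y ->
  Pr.-integrable setT (fun w => (Y w)%:E) ->
  Pr.-integrable setT (fun w => (Y w * incr i s t w)%:E) /\
  \int[Pr]_w (Y w * incr i s t w) = 0.
Proof.
move=> s0 st wY iY; have t0 := le_trans s0 st.
have [h ->] := independent_mul (filtration_measurable s0) (sigI_measurable s0 st)
  (fun E E' => @incr_indep s t E E' s0 st) wY (@sigI_incr i s t) iY
  (sqint_integrable (incr_sqint i s0 st)).
split => //; rewrite RintegralB//; [|exact/sqint_integrable/wiener_sqint..].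
by rewrite !Rintegral_wiener// subrr mulr0.
Qed.

(** Expand [W t] as [W s] plus the increment in the known covariance at time [t]; the mixed terms
    vanish by [incr_mul]. *)
Lemma incr_cov i j (s t : R) : 0 <= s -> s <= t ->
  \int[Pr]_w (incr i s t w * incr j s t w) = (t - s) * K i j.
Proof.
move=> s0 st; have t0 := le_trans s0 st.
have hi := incr_sqint i s0 st; have hj := incr_sqint j s0 st.
have wi := wiener_sqint i s0; have wj := wiener_sqint j s0.
have E := wiener_cov i j t0.
have Ei : (fun w => W t w i 0) = (fun w => W s w i 0 + incr i s t w).
  by apply/funext => w; rewrite /incr addrC subrK.
have Ej : (fun w => W t w j 0) = (fun w => W s w j 0 + incr j s t w).
  by apply/funext => w; rewrite /incr addrC subrK.
rewrite Ei Ej (ipDl wi hi (sqintD wj hj)) (ipDr wj hj wi) (ipDr wj hj hi) in E.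
have [_ C1] : _ /\ ip Pr (fun w => W s w i 0) (incr j s t) = 0 := incr_mul j s0 st (wiener_wrt i s0) (sqint_integrable wi).
have [_ C2] : _ /\ ip Pr (fun w => W s w j 0) (incr i s t) = 0 := incr_mul i s0 st (wiener_wrt j s0) (sqint_integrable wj).
rewrite -/(ip _ (incr i s t) (incr j s t)).
move: E; rewrite wiener_cov// (ipC _ (incr i s t) (fun w => W s w j 0)).
by rewrite C1 C2; lra.
Qed.

Lemma incr_mul2 i j (s t : R) Y : 0 <= s -> s <= t -> measurable_wrt (F s) Y ->
  Pr.-integrable setT (fun w => (Y w)%:E) ->
  \int[Pr]_w (Y w * (incr i s t w * incr j s t w)) = (\int[Pr]_w Y w) * ((t - s) * K i j).
Proof.
move=> s0 st wY iY; rewrite -(incr_cov i j s0 st).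
have wij := measurable_wrtM (sigI_sigma s t) (@sigI_incr i s t) (@sigI_incr j s t).
by have [_ ->] := independent_mul (filtration_measurable s0) (sigI_measurable s0 st)
  (fun E E' => @incr_indep s t E E' s0 st) wY wij iY
  (sqint_mul (incr_sqint i s0 st) (incr_sqint j s0 st)).
Qed.

(** The sum is the expectation of $V^T X V$ for the random vector $V = \sum_i W_i(1) a_i$. This is
    the source of the hypothesis [Kpsd], through which the algebraic sections below see the
    covariance matrix. *)
Lemma psd_covariance k (X : 'M[R]_k) (a : 'I_q -> 'cV[R]_k) : posdef X ->
  0 <= \sum_i \sum_j K i j * ((a i)^T *m X *m a j) 0 0.
Proof.
move=> [_ pX].
pose V w := \sum_i (W 1 w i 0 *: a i).
have e : \sum_i \sum_j K i j * ((a i)^T *m X *m a j) 0 0 = \int[Pr]_w quad X (V w).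
  have wi i := wiener_sqint i (@ler01 R).
  have -> : (fun w => quad X (V w)) = fun w => \sum_i (W 1 w i 0 *
      \sum_j ((a i)^T *m X *m a j) 0 0 * W 1 w j 0).
    apply/funext => w; rewrite /quad.
    have -> : (V w)^T = \sum_i (W 1 w i 0 *: (a i)^T).
      by rewrite /V raddf_sum; apply: eq_bigr => i _; apply/matrixP => k' l; rewrite !mxE.
    rewrite /V mulmx_suml mulmx_suml summxE.
    apply: eq_bigr => i _; rewrite mulmx_sumr summxE mulr_sumr; apply: eq_bigr => j _.
    rewrite -!scalemxAl -scalemxAr scalerA [LHS]mxE; ring.
  have wa i : sqint Pr (fun w => \sum_j ((a i)^T *m X *m a j) 0 0 * W 1 w j 0).
    by apply: sqint_sum => j; exact: sqintZ.
  rewrite Rintegral_sum//; last by move=> i; exact: sqint_mul.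
  apply: eq_bigr => i _.
  rewrite -/(ip Pr (fun w => W 1 w i 0) (fun w => \sum_j _ * W 1 w j 0)).
  rewrite ip_sumr//; last by move=> j; exact: sqintZ.
  by apply: eq_bigr => j _; rewrite ipZr// wiener_cov// mul1r mulrC.
rewrite e; apply: Rintegral_ge0 => w _.
have [->|/pX/ltW//] := eqVneq (V w) 0.
by rewrite /quad mulmx0 mxE.
Qed.
End WienerIncrements.

(** * Ito isometry *)

Notation time_prob Pr := (product_measure1 lebesgue_measure Pr).

Section TimeMeasure.
Context {R : realType} {d : measure_display} {Omega : measurableType d}.
Variable Pr : probability Omega R.
Implicit Types (D : set R) (H : R -> Omega -> R).

(* Processes on a time set [D] are extended by [0], so that a single measure
   serves for all horizons. *)
Definition cut D H (z : R * Omega) : R := \1_D z.1 * H z.1 z.2.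

Lemma measurable_upto (t : R) : measurable (upto t).
Proof. exact: measurable_itv. Qed.

Lemma measurable_halfline : measurable (halfline : set R).
Proof. exact: measurable_itv. Qed.

Lemma uptoP (t s : R) : upto t s <-> 0 <= s <= t.
Proof. by rewrite /upto/= in_itv. Qed.

Lemma measurable_cut D H : measurable D ->
  measurable_fun (D `*` setT) (fun z : R * Omega => H z.1 z.2) ->
  measurable_fun setT (cut D H).
Proof.
move=> mD mH; have mD' : measurable (D `*` (setT : set Omega)) by exact: measurableX.
have := (measurable_restrictT _ mD').1 mH.
congr (measurable_fun _ _); apply/funext => z; rewrite /cut patchE indicE.
have -> : (z \in D `*` (setT : set Omega)) = (z.1 \in D).
  by apply/idP/idP => /set_mem; rewrite /setX/= => h; apply: mem_set => //; case: h.
by case: (_ \in _); rewrite ?mul1r ?mul0r.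
Qed.

Lemma integral_cut D H : measurable D ->
  measurable_fun (D `*` setT) (fun z : R * Omega => H z.1 z.2) ->
  (forall s w, 0 <= H s w) ->
  (\int[Pr]_w \int[lebesgue_measure]_(s in D) (H s w)%:E =
   \int[time_prob Pr]_z (cut D H z)%:E)%E.
Proof.
move=> mD mH H0.
rewrite (@fubini_tonelli2 _ _ _ _ _ lebesgue_measure Pr (fun z => (cut D H z)%:E)).
- apply: eq_integral => w _; rewrite integral_mkcond; apply: eq_integral => s _.
  rewrite patchE /cut/= indicE; case: (_ \in _); rewrite ?mul1r ?mul0r//.
- by apply/measurable_EFinP; exact: measurable_cut.
- by move=> z; rewrite lee_fin mulr_ge0// indicE ler0n.
Qed.

Lemma integral_cut_sqr D H : measurable D ->
  measurable_fun (D `*` setT) (fun z : R * Omega => H z.1 z.2) ->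
  (\int[Pr]_w \int[lebesgue_measure]_(s in D) (H s w ^+ 2)%:E =
   \int[time_prob Pr]_z (cut D H z ^+ 2)%:E)%E.
Proof.
move=> mD mH; rewrite (@integral_cut D (fun s w => H s w ^+ 2)) //.
- apply: eq_integral => z _; rewrite /cut exprMn indicE.
  by case: (_ \in _); rewrite ?expr1n ?expr0n.
- exact: measurable_funX.
- by move=> s w; exact: sqr_ge0.
Qed.

Lemma cutD D H H' : cut D (fun s w => H s w + H' s w) = fun z => cut D H z + cut D H' z.
Proof. by apply/funext => z; rewrite /cut mulrDr. Qed.

Lemma cutB D H H' : cut D (fun s w => H s w - H' s w) = fun z => cut D H z - cut D H' z.
Proof. by apply/funext => z; rewrite /cut mulrBr. Qed.

Lemma cutZ D a H : cut D (fun s w => a * H s w) = fun z => a * cut D H z.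
Proof. by apply/funext => z; rewrite /cut mulrCA. Qed.

Lemma cut_sum D I (r : seq I) (H : I -> R -> Omega -> R) :
  cut D (fun s w => \sum_(i <- r) H i s w) = fun z => \sum_(i <- r) cut D (H i) z.
Proof. by apply/funext => z; rewrite /cut mulr_sumr. Qed.

Lemma lebesgue_upto_lty (t : R) : (lebesgue_measure (upto t) < +oo)%E.
Proof. by rewrite /upto lebesgue_measure_itv/=; case: ifP => _; rewrite -?EFinD ltry. Qed.

Lemma integrable_indic_upto (D : set R) t : measurable D -> D `<=` upto t ->
  lebesgue_measure.-integrable setT (fun s => (\1_D s)%:E : \bar R).
Proof.
move=> mD Dt; apply/integrableP; split.
  by apply/measurable_EFinP; exact: measurable_indic.
under eq_integral do rewrite gee0_abs ?lee_fin ?indicE ?ler0n//.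
rewrite integral_indic// setIT; apply: le_lt_trans (lebesgue_upto_lty t); apply: le_measure => //; rewrite inE//.
exact: measurable_upto.
Qed.

End TimeMeasure.

(** * Isometry and martingale property for elementary processes *)

Section ElementaryProcesses.
Context {R : realType} {d : measure_display} {Omega : measurableType d}.
Variables (Pr : probability Omega R) (F : R -> set (set Omega)).
Variables (q : nat) (K : 'M[R]_q) (W : R -> Omega -> 'cV[R]_q).
Hypotheses (hF : usual_filtration Pr F) (hW : wiener Pr F K W).

(* The elementary process [xi 1_]c, +oo[] and its stochastic integral: simple
   processes are linear combinations of these, and a pair of half-lines needs
   fewer case distinctions than a pair of bounded intervals. *)
Definition elem (c : R) (xi : Omega -> R) (s : R) (w : Omega) : R :=
  \1_(`]c, +oo[) s * xi w.

Definition elem_int i (c : R) (xi : Omega -> R) (t : R) (w : Omega) : R :=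
  xi w * incr W i (Num.min c t) t w.

Definition elem_adapted c (xi : Omega -> R) : Prop :=
  [/\ 0 <= c, measurable_wrt (F c) xi & exists M, forall w, `|xi w| <= M].

Lemma elem_measurable c xi : elem_adapted c xi -> measurable_fun setT xi.
Proof.
by move=> [c0 wxi _]; exact: measurable_wrt_fun (filtration_measurable hF c0) wxi.
Qed.

Lemma elem_sqint_coef c xi : elem_adapted c xi -> sqint Pr xi.
Proof.
by move=> h; have [_ _ [M]] := h; apply: bounded_sqint; exact: elem_measurable h.
Qed.

Lemma elem_int_sqint i c xi t : 0 <= t -> elem_adapted c xi ->
  sqint Pr (elem_int i c xi t).
Proof.
move=> t0 h; have [c0 _ [M xiM]] := h.
apply: (sqint_bounded_mul (elem_measurable h) xiM).
by apply: (incr_sqint hF hW); rewrite ?le_min ?c0// ge_min lexx orbT.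
Qed.

Lemma elem_jointly_measurable c xi : elem_adapted c xi ->
  measurable_fun setT (fun z : R * Omega => elem c xi z.1 z.2).
Proof.
move=> h; apply: measurable_funM.
  have mi : measurable_fun setT (\1_(`]c, +oo[%classic) : R -> R).
    by apply: measurable_indic; exact: measurable_itv.
  exact: measurableT_comp mi measurable_fst.
exact: measurableT_comp (elem_measurable h) measurable_snd.
Qed.

Lemma cut_elem_sqint c xi t : elem_adapted c xi ->
  sqint (time_prob Pr) (cut (upto t) (elem c xi)).
Proof.
move=> h; have mc : measurable_fun setT (cut (upto t) (elem c xi)).
  apply: measurable_cut; first exact: measurable_upto.
  by apply: measurable_funTS; exact: elem_jointly_measurable.
split => //.
have i1 := integrable_indic_upto (measurable_upto t) (@subset_refl _ (upto t)).
have i2 := sqint_integrable_sqr (elem_sqint_coef h).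
have := integrable_lty measurableT (integrable_prod_mul i1 i2).
apply: le_lt_trans; apply: ge0_le_integral => //.
- by move=> z _; rewrite lee_fin sqr_ge0.
- by apply/measurable_EFinP; exact: measurable_funX.
- exact: measurable_int (integrable_prod_mul i1 i2).
- move=> z _; rewrite lee_fin /cut /elem !indicE.
  case: (_ \in _); case: (_ \in _); rewrite ?mul0r ?mul1r ?expr0n//= ?mul1r//.
  by rewrite sqr_ge0.
Qed.

Lemma elem_mul_wrt a c xi eta : elem_adapted a xi -> elem_adapted c eta -> a <= c ->
  elem_adapted c (fun w => xi w * eta w).
Proof.
move=> [a0 wa [M hM]] [c0 wc [M' hM']] ac; split => //.
  apply: measurable_wrtM => //; first exact: filtration_sigma hF _ _.
  exact: measurable_wrtS (filtrationS hF a0 ac) wa.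
exists (M * M') => w; rewrite normrM ler_pM//.
Qed.

(** Let [c] be the later of the two starting times. The part of the first integral collected before
    [c] is [F c]-measurable, hence orthogonal to the increment after [c]. On the common interval
    from [c] to [t] the product of increments is independent of [F c] with mean $(t - c) K_{ij}$. If
    $t \le c$ both sides vanish. *)
Lemma elem_isometry i j a c xi eta t : 0 <= t ->
  elem_adapted a xi -> elem_adapted c eta ->
  ip Pr (elem_int i a xi t) (elem_int j c eta t) =
  K i j * ip (time_prob Pr) (cut (upto t) (elem a xi)) (cut (upto t) (elem c eta)).
Proof.
have Ksym : K i j = K j i.
  have := wiener_cov hW i j (@ler01 R); rewrite ipC (wiener_cov hW) ?ler01//.
  by rewrite !mul1r => ->.
move=> t0.
wlog ac : i j a c xi eta Ksym / a <= c.
  move=> H ha hc; have [ac|/ltW ca] := leP a c; first exact: H.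
  by rewrite ipC (H j i c a)// Ksym ipC.
move=> ha hc; have hac := elem_mul_wrt ha hc ac.
have [a0 wa _] := ha; have [c0 wc _] := hc; have [_ wac _] := hac.
have iac := sqint_integrable (elem_sqint_coef hac).
pose D := upto t `&` `]c, +oo[.
have mD : measurable D by apply: measurableI; [exact: measurable_upto|exact: measurable_itv].
have -> : ip (time_prob Pr) (cut (upto t) (elem a xi)) (cut (upto t) (elem c eta)) =
    (\int[lebesgue_measure]_s \1_D s) * \int[Pr]_w (xi w * eta w).
  rewrite -Rintegral_prod_mul//; last exact: (integrable_indic_upto mD (@subIsetl _ _ _)).
  apply: eq_Rintegral => z _; rewrite /cut /elem /D.
  rewrite indicI/= !indicE.
  have [zc|zc] := boolP (z.1 \in `]c, +oo[%classic); last by rewrite !(mulr0,mul0r).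
  have -> : (z.1 \in `]a, +oo[%classic) = true.
    move: zc => /set_mem/=; rewrite in_itv/= andbT => zc.
    by apply: mem_set; rewrite /= in_itv/= andbT (le_lt_trans ac).
  by case: (_ \in _); rewrite ?mulr1 ?mul1r ?(mul0r,mulr0).
have [tc|ct] := leP t c.
  have -> : D = set0.
    apply/seteqP; split => // s [/uptoP/andP[_ st]]; rewrite /= in_itv/= andbT => cs.
    by have := lt_le_trans cs (le_trans st tc); rewrite ltxx.
  rewrite indic0 /ip /elem_int (min_idPr tc).
  under eq_Rintegral do rewrite [incr _ j _ _ _]/incr subrr !mulr0.
  rewrite !Rintegral_cst ?mul0r ?mulr0//.
have at_ : a <= t by exact: le_trans ac (ltW ct).
have -> : \int[lebesgue_measure]_s \1_D s = t - c.
  rewrite /Rintegral integral_indic// setIT.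
  have -> : D = `]c, t]%classic.
    apply/seteqP; split=> s; rewrite /D/=; last first.
      rewrite in_itv/= => /andP[cs st]; split; rewrite /upto/= ?in_itv/= ?cs ?st//.
      by rewrite (le_trans c0 (ltW cs)).
    by move=> [/uptoP/andP[_ st]]; rewrite /= !in_itv/= andbT st => ->.
  have L : lebesgue_measure (`]c, t]%classic : set R) = (t - c)%:E.
    by rewrite lebesgue_measure_itv/= lte_fin ct.
  exact: (congr1 fine L).
have ->: ip Pr (elem_int i a xi t) (elem_int j c eta t) =
  \int[Pr]_w ((xi w * eta w) * (incr W i c t w * incr W j c t w)
     + (xi w * eta w * incr W i a c w) * incr W j c t w).
  apply: eq_Rintegral => w _; rewrite /elem_int (min_idPl at_) (min_idPl (ltW ct)).
  by rewrite /incr; ring.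
have hia := incr_sqint hF hW i a0 ac.
have wia : measurable_wrt (F c) (fun w => xi w * eta w * incr W i a c w).
  apply: measurable_wrtM => //; first exact: filtration_sigma hF _ _.
  apply: measurable_wrtD; first exact: filtration_sigma hF _ _.
    exact: wiener_wrt hW _ _ c0.
  under eq_fun do rewrite -mulN1r.
  apply: measurable_wrtM; first exact: filtration_sigma hF _ _.
    exact: measurable_wrt_cst (filtration_sigma hF c0).
  exact: measurable_wrtS (filtrationS hF a0 ac) (wiener_wrt hW _ a0).
have [M hM] : exists M, forall w, `|xi w * eta w| <= M by case: hac.
have iia := integrable_bounded_mul (elem_measurable hac) hM (sqint_integrable hia).
have [ii1 e1] := incr_mul hF hW j c0 (ltW ct) wia iia.
rewrite RintegralD//; last first.
  apply: (integrable_bounded_mul (elem_measurable hac) hM).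
  by apply: sqint_mul; apply: (incr_sqint hF hW) => //; exact: ltW.
rewrite e1 addr0 (incr_mul2 hF hW)//; last exact: ltW.
ring.
Qed.

Lemma elem_martingale i c xi s t Y : 0 <= s -> s <= t ->
  elem_adapted c xi -> measurable_wrt (F s) Y -> sqint Pr Y ->
  ip Pr Y (elem_int i c xi t) = ip Pr Y (elem_int i c xi s).
Proof.
move=> s0 st h wY hY; have t0 := le_trans s0 st.
have [c0 wc [M xiM]] := h.
have ht := elem_int_sqint i t0 h; have hs := elem_int_sqint i s0 h.
apply/eqP; rewrite -subr_eq0 -ipBr//; apply/eqP.
have [tc|ct] := leP t c.
  rewrite /ip; under eq_Rintegral do
    rewrite /elem_int (min_idPr tc) (min_idPr (le_trans st tc)) /incr !subrr mulr0.
  by rewrite Rintegral_cst ?mul0r.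
(* The integrals up to [t] and up to [s] differ by [xi] times the increment over []b, t]], and both
   [xi] and [Y] are measurable with respect to [F b]. *)
pose b := Num.max c s.
have b0 : 0 <= b by rewrite le_max c0.
have bt : b <= t by rewrite ge_max (ltW ct).
have wYb : measurable_wrt (F b) (fun w => xi w * Y w).
  apply: measurable_wrtM; first exact: filtration_sigma hF _ _.
    by apply: measurable_wrtS wc; apply: (filtrationS hF) => //; rewrite le_max lexx.
  by apply: measurable_wrtS wY; apply: (filtrationS hF) => //; rewrite le_max lexx orbT.
have iY := sqint_integrable (sqint_bounded_mul (elem_measurable h) xiM hY).
have [_ <-] := incr_mul hF hW i b0 bt wYb iY.
apply: eq_Rintegral => w _; rewrite /elem_int (min_idPl (ltW ct)) /b.
by case: (leP c s) => cs; rewrite /incr; ring.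
Qed.

End ElementaryProcesses.

(** * From simple processes to the Ito integral *)

Section ItoIntegral.
Context {R : realType} {d : measure_display} {Omega : measurableType d}.
Variables (Pr : probability Omega R) (F : R -> set (set Omega)).
Variables (q : nat) (K : 'M[R]_q) (W : R -> Omega -> 'cV[R]_q).
Hypotheses (hF : usual_filtration Pr F) (hW : wiener Pr F K W).
Implicit Types (S : @simple_process R d Omega) (t : R) (i : 'I_q).

Let b i s w : R := W s w i 0.

(** The indicator of $]t_j, t_{j+1}]$ is a difference of two half-line indicators. The flag [true]
    stands for the left end, with coefficient $\xi_j$, and [false] for the right end, with
    coefficient $-\xi_j$. *)
Definition jump_time S (p : 'I_(sp_size S) * bool) : R :=
  sp_time S (if p.2 then p.1 : nat else p.1.+1).

Definition jump_coef S (p : 'I_(sp_size S) * bool) (w : Omega) : R :=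
  if p.2 then sp_coef S p.1 w else - sp_coef S p.1 w.

Lemma sp_time_ge0 S (j : nat) : simple_adapted F S -> 0 <= sp_time S j.
Proof.
move=> [h0 h1 _ _]; elim: j => [|j IH] //; apply: le_trans IH _; exact: h1.
Qed.

Lemma jump_adapted S p : simple_adapted F S ->
  elem_adapted F (@jump_time S p) (@jump_coef S p).
Proof.
move=> h; have [h0 h1 h2 h3] := h; case: p => j [] /=; rewrite /jump_time /jump_coef /=.
  by split => //; exact: sp_time_ge0.
have s1 := filtration_sigma hF (sp_time_ge0 j.+1 h).
split; first exact: sp_time_ge0.
  under eq_fun do rewrite -mulN1r.
  apply: measurable_wrtM => //; first exact: measurable_wrt_cst.
  exact: measurable_wrtS (filtrationS hF (sp_time_ge0 j h) (h1 j)) (h2 j).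
by have [M hM] := h3 j; exists M => w; rewrite normrN.
Qed.

Lemma simple_valE S : simple_adapted F S ->
  simple_val S = fun s w => \sum_p elem (@jump_time S p) (@jump_coef S p) s w.
Proof.
move=> h; have [_ h1 _ _] := h; apply/funext => s; apply/funext => w.
rewrite /simple_val -(pair_bigA _ (fun j c => elem (jump_time (j, c)) (jump_coef (j, c)) s w))/=.
apply: eq_bigr => j _; rewrite big_bool/= /elem /jump_time /jump_coef/=.
rewrite mulrN mulrC -mulrBl; congr (_ * _).
rewrite !indicE !mem_setE !in_itv/= !andbT.
have [s1|s1] := ltP (sp_time S j) s; have [s2|s2] := leP s (sp_time S j.+1); rewrite ?subr0 ?subrr//.
by have := lt_le_trans s2 (le_trans s1 (h1 j)); rewrite ltxx.
Qed.

Lemma simple_integralE i S t :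
  simple_integral (b i) S t = fun w => \sum_p elem_int W i (@jump_time S p) (@jump_coef S p) t w.
Proof.
apply/funext => w.
rewrite /simple_integral -(pair_bigA _ (fun j c => elem_int W i (jump_time (j, c)) (jump_coef (j, c)) t w))/=.
apply: eq_bigr => j _; rewrite big_bool/= /elem_int /jump_time /jump_coef/= /incr /b.
by ring.
Qed.

Lemma cut_simple_val_sqint S t : simple_adapted F S ->
  sqint (time_prob Pr) (cut (upto t) (simple_val S)).
Proof.
move=> h; rewrite simple_valE// cut_sum; apply: sqint_sum => p.
exact: (cut_elem_sqint hF t (jump_adapted p h)).
Qed.

Lemma simple_integral_sqint i S t : 0 <= t -> simple_adapted F S ->
  sqint Pr (simple_integral (b i) S t).
Proof.
move=> t0 h; rewrite simple_integralE; apply: sqint_sum => p.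
exact: (elem_int_sqint hF hW _ t0 (jump_adapted p h)).
Qed.

Lemma simple_isometry i (j : 'I_q) S S' t : 0 <= t -> simple_adapted F S -> simple_adapted F S' ->
  ip Pr (simple_integral (b i) S t) (simple_integral (b j) S' t) =
  K i j * ip (time_prob Pr) (cut (upto t) (simple_val S)) (cut (upto t) (simple_val S')).
Proof.
move=> t0 h h'; rewrite !simple_integralE !simple_valE// !cut_sum.
have e1 p : sqint Pr (elem_int W i (@jump_time S p) (@jump_coef S p) t).
  exact: (elem_int_sqint hF hW _ t0 (jump_adapted p h)).
have e2 p : sqint Pr (elem_int W j (@jump_time S' p) (@jump_coef S' p) t).
  exact: (elem_int_sqint hF hW _ t0 (jump_adapted p h')).
have c1 p : sqint (time_prob Pr) (cut (upto t) (elem (@jump_time S p) (@jump_coef S p))).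
  exact: (cut_elem_sqint hF t (jump_adapted p h)).
have c2 p : sqint (time_prob Pr) (cut (upto t) (elem (@jump_time S' p) (@jump_coef S' p))).
  exact: (cut_elem_sqint hF t (jump_adapted p h')).
rewrite ip_suml//; last exact: sqint_sum.
rewrite [in RHS]ip_suml//; last exact: sqint_sum.
rewrite mulr_sumr; apply: eq_bigr => p _.
rewrite ip_sumr// [in RHS]ip_sumr// mulr_sumr; apply: eq_bigr => p' _.
exact: (elem_isometry hF hW i j t0 (jump_adapted p h) (jump_adapted p' h')).
Qed.

Lemma simple_martingale i S s t Y : 0 <= s -> s <= t -> simple_adapted F S ->
  measurable_wrt (F s) Y -> sqint Pr Y ->
  ip Pr Y (simple_integral (b i) S t) = ip Pr Y (simple_integral (b i) S s).
Proof.
move=> s0 st h wY hY; rewrite !simple_integralE.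
have et p : sqint Pr (elem_int W i (@jump_time S p) (@jump_coef S p) t).
  exact: (elem_int_sqint hF hW _ (le_trans s0 st) (jump_adapted p h)).
have es p : sqint Pr (elem_int W i (@jump_time S p) (@jump_coef S p) s).
  exact: (elem_int_sqint hF hW _ s0 (jump_adapted p h)).
rewrite ip_sumr// [RHS]ip_sumr//.
by apply: eq_bigr => p _; exact: (elem_martingale hF hW i s0 st (jump_adapted p h) wY hY).
Qed.

(** Moves the two limits in [ito_integral] to inner products. Square integrability of the integrand
    and of the integral follows from that of the approximants. *)
Lemma ito_approximation i H t J : 0 <= t ->
  measurable_fun (upto t `*` setT) (fun z : R * Omega => H z.1 z.2) ->
  ito_integral Pr F (b i) H t J ->
  [/\ sqint (time_prob Pr) (cut (upto t) H), sqint Pr J &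
   exists S_ : nat -> simple_process,
    [/\ forall k, simple_adapted F (S_ k),
      L2cvg (time_prob Pr) (fun k => cut (upto t) (simple_val (S_ k))) (cut (upto t) H) &
      L2cvg Pr (fun k => simple_integral (b i) (S_ k) t) J]].
Proof.
move=> t0 mH [mJ [S_ [aS c1 c2]]].
have mu_t := measurable_upto t.
have mSv k : measurable_fun setT (fun z : R * Omega => simple_val (S_ k) z.1 z.2).
  rewrite simple_valE//; apply: measurable_sum => p.
  exact: (elem_jointly_measurable hF (jump_adapted p (aS k))).
have c1' : (fun k => \int[time_prob Pr]_z
    ((cut (upto t) (simple_val (S_ k)) z - cut (upto t) H z) ^+ 2)%:E)%E @ \oo --> 0%E.
  rewrite (_ : (fun k => _) = fun k =>
      (\int[Pr]_w \int[lebesgue_measure]_(s in upto t)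
         ((simple_val (S_ k) s w - H s w) ^+ 2)%:E)%E) //.
  apply/funext => k.
  rewrite (@integral_cut_sqr _ _ _ Pr _ (fun s w => simple_val (S_ k) s w - H s w))//.
    by apply: eq_integral => z _; rewrite cutB.
  by apply: measurable_funB => //; exact: measurable_funTS.
have c2' : (fun k => \int[Pr]_w ((simple_integral (b i) (S_ k) t w - J w) ^+ 2)%:E)%E
    @ \oo --> 0%E.
  by move: c2; rewrite unlock.
have [hH hHc] := L2cvg_ereal (fun k => cut_simple_val_sqint t (aS k))
  (measurable_cut mu_t mH) c1'.
have [hJ hJc] := L2cvg_ereal (fun k => simple_integral_sqint i t0 (aS k)) mJ c2'.
by split => //; exists S_.
Qed.

Lemma ito_isometry i (j : 'I_q) H H' t J J' : 0 <= t ->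
  measurable_fun (upto t `*` setT) (fun z : R * Omega => H z.1 z.2) ->
  measurable_fun (upto t `*` setT) (fun z : R * Omega => H' z.1 z.2) ->
  ito_integral Pr F (b i) H t J -> ito_integral Pr F (b j) H' t J' ->
  ip Pr J J' = K i j * ip (time_prob Pr) (cut (upto t) H) (cut (upto t) H').
Proof.
move=> t0 mH mH' /(ito_approximation t0 mH) [hH hJ [S [aS cH cJ]]].
move=> /(ito_approximation t0 mH') [hH' hJ' [S' [aS' cH' cJ']]].
have L1 := ip_cvg (fun k => simple_integral_sqint i t0 (aS k))
  (fun k => simple_integral_sqint j t0 (aS' k)) hJ hJ' cJ cJ'.
have L2 := ip_cvg (fun k => cut_simple_val_sqint t (aS k))
  (fun k => cut_simple_val_sqint t (aS' k)) hH hH' cH cH'.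
have L3 : (fun k => ip Pr (simple_integral (b i) (S k) t) (simple_integral (b j) (S' k) t))
   @ \oo --> K i j * ip (time_prob Pr) (cut (upto t) H) (cut (upto t) H').
  under eq_fun do rewrite simple_isometry//.
  by apply: cvgM L2; exact: cvg_cst.
exact: (cvg_unique _ L1 L3).
Qed.

Lemma cut_L2cvg (H_ : nat -> R -> Omega -> R) H s t : s <= t ->
  (forall k, sqint (time_prob Pr) (cut (upto t) (H_ k))) ->
  (forall k, sqint (time_prob Pr) (cut (upto s) (H_ k))) ->
  sqint (time_prob Pr) (cut (upto t) H) -> sqint (time_prob Pr) (cut (upto s) H) ->
  L2cvg (time_prob Pr) (fun k => cut (upto t) (H_ k)) (cut (upto t) H) ->
  L2cvg (time_prob Pr) (fun k => cut (upto s) (H_ k)) (cut (upto s) H).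
Proof.
move=> st ht hs hHt hHs c; apply: (squeeze_cvgr _ (cvg_cst 0) c).
apply: nearW => k; rewrite ip_ge0/=; apply: le_Rintegral => //.
- by apply: sqint_mul; exact: sqintB.
- by apply: sqint_mul; exact: sqintB.
move=> z _; rewrite -!expr2 /cut -!mulrBr !exprMn ler_wpM2r ?sqr_ge0// !indicE.
have [zs|_] := boolP (z.1 \in upto s); last by rewrite expr0n sqr_ge0.
have -> // : z.1 \in upto t.
move: zs => /set_mem /uptoP/andP[z0 zs]; apply: mem_set; apply/uptoP.
by rewrite z0 (le_trans zs).
Qed.

(** The property holds for simple processes, but the approximations behind [J] and [J'] are
    unrelated, so at time [s] they have to be compared with each other. *)
Lemma ito_martingale i H s t J J' Y : 0 <= s -> s <= t ->
  measurable_fun (upto t `*` setT) (fun z : R * Omega => H z.1 z.2) ->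
  ito_integral Pr F (b i) H t J -> ito_integral Pr F (b i) H s J' ->
  measurable_wrt (F s) Y -> sqint Pr Y -> ip Pr Y J = ip Pr Y J'.
Proof.
move=> s0 st mH IJ IJ' wY hY; have t0 := le_trans s0 st.
have mHs : measurable_fun (upto s `*` setT) (fun z : R * Omega => H z.1 z.2).
  apply: measurable_funS mH.
    by apply: measurableX => //; exact: measurable_upto.
  move=> z [/uptoP/andP[z0 zs] _]; split => //.
  by apply/uptoP; rewrite z0 (le_trans zs).
have [hH hJ [S [aS cH cJ]]] := ito_approximation t0 mH IJ.
have [hH' hJ' [S' [aS' cH' cJ']]] := ito_approximation s0 mHs IJ'.
have L1 := ip_cvg (fun=> hY) (fun k => simple_integral_sqint i t0 (aS k)) hY hJ
  (@L2cvg_cst _ _ _ Pr Y) cJ.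
have L2 := ip_cvg (fun=> hY) (fun k => simple_integral_sqint i s0 (aS' k)) hY hJ'
  (@L2cvg_cst _ _ _ Pr Y) cJ'.
(* By the isometry the second moment of [D k] is [K i i] times the squared distance of the two
   integrands on [upto s]. Both approximate [H] there, so it tends to zero. *)
pose D k w := simple_integral (b i) (S k) s w - simple_integral (b i) (S' k) s w.
have h1 k := simple_integral_sqint i s0 (aS k).
have h2 k := simple_integral_sqint i s0 (aS' k).
have hD k : sqint Pr (D k) by exact: sqintB.
have D0 : (fun k => ip Pr (D k) (D k)) @ \oo --> 0.
  have g1 k := cut_simple_val_sqint s (aS k).
  have g2 k := cut_simple_val_sqint s (aS' k).
  have cHs := cut_L2cvg st (fun k => cut_simple_val_sqint t (aS k)) g1 hH hH' cH.
  have M11 := ip_cvg g1 g1 hH' hH' cHs cHs.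
  have M12 := ip_cvg g1 g2 hH' hH' cHs cH'.
  have M22 := ip_cvg g2 g2 hH' hH' cH' cH'.
  pose G k := K i i *
    (ip (time_prob Pr) (cut (upto s) (simple_val (S k))) (cut (upto s) (simple_val (S k)))
     - ip (time_prob Pr) (cut (upto s) (simple_val (S k))) (cut (upto s) (simple_val (S' k)))
     - (ip (time_prob Pr) (cut (upto s) (simple_val (S k))) (cut (upto s) (simple_val (S' k)))
     - ip (time_prob Pr) (cut (upto s) (simple_val (S' k))) (cut (upto s) (simple_val (S' k))))).
  have -> : (fun k => ip Pr (D k) (D k)) = G.
    apply/funext => k; rewrite /G.
    rewrite (ipBl (h1 k) (h2 k) (hD k)) (ipBr (h1 k) (h2 k) (h1 k)) (ipBr (h1 k) (h2 k) (h2 k)).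
    rewrite (ipC _ (simple_integral _ (S' k) s) (simple_integral _ (S k) s)).
    by rewrite !simple_isometry// -!mulrBr.
  pose l := ip (time_prob Pr) (cut (upto s) H) (cut (upto s) H).
  have e0 : 0 = K i i * (l - l - (l - l)) by rewrite !subrr mulr0.
  rewrite e0; apply: cvgM; first exact: cvg_cst.
  by apply: cvgB; exact: cvgB.
have L3 : (fun k => ip Pr (D k) Y) @ \oo --> 0.
  by apply: (@cvg0_ip _ _ _ _ _ _ (ip Pr Y Y)) => //; exact: nearW.
have L4 : (fun k => ip Pr Y (simple_integral (b i) (S k) t)) @ \oo --> 0 + ip Pr Y J'.
  rewrite (_ : (fun k => _) = fun k => ip Pr (D k) Y + ip Pr Y (simple_integral (b i) (S' k) s)).
    exact: cvgD.
  apply/funext => k; rewrite (simple_martingale i s0 st (aS k) wY hY).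
  by rewrite (ipBl (h1 k) (h2 k) hY) ipC [ip _ (simple_integral _ (S' k) s) _]ipC subrK.
by rewrite (cvg_unique _ L1 L4) ?add0r.
Qed.

End ItoIntegral.

(** * Second moments of Ito processes *)

Section Tensor.
Context {d1 d2} {T1 : measurableType d1} {T2 : measurableType d2} {R : realType}.
Variables (m1 : {sigma_finite_measure set T1 -> \bar R})
  (m2 : {sigma_finite_measure set T2 -> \bar R}).

Lemma sqint_tensor (f : T1 -> R) (g : T2 -> R) : sqint m1 f -> sqint m2 g ->
  sqint (product_measure1 m1 m2) (fun z => f z.1 * g z.2).
Proof.
move=> hf hg; split.
  apply: measurable_funM.
    exact: measurableT_comp (sqint_measurable hf) measurable_fst.
  exact: measurableT_comp (sqint_measurable hg) measurable_snd.
have := integrable_lty measurableT (integrable_prod_mul (sqint_integrable_sqr hf)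
  (sqint_integrable_sqr hg)).
by under eq_integral do rewrite -exprMn.
Qed.

End Tensor.

Section IntegrationByParts.
Context {R : realType}.
Let leb := @lebesgue_measure R.

Lemma Rintegral_indic (D : set R) (f : R -> R) :
  \int[leb]_(t in D) f t = \int[leb]_t (\1_D t * f t).
Proof.
rewrite Rintegral_mkcond; apply: eq_Rintegral => t _.
by rewrite patchE indicE; case: (_ \in _); rewrite ?mul1r ?mul0r.
Qed.

(** Fubini for $f(s) g(t)$ on the plane, cut along the diagonal. *)
Lemma Rintegral_mul_by_parts (f g : R -> R) :
  leb.-integrable setT (fun s => (f s)%:E) -> leb.-integrable setT (fun s => (g s)%:E) ->
  (\int[leb]_s f s) * (\int[leb]_s g s) =
  \int[leb]_s (f s * \int[leb]_(t in `]-oo, s]) g t)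
  + \int[leb]_s (g s * \int[leb]_(t in `]-oo, s]) f t).
Proof.
move=> fi gi.
pose L : set (R * R) := [set z | z.2 <= z.1].
have mL : measurable L.
  rewrite -[L]setTI; apply: measurable_fun_le => //.
pose h1 z := \1_L z * (f z.1 * g z.2).
pose h2 z := \1_(~` L) z * (f z.1 * g z.2).
have ifg := integrable_prod_mul fi gi.
have i1 : (product_measure1 leb leb).-integrable setT (fun z => (h1 z)%:E).
  apply: (@integrable_bounded_mul _ _ _ _ _ _ 1) => //.
  by move=> z; rewrite indicE; case: (_ \in _); rewrite ?normr1 ?normr0.
have i2 : (product_measure1 leb leb).-integrable setT (fun z => (h2 z)%:E).
  apply: (@integrable_bounded_mul _ _ _ _ _ _ 1) => //.
    by apply: measurable_indic; exact: measurableC.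
  by move=> z; rewrite indicE; case: (_ \in _); rewrite ?normr1 ?normr0.
rewrite -Rintegral_prod_mul//.
have -> : \int[product_measure1 leb leb]_z (f z.1 * g z.2) =
   \int[product_measure1 leb leb]_z (h1 z + h2 z).
  apply: eq_Rintegral => z _; rewrite /h1 /h2 -mulrDl !indicE in_setC.
  by case: (_ \in _); rewrite ?addr0 ?add0r mul1r.
rewrite RintegralD//; congr (_ + _).
  under [RHS]eq_Rintegral do rewrite Rintegral_indic.
  rewrite [LHS]/Rintegral -(integral12_prod_meas1 i1) /fubini_F.
  congr fine; apply: eq_integral => s _.
  have gis : leb.-integrable setT (fun t => (\1_`]-oo, s] t * g t)%:E).
    apply: (@integrable_bounded_mul _ _ _ _ _ _ 1) => //.
    by move=> t; rewrite indicE; case: (_ \in _); rewrite ?normr1 ?normr0.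
  rewrite EFinM /Rintegral fineK ?integrable_fin_num// -integralZl//.
  apply: eq_integral => t _; rewrite /h1/= -EFinM; congr (_%:E).
  rewrite [RHS]mulrCA; congr (_ * _).
(* The complement of [L] is the open half-plane $s < t$, so the closed half-line in the statement is
   first replaced by the open one; they differ by a null set. *)
under [RHS]eq_Rintegral => t _.
  rewrite -Rintegral_itv_bndo_bndc; last exact: integrableS fi.
  rewrite Rintegral_indic.
  over.
rewrite [LHS]/Rintegral -(integral21_prod_meas1 i2) /fubini_G.
congr fine; apply: eq_integral => t _.
have fis : leb.-integrable setT (fun s => (\1_`]-oo, t[ s * f s)%:E).
  apply: (@integrable_bounded_mul _ _ _ _ _ _ 1) => //.
  by move=> s; rewrite indicE; case: (_ \in _); rewrite ?normr1 ?normr0.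
rewrite EFinM /Rintegral fineK ?integrable_fin_num// -integralZl//.
apply: eq_integral => s _; rewrite /h2/= -EFinM; congr (_%:E).
rewrite [RHS]mulrCA [g t * f s]mulrC; congr (_ * _).
by rewrite !indicE in_setC !mem_setE/= in_itv/= -ltNge.
Qed.

End IntegrationByParts.

(** * Time integrals of square-integrable processes *)

Section TimeIntegral.
Context {R : realType} {d : measure_display} {Omega : measurableType d}.
Variables (Pr : probability Omega R) (T : R).
Hypothesis T0 : 0 < T.
Let leb := @lebesgue_measure R.
Let mu := time_prob Pr.
Implicit Types (a : R -> Omega -> R) (A : R * Omega -> R) (Z : Omega -> R).

Definition time_int A (w : Omega) : R := \int[leb]_s A (s, w).

(** The lower limit is $-\infty$ because the integrands in use vanish off [upto T]. The indicator in
    front is needed for square integrability: past [T] the integral stays constant. *)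
Definition running_int A (z : R * Omega) : R :=
  \1_(upto T) z.1 * \int[leb]_(s in `]-oo, z.1]) A (s, z.2).

Lemma sqint_indic_upto : sqint leb (\1_(upto T)).
Proof.
have i1 := integrable_indic_upto (measurable_upto T) (@subset_refl _ (upto T)).
split; first by apply: measurable_indic; exact: measurable_upto.
have := integrable_lty measurableT i1.
rewrite (_ : (fun s => _) = fun s => (\1_(upto T) s ^+ 2)%:E)//.
by apply/funext => s; rewrite indicE; case: (_ \in _); rewrite ?expr1n ?expr0n.
Qed.

Lemma ip_indic_upto : ip leb (\1_(upto T)) (\1_(upto T)) = T.
Proof.
have -> : ip leb (\1_(upto T)) (\1_(upto T)) = \int[leb]_s \1_(upto T) s.
  by apply: eq_Rintegral => s _; rewrite indicE; case: (_ \in _); rewrite ?mulr1 ?mulr0.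
rewrite /Rintegral integral_indic ?setIT//; last exact: measurable_upto.
have L : leb (upto T) = T%:E by rewrite /leb /upto lebesgue_measure_itv/= lte_fin T0 oppr0 adde0.
exact: (congr1 fine L).
Qed.

Lemma sqint_tensor_upto Z : sqint Pr Z -> sqint mu (fun z => \1_(upto T) z.1 * Z z.2).
Proof. exact: sqint_tensor sqint_indic_upto. Qed.

Lemma sqint_supp_integrable A : (forall z, \1_(upto T) z.1 * A z = A z) ->
  sqint mu A -> mu.-integrable setT (fun z => (A z)%:E).
Proof.
move=> supA hA; have := sqint_mul (sqint_tensor_upto (sqint_cst Pr 1)) hA.
by under eq_fun do rewrite mulr1 supA.
Qed.

Lemma measurable_section A w : measurable_fun setT A -> measurable_fun setT (fun s => A (s, w)).
Proof. move=> mA; exact: measurableT_comp mA (measurable_pair2 _). Qed.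

Lemma measurable_time_int A : mu.-integrable setT (fun z => (A z)%:E) ->
  measurable_fun setT (time_int A).
Proof.
move=> iA; apply: measurableT_comp; last exact: measurable_fubini_G iA.
exact: fine_measurable.
Qed.

(* Cauchy-Schwarz; the bound is [+oo] when the path is not square integrable. *)
Lemma sqr_Rintegral_le A D w : (forall z, \1_(upto T) z.1 * A z = A z) ->
  measurable_fun setT A -> measurable D ->
  (((\int[leb]_(s in D) A (s, w)) ^+ 2)%:E <= T%:E * \int[leb]_s (A (s, w) ^+ 2)%:E)%E.
Proof.
move=> supA mA mD.
have [Aw|] := ltP (\int[leb]_s (A (s, w) ^+ 2)%:E)%E +oo%E; last first.
  by rewrite leye_eq => /eqP ->; rewrite gt0_muley ?lte_fin ?leey.
have hAw : sqint leb (fun s => A (s, w)) by split => //; exact: measurable_section.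
have hD : sqint leb (fun s => \1_D s * A (s, w)).
  apply: (@sqint_bounded_mul _ _ _ _ _ _ 1) hAw => //.
  by move=> s; rewrite indicE; case: (_ \in _); rewrite ?normr1 ?normr0.
rewrite -EFin_ipff// -EFinM lee_fin -ip_indic_upto Rintegral_indic.
have -> : \int[leb]_s (\1_D s * A (s, w)) = ip leb (\1_(upto T)) (fun s => \1_D s * A (s, w)).
  by apply: eq_Rintegral => s _; rewrite mulrCA (supA (s, w)).
apply: le_trans (ip_cauchy_schwarz sqint_indic_upto hD) _.
rewrite ler_wpM2l ?ip_ge0//; apply: le_Rintegral => //; [exact: sqint_mul..|].
move=> s _; rewrite !indicE; case: (_ \in _); rewrite ?mul1r// mul0r mul0r.
by rewrite -expr2 sqr_ge0.
Qed.

Lemma measurable_sqr_time_int A : measurable_fun setT A ->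
  measurable_fun setT (fun w => \int[leb]_s (A (s, w) ^+ 2)%:E)%E.
Proof.
move=> mA; apply: (@measurable_fun_fubini_tonelli_G _ _ _ _ _ leb (fun z => (A z ^+ 2)%:E)).
- by apply/measurable_EFinP; exact: measurable_funX.
- by move=> z; rewrite lee_fin sqr_ge0.
Qed.

Lemma sqint_time_int A : (forall z, \1_(upto T) z.1 * A z = A z) -> sqint mu A ->
  sqint Pr (time_int A).
Proof.
move=> supA hA; have iA := sqint_supp_integrable supA hA.
have mA := sqint_measurable hA.
have mA2 : measurable_fun setT (fun z => (A z ^+ 2)%:E).
  by apply/measurable_EFinP; exact: measurable_funX.
have A20 z : (0 <= (A z ^+ 2)%:E)%E by rewrite lee_fin sqr_ge0.
split; first exact: measurable_time_int.
have [_ fA] := hA; have Te0 : (0 <= T%:E)%E by rewrite lee_fin ltW.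
have : (T%:E * \int[mu]_z (A z ^+ 2)%:E < +oo)%E.
  by apply: lte_mul_pinfty => //; rewrite lee_fin ltW.
apply: le_lt_trans.
rewrite fubini_tonelli2// -ge0_integralZl//; last 2 first.
- exact: measurable_sqr_time_int.
- by move=> w _; apply: integral_ge0.
apply: ge0_le_integral => //.
- by move=> w _; rewrite lee_fin sqr_ge0.
- by apply/measurable_EFinP; apply: measurable_funX; exact: measurable_time_int.
- by apply: measurable_funeM; exact: measurable_sqr_time_int.
by move=> w _; exact: sqr_Rintegral_le.
Qed.

Lemma time_int_ip A Z : (forall z, \1_(upto T) z.1 * A z = A z) -> sqint mu A ->
  sqint Pr Z -> ip Pr (time_int A) Z = ip mu A (fun z => \1_(upto T) z.1 * Z z.2).
Proof.
move=> supA hA hZ; have iA := sqint_supp_integrable supA hA.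
have iAZ := sqint_mul hA (sqint_tensor_upto hZ).
rewrite [RHS]/ip /Rintegral -(integral21_prod_meas1 iAZ) /fubini_G; congr fine.
apply: ae_eq_integral => //.
- apply/measurable_EFinP; apply: measurable_funM; first exact: measurable_time_int.
  exact: sqint_measurable hZ.
- exact: measurable_fubini_G iAZ.
apply: filterS (ae_integrable2 iA) => w iAw _ /=.
rewrite EFinM /time_int fineK ?integrable_fin_num//.
rewrite -integralZr//; apply: eq_integral => s _.
by rewrite -EFinM -[in LHS](supA (s, w)) mulrA [A _ * _]mulrC.
Qed.

Lemma measurable_running_int A : measurable_fun setT A -> measurable_fun setT (running_int A).
Proof.
move=> mA; apply: measurable_funM.
  have mi : measurable_fun setT (\1_(upto T) : R -> R).
    by apply: measurable_indic; exact: measurable_upto.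
  exact: measurableT_comp mi measurable_fst.
pose f (y : (R * Omega) * R) : \bar R :=
  (\1_[set u : R * R | u.1 <= u.2] (y.2, y.1.1) * A (y.2, y.1.2))%:E.
have mf : measurable_fun setT f.
  apply/measurable_EFinP; apply: measurable_funM.
    have mi : measurable_fun setT (\1_[set u : R * R | u.1 <= u.2] : R * R -> R).
      apply: measurable_indic; rewrite -[X in measurable X]setTI.
      exact: measurable_fun_le.
    apply: measurableT_comp mi _; apply: measurable_fun_pair => //.
    exact: measurableT_comp.
  apply: measurableT_comp mA _; apply: measurable_fun_pair => //.
  exact: measurableT_comp.
have -> : (fun z => \int[leb]_(s in `]-oo, z.1]) A (s, z.2)) =
    fun z => fine (\int[leb]_s f (z, s)).
  apply/funext => z; by rewrite Rintegral_indic; congr fine.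
apply: measurableT_comp; first exact: fine_measurable.
(* No integrability of [f] is at hand, so measurability comes from Tonelli applied to the positive
   and negative parts. *)
have -> : (fun z => \int[leb]_s f (z, s))%E =
    (fun z => \int[leb]_s f^\+ (z, s) - \int[leb]_s f^\- (z, s))%E.
  apply/funext => z; rewrite [LHS]integralE.
  under eq_integral do rewrite funepos_comp/=.
  by under [X in (_ - X)%E = _]eq_integral do rewrite funeneg_comp/=.
apply: emeasurable_funB.
  apply: (@measurable_fun_fubini_tonelli_F _ _ _ _ _ leb (f^\+)%E) => //.
  exact: measurable_funepos.
apply: (@measurable_fun_fubini_tonelli_F _ _ _ _ _ leb (f^\-)%E) => //.
exact: measurable_funeneg.
Qed.

Lemma sqint_running_int A : (forall z, \1_(upto T) z.1 * A z = A z) -> sqint mu A ->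
  sqint mu (running_int A).
Proof.
move=> supA hA.
have mA := sqint_measurable hA.
split; first exact: measurable_running_int.
have [_ fA] := hA.
have A20 z : (0 <= (A z ^+ 2)%:E)%E by rewrite lee_fin sqr_ge0.
have Te0 : (0 <= T%:E)%E by rewrite lee_fin ltW.
have mA2 : measurable_fun setT (fun z => (A z ^+ 2)%:E).
  by apply/measurable_EFinP; exact: measurable_funX.
have mG : measurable_fun setT (fun w => \int[leb]_s (A (s, w) ^+ 2)%:E)%E.
  exact: measurable_sqr_time_int.
have mi : measurable_fun setT (fun t : R => (\1_(upto T) t)%:E : \bar R).
  by apply/measurable_EFinP; apply: measurable_indic; exact: measurable_upto.
(* The bound of [sqr_Rintegral_le], restricted to [upto T]. Its integral is $T^2$ times that of [A]
   squared: one factor from Cauchy-Schwarz, one from the outer time integration. *)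
pose g (z : R * Omega) := ((\1_(upto T) z.1)%:E *
   (T%:E * \int[leb]_s (A (s, z.2) ^+ 2)%:E))%E.
have G0 w : (0 <= \int[leb]_s (A (s, w) ^+ 2)%:E)%E by exact: integral_ge0.
have TG0 w : (0 <= T%:E * \int[leb]_s (A (s, w) ^+ 2)%:E)%E.
  by rewrite mule_ge0// lee_fin ltW.
have i0 t : (0 <= (\1_(upto T) t)%:E :> \bar R)%E by rewrite lee_fin indicE ler0n.
have mTG : measurable_fun setT (fun w => T%:E * \int[leb]_s (A (s, w) ^+ 2)%:E)%E.
  exact: measurable_funeM.
have mg : measurable_fun setT g.
  apply: emeasurable_funM.
    exact: measurableT_comp mi measurable_fst.
  exact: measurableT_comp mTG measurable_snd.
have : (\int[mu]_z g z < +oo)%E.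
  rewrite fubini_tonelli2//; last by move=> z; rewrite mule_ge0.
  rewrite /fubini_G/=.
  have E w : (\int[leb]_t g (t, w) = T%:E * (T%:E * \int[leb]_s (A (s, w) ^+ 2)%:E))%E.
    rewrite /g/= ge0_integralZr// integral_indic ?setIT//; last exact: measurable_upto.
    have L : leb (upto T) = T%:E by rewrite /leb /upto lebesgue_measure_itv/= lte_fin T0 oppr0 adde0.
    by congr (_ * _)%E; exact: L.
  under eq_integral do rewrite E.
  rewrite !ge0_integralZl//; [|by rewrite lee_fin ltW..].
  rewrite lte_mul_pinfty ?lee_fin ?ltW//; last first.
    rewrite lte_mul_pinfty ?lee_fin ?ltW//.
    by move: fA; rewrite fubini_tonelli2.
apply: le_lt_trans; apply: ge0_le_integral => //.
- by move=> z _; rewrite lee_fin sqr_ge0.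
- by apply/measurable_EFinP; apply: measurable_funX; exact: measurable_running_int.
move=> z _; rewrite /running_int /g exprMn EFinM.
have -> : \1_(upto T) z.1 ^+ 2 = \1_(upto T) z.1 :> R.
  by rewrite indicE; case: (_ \in _); rewrite ?expr1n ?expr0n.
by apply: lee_pmul => //; [rewrite lee_fin sqr_ge0|exact: sqr_Rintegral_le].
Qed.

End TimeIntegral.

Section TimeIntegralFubini.
Context {R : realType} {d : measure_display} {Omega : measurableType d}.
Variables (Pr : probability Omega R).
Let leb := @lebesgue_measure R.
Let mu := time_prob Pr.
Implicit Types (A B : R * Omega -> R) (Z : Omega -> R).

Lemma ae_section_integrable A : mu.-integrable setT (fun z => (A z)%:E) ->
  {ae Pr, forall w, leb.-integrable setT (fun s => (A (s, w))%:E)}.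
Proof. by move=> iA; exact: ae_integrable2 iA. Qed.

Lemma time_intE A : mu.-integrable setT (fun z => (A z)%:E) ->
  {ae Pr, forall w, (time_int A w)%:E = (\int[leb]_s (A (s, w))%:E)%E}.
Proof.
move=> iA; apply: filterS (ae_section_integrable iA) => w iAw.
by rewrite /time_int /Rintegral fineK ?integrable_fin_num.
Qed.

Lemma integrable_time_int A : mu.-integrable setT (fun z => (A z)%:E) ->
  Pr.-integrable setT (fun w => (time_int A w)%:E).
Proof.
move=> iA; apply/integrableP; split.
  by apply/measurable_EFinP; exact: measurable_time_int iA.
have mA : measurable_fun setT (fun z => (A z)%:E) by exact: measurable_int iA.
have h := (integrable21ltyP leb Pr mA).1 iA; apply: (le_lt_trans _ h).
rewrite (ae_eq_integral (fun w => `|\int[leb]_s (A (s, w))%:E|)%E)//.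
- apply: ge0_le_integral => //.
  + by apply: measurableT_comp => //; exact: measurable_fubini_G iA.
  + apply: (@measurable_fun_fubini_tonelli_G _ _ _ _ _ leb (fun z => `|(A z)%:E|)%E) => //.
    exact: measurableT_comp.
  + move=> w _; apply: le_abse_integral => //.
    exact: measurableT_comp mA (measurable_pair2 _).
- apply: measurableT_comp => //.
  by apply/measurable_EFinP; exact: measurable_time_int iA.
- by apply: measurableT_comp => //; exact: measurable_fubini_G iA.
- by apply: filterS (time_intE iA) => w -> _.
Qed.

Lemma Rintegral_time_int A : mu.-integrable setT (fun z => (A z)%:E) ->
  \int[Pr]_w time_int A w = \int[mu]_z A z.
Proof.
move=> iA; rewrite /Rintegral -(integral21_prod_meas1 iA); congr fine.
apply: ae_eq_integral => //.
- by apply/measurable_EFinP; exact: measurable_time_int iA.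
- exact: measurable_fubini_G iA.
- by apply: filterS (time_intE iA) => w -> _.
Qed.

(** Reduces pairings on the product space to fixed times, where the martingale property is
    available. Sections are square integrable at almost every time only, so the comparison is
    allowed to assume it. *)
Lemma ip_eq_sections A B B' : sqint mu A -> sqint mu B -> sqint mu B' ->
  (forall s, sqint Pr (fun w => A (s, w)) ->
     sqint Pr (fun w => B (s, w)) -> sqint Pr (fun w => B' (s, w)) ->
     ip Pr (fun w => A (s, w)) (fun w => B (s, w)) =
     ip Pr (fun w => A (s, w)) (fun w => B' (s, w))) ->
  ip mu A B = ip mu A B'.
Proof.
move=> hA hB hB' E.
have sec f : sqint mu f -> {ae leb, forall s, sqint Pr (fun w => f (s, w))}.
  move=> hf; have := ae_integrable1 (sqint_integrable_sqr hf).
  apply: filterS => s /integrable_lty -/(_ measurableT) fs; split => //.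
  exact: measurableT_comp (sqint_measurable hf) (measurable_pair1 _).
have iAB := sqint_mul hA hB; have iAB' := sqint_mul hA hB'.
rewrite /ip /Rintegral -(integral12_prod_meas1 iAB) -(integral12_prod_meas1 iAB').
congr fine; apply: ae_eq_integral => //.
- exact: measurable_fubini_F iAB.
- exact: measurable_fubini_F iAB'.
have sA := sec _ hA; have sB := sec _ hB; have sB' := sec _ hB'.
apply: filterS3 sA sB sB' => s sA sB sB' _.
by rewrite /fubini_F -!EFin_ip// E.
Qed.

Variable T : R.
Hypothesis T0 : 0 < T.

(** Integration by parts on almost every path, followed by Fubini. *)
Lemma time_int_by_parts A C :
  (forall z, \1_(upto T) z.1 * A z = A z) -> (forall z, \1_(upto T) z.1 * C z = C z) ->
  sqint mu A -> sqint mu C ->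
  ip Pr (time_int A) (time_int C) = ip mu A (running_int T C) + ip mu C (running_int T A).
Proof.
move=> supA supC hA hC.
have iA := sqint_supp_integrable supA hA; have iC := sqint_supp_integrable supC hC.
have iAC := sqint_mul hA (sqint_running_int T0 supC hC).
have iCA := sqint_mul hC (sqint_running_int T0 supA hA).
rewrite [X in _ = X + _]/ip [X in _ = _ + X]/ip.
rewrite -(Rintegral_time_int iAC) -(Rintegral_time_int iCA).
rewrite -(RintegralD measurableT (integrable_time_int iAC) (integrable_time_int iCA)).
rewrite /ip /Rintegral; congr fine; apply: ae_eq_integral => //.
- apply/measurable_EFinP; apply: measurable_funM.
    exact: measurable_time_int iA.
  exact: measurable_time_int iC.
- apply/measurable_EFinP; apply: measurable_funD.
    exact: measurable_time_int iAC.
  exact: measurable_time_int iCA.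
apply: filterS2 (ae_section_integrable iA) (ae_section_integrable iC) => w iAw iCw _ /=.
congr (_%:E); rewrite /time_int Rintegral_mul_by_parts//.
by congr (_ + _); apply: eq_Rintegral => s _; rewrite /running_int/= mulrA [_ * \1_ _ _]mulrC;
  rewrite ?(supA (s, w)) ?(supC (s, w)).
Qed.

End TimeIntegralFubini.

Section SecondMoment.
Context {R : realType} {d : measure_display} {Omega : measurableType d}.
Variables (Pr : probability Omega R) (F : R -> set (set Omega)).
Variables (q : nat) (K : 'M[R]_q) (W : R -> Omega -> 'cV[R]_q).
Hypotheses (hF : usual_filtration Pr F) (hW : wiener Pr F K W).
Let leb := @lebesgue_measure R.
Let mu := time_prob Pr.
Variable T : R.
Hypothesis T0 : 0 < T.

(* [dX = a dt + sum_i g_i dW_i] on [0, T], with [X 0 = 0]. *)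
Definition ito_process (a : R -> Omega -> R) (g : 'I_q -> R -> Omega -> R)
    (X : R -> Omega -> R) : Prop :=
  [/\ forall t, upto T t -> measurable_wrt (F t) (a t),
      sqint mu (cut (upto T) a),
      forall i, measurable_fun (upto T `*` setT) (fun z : R * Omega => g i z.1 z.2),
      (forall t, upto T t -> measurable_fun setT (X t)) /\ sqint mu (cut (upto T) X) &
      forall t, upto T t -> exists J : 'I_q -> Omega -> R,
        (forall i, ito_integral Pr F (fun s w => W s w i 0) (g i) t (J i)) /\
        {ae Pr, forall w,
          X t w = \int[leb]_(s in upto t) a s w + \sum_i J i w}].

Lemma cut_supp (D : set R) (a : R -> Omega -> R) z : \1_D z.1 * cut D a z = cut D a z.
Proof. by rewrite /cut indicE; case: (_ \in _); rewrite ?mul1r ?mul0r. Qed.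

Lemma upto_horizon : upto T T.
Proof. by apply/uptoP; rewrite lexx ltW. Qed.

Lemma Rintegral_upto_cut (a : R -> Omega -> R) t w : upto T t ->
  \int[leb]_(s in upto t) a s w = \int[leb]_(s in `]-oo, t]) cut (upto T) a (s, w).
Proof.
move=> /uptoP/andP[t0 tT]; rewrite Rintegral_indic [RHS]Rintegral_indic; apply: eq_Rintegral => s _.
rewrite /cut/= mulrA; congr (_ * _); rewrite !indicE !mem_setE !in_itv/=.
by have [s0|s0] := leP 0 s; have [st|st] := leP s t; rewrite /= ?(le_trans st tT) ?mul1r ?mul0r.
Qed.

Lemma time_int_cut (a : R -> Omega -> R) w :
  \int[leb]_(s in upto T) a s w = time_int (cut (upto T) a) w.
Proof. exact: Rintegral_indic. Qed.

(** Against the [F s]-measurable section of [A] at time [s], the martingale part of [Y] at [T] may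
    be replaced by the one at [s], which is [Y s] minus the integral of [c] up to [s]. *)
Lemma drift_martingale (A : R * Omega -> R) c h Y (J : 'I_q -> Omega -> R) :
  (forall t, upto T t -> measurable_wrt (F t) (fun w => A (t, w))) ->
  (forall z, \1_(upto T) z.1 * A z = A z) -> sqint mu A ->
  ito_process c h Y ->
  (forall i, ito_integral Pr F (fun s w => W s w i 0) (h i) T (J i)) ->
  ip mu A (fun z => \1_(upto T) z.1 * \sum_i J i z.2) =
  ip mu A (cut (upto T) Y) - ip mu A (running_int T (cut (upto T) c)).
Proof.
move=> wA supA hA [wc hc mh [mY hY] dY] IJ.
have hJ i : sqint Pr (J i).
  by have [] := ito_approximation hF hW (ltW T0) (mh i) (IJ i).
have hSJ : sqint Pr (fun w => \sum_i J i w) by exact: sqint_sum.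
have hRC := sqint_running_int T0 (@cut_supp _ c) hc.
rewrite -ipBr//; apply: ip_eq_sections => //.
- exact: sqint_tensor_upto hSJ.
- exact: sqintB.
move=> s sA _ sB'.
have [sT|sT] := pselect (upto T s); last first.
  have -> : (fun w => A (s, w)) = fun=> 0.
    by apply/funext => w; rewrite -supA indicE memNset// mul0r.
  by rewrite !ip0l.
have [s0 sT'] : 0 <= s /\ s <= T by move/uptoP : sT => /andP.
have i1 : \1_(upto T) s = 1 :> R by rewrite indicE mem_set.
have [Js [IJs dYs]] := dY s sT.
have hJs i : sqint Pr (Js i).
  have mhs : measurable_fun (upto s `*` setT) (fun z : R * Omega => h i z.1 z.2).
    apply: measurable_funS (mh i).
      by apply: measurableX => //; exact: measurable_upto.
    move=> z [/uptoP/andP[z0 zs] _]; split => //.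
    by apply/uptoP; rewrite z0 (le_trans zs).
  by have [] := ito_approximation hF hW s0 mhs (IJs i).
transitivity (ip Pr (fun w => A (s, w)) (fun w => \sum_i Js i w)).
  have -> : (fun w => \1_(upto T) (s, w).1 * \sum_i J i (s, w).2) = fun w => \sum_i J i w.
    by apply/funext => w; rewrite /= i1 mul1r.
  rewrite !ip_sumr//; apply: eq_bigr => i _.
  exact: (ito_martingale hF hW s0 sT' (mh i) (IJ i) (IJs i) (wA s sT) sA).
rewrite ipC [RHS]ipC; apply: ip_eq_ae.
- by apply: measurable_sum => i; exact: sqint_measurable (hJs i).
- exact: sqint_measurable sB'.
- exact: sqint_measurable sA.
apply: filterS dYs => w dw.
rewrite /cut/= /running_int/= i1 !mul1r dw Rintegral_upto_cut//.
by rewrite addrC addKr.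
Qed.

(** Split both terminal values into drift and martingale parts. The drift-drift product gives two
    running integrals by parts; [drift_martingale] produces the same two with the opposite sign,
    next to the pairings with [X] and [Y]. The isometry gives the last sum. *)
Lemma second_moment a g X c h Y : ito_process a g X -> ito_process c h Y ->
  [/\ sqint Pr (X T), sqint Pr (Y T) &
  ip Pr (X T) (Y T) = ip mu (cut (upto T) a) (cut (upto T) Y)
    + ip mu (cut (upto T) c) (cut (upto T) X)
    + \sum_i \sum_j K i j * ip mu (cut (upto T) (g i)) (cut (upto T) (h j))].
Proof.
move=> hX hY.
have [wa ha mg [mX cX] dX] := hX; have [wc hc mh [mY cY] dY] := hY.
have [J [IJ dXT]] := dX T upto_horizon; have [J' [IJ' dYT]] := dY T upto_horizon.
have hJ i : sqint Pr (J i).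
  by have [] := ito_approximation hF hW (ltW T0) (mg i) (IJ i).
have hJ' i : sqint Pr (J' i).
  by have [] := ito_approximation hF hW (ltW T0) (mh i) (IJ' i).
pose A := cut (upto T) a; pose C := cut (upto T) c.
have supA : forall z, \1_(upto T) z.1 * A z = A z by exact: cut_supp.
have supC : forall z, \1_(upto T) z.1 * C z = C z by exact: cut_supp.
have hV := sqint_time_int T0 supA ha; have hV' := sqint_time_int T0 supC hc.
pose M w := \sum_i J i w; pose M' w := \sum_i J' i w.
have hM : sqint Pr M by exact: sqint_sum.
have hM' : sqint Pr M' by exact: sqint_sum.
have eX : {ae Pr, forall w, time_int A w + M w = X T w}.
  by apply: filterS dXT => w ->; rewrite time_int_cut.
have eY : {ae Pr, forall w, time_int C w + M' w = Y T w}.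
  by apply: filterS dYT => w ->; rewrite time_int_cut.
have hVM := sqintD hV hM; have hVM' := sqintD hV' hM'.
have sX : sqint Pr (X T) by exact: sqint_eq_ae hVM (mX _ upto_horizon) eX.
have sY : sqint Pr (Y T) by exact: sqint_eq_ae hVM' (mY _ upto_horizon) eY.
split => //.
have mm f : sqint Pr f -> measurable_fun setT f by exact: sqint_measurable.
rewrite -(ip_eq_ae (mm _ hVM) (mm _ sX) (mm _ sY) eX) ipC.
rewrite -(ip_eq_ae (mm _ hVM') (mm _ sY) (mm _ hVM) eY) ipC.
rewrite (ipDl hV hM hVM') (ipDr hV' hM' hV) (ipDr hV' hM' hM).
rewrite (time_int_by_parts T0 supA supC ha hc).
have wA t : upto T t -> measurable_wrt (F t) (fun w => A (t, w)).
  by move=> tT; rewrite /A /cut/= indicE mem_set//; under eq_fun do rewrite mul1r; exact: wa.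
have wC t : upto T t -> measurable_wrt (F t) (fun w => C (t, w)).
  by move=> tT; rewrite /C /cut/= indicE mem_set//; under eq_fun do rewrite mul1r; exact: wc.
rewrite (time_int_ip supA ha hM') (drift_martingale wA supA ha hY IJ').
rewrite (ipC _ M (time_int C)) (time_int_ip supC hc hM) (drift_martingale wC supC hc hX IJ).
have -> : ip Pr M M' =
    \sum_i \sum_j K i j * ip mu (cut (upto T) (g i)) (cut (upto T) (h j)).
  rewrite ip_suml//; apply: eq_bigr => i _; rewrite ip_sumr//; apply: eq_bigr => j _.
  exact: (ito_isometry hF hW (ltW T0) (mg i) (mh j) (IJ i) (IJ' j)).
rewrite -/A -/C; ring.
Qed.

End SecondMoment.

(** * Quadratic storage functions *)

Section BilinearForms.
Context {R : realType}.

Definition bil {k} (X : 'M[R]_k) (x y : 'cV[R]_k) : R := (x^T *m X *m y) 0 0.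

Lemma quadE k (X : 'M[R]_k) x : quad X x = bil X x x. Proof. by []. Qed.

Lemma bilDl k (X : 'M[R]_k) x y z : bil X (x + y) z = bil X x z + bil X y z.
Proof. by rewrite /bil linearD/= !mulmxDl mxE. Qed.

Lemma bilDr k (X : 'M[R]_k) x y z : bil X x (y + z) = bil X x y + bil X x z.
Proof. by rewrite /bil mulmxDr mxE. Qed.

Lemma bilNl k (X : 'M[R]_k) x y : bil X (- x) y = - bil X x y.
Proof. by rewrite /bil linearN/= !mulNmx mxE. Qed.

Lemma bilNr k (X : 'M[R]_k) x y : bil X x (- y) = - bil X x y.
Proof. by rewrite /bil mulmxN mxE. Qed.

Lemma bil0l k (X : 'M[R]_k) x : bil X 0 x = 0.
Proof. by rewrite /bil trmx0 !mul0mx mxE. Qed.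

Lemma bilC k (X : 'M[R]_k) x y : X^T = X -> bil X x y = bil X y x.
Proof.
move=> sX; have e : y^T *m X *m x = (x^T *m X *m y)^T.
  by rewrite !trmx_mul trmxK sX mulmxA.
by rewrite /bil e [RHS]mxE.
Qed.

Lemma bilDm k (X Y : 'M[R]_k) x y : bil (X + Y) x y = bil X x y + bil Y x y.
Proof. by rewrite /bil mulmxDr mulmxDl mxE. Qed.

Lemma bilZm k (X : 'M[R]_k) a x y : bil (a *: X) x y = a * bil X x y.
Proof. by rewrite /bil -scalemxAr -scalemxAl mxE. Qed.

Lemma bil_conj k l (L : 'M[R]_(k, l)) (X : 'M[R]_k) x y :
  bil (L^T *m X *m L) x y = bil X (L *m x) (L *m y).
Proof. by rewrite /bil trmx_mul !mulmxA. Qed.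

Lemma bil_sum k (X : 'M[R]_k) x y : bil X x y = \sum_i \sum_j X i j * (x i 0 * y j 0).
Proof.
rewrite /bil mxE exchange_big/=; apply: eq_bigr => j _.
rewrite mxE mulr_suml; apply: eq_bigr => i _.
by rewrite mxE; ring.
Qed.

Lemma posdef_ge0 k (X : 'M[R]_k) x : posdef X -> 0 <= bil X x x.
Proof.
move=> [_ pX]; have [->|/pX/ltW//] := eqVneq x 0; by rewrite bil0l.
Qed.

Lemma posdef_eq0 k (X : 'M[R]_k) x : posdef X -> bil X x x <= 0 -> x = 0.
Proof.
move=> [_ pX] h; apply/eqP; apply: contraTT h => /pX; by rewrite -ltNge.
Qed.

Lemma posdef_unitmx k (X : 'M[R]_k) : posdef X -> X \in unitmx.
Proof.
move=> pX; rewrite -row_free_unit -kermx_eq0; apply/eqP/row_matrixP => i.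
rewrite row0; set u := row i _.
have uX : u *m X = 0 by rewrite /u -row_mul mulmx_ker row0.
have : u^T = 0.
  by apply: (posdef_eq0 pX); rewrite /bil trmxK uX mul0mx mxE.
by move=> /(congr1 trmx); rewrite trmxK trmx0.
Qed.

Lemma posdef_conj k l (L : 'M[R]_(k, l)) (X : 'M[R]_k) :
  posdef X -> (forall x : 'cV[R]_l, L *m x = 0 -> x = 0) -> posdef (L^T *m X *m L).
Proof.
move=> [sX qX] iL; split; first by rewrite !trmx_mul trmxK sX mulmxA.
move=> x x0; rewrite quadE bil_conj; apply: qX.
by apply: contraNneq x0 => /iL ->.
Qed.

Lemma sqnormE k (x : 'cV[R]_k) : sqnorm x = bil 1%:M x x.
Proof.
by rewrite /bil mulmx1 mxE; apply: eq_bigr => i _; rewrite mxE expr2.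
Qed.

Lemma sqnorm_ge0 k (x : 'cV[R]_k) : 0 <= sqnorm x.
Proof. by apply: sumr_ge0 => i _; exact: sqr_ge0. Qed.

(* Convexity of the square with weights [g / (g + d)] and [d / (g + d)]. *)
Lemma sqnormD_le k (x y : 'cV[R]_k) g d : 0 < g -> 0 < d ->
  sqnorm (x + y) <= (g + d) / g * sqnorm x + (g + d) / d * sqnorm y.
Proof.
move=> g0 d0; rewrite /sqnorm !mulr_sumr -big_split/=; apply: ler_sum => i _.
rewrite mxE -subr_ge0.
have -> : (g + d) / g * x i 0 ^+ 2 + (g + d) / d * y i 0 ^+ 2 - (x i 0 + y i 0) ^+ 2
   = (d * x i 0 - g * y i 0) ^+ 2 / (g * d).
  by field; rewrite !gt_eqF.
by rewrite divr_ge0 ?sqr_ge0 ?mulr_ge0// ltW.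
Qed.

(** One entry of the weighted noise forms in [dissipative_trans]: terms 2 and 3 are the mixed ones,
    which cancel between the two forms by orthogonality. *)
Lemma cross_terms (k a b x1 x2 x3 x4 y1 y2 y3 y4 : R) :
  a * x2 + b * y2 = 0 -> a * x3 + b * y3 = 0 ->
  a * (k * (x1 + x2 + (x3 + x4))) + b * (k * (y1 + y2 + (y3 + y4))) =
  k * (a * x1 + b * y1) + k * (a * x4 + b * y4).
Proof.
move=> h2 h3; transitivity (k * (a * x1 + b * y1) + k * (a * x4 + b * y4)
  + k * (a * x2 + b * y2) + k * (a * x3 + b * y3)); first by ring.
by rewrite h2 h3 mulr0 !addr0.
Qed.

End BilinearForms.

Section Dissipation.
Context {R : realType} {q m p : nat} (K : 'M[R]_q).

Record system (k : nat) := System {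
  sysA : 'M[R]_k;
  sysN : 'I_q -> 'M[R]_k;
  sysB : 'M[R]_(k, m);
  sysC : 'M[R]_(p, k) }.

(** The Ito correction for the quadratic form [X] when the coefficient of $dW_i$ is [a i]. *)
Definition noise_form {k} (X : 'M[R]_k) (a : 'I_q -> 'cV[R]_k) : R :=
  \sum_i \sum_j K i j * bil X (a i) (a j).

Definition drift {k} (s : system k) (x : 'cV[R]_k) (v : 'cV[R]_m) : 'cV[R]_k :=
  sysA s *m x + sysB s *m v.

(* The two systems driven by the same input have outputs at [L^2] distance at
   most [g] times the norm of the input, and a quadratic storage function of the
   pair of states proves it. *)
Definition dissipative {k l} (s : system k) (t : system l) (g : R) : Prop :=
  exists X : 'M[R]_(k + l), posdef X /\ forall x y v,
    2 * bil X (col_mx x y) (col_mx (drift s x v) (drift t y v))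
    + noise_form X (fun i => col_mx (sysN s i *m x) (sysN t i *m y))
    <= g ^+ 2 * sqnorm v - sqnorm (sysC s *m x - sysC t *m y).

Hypothesis Kpsd : forall k (X : 'M[R]_k) a, posdef X -> 0 <= noise_form X a.

(* The storage function is the minimum over the state [y] of the middle system
   of a weighted sum of the two given ones. By minimality its derivative does not
   see the dynamics of [y], so no trajectory of the middle system is needed. *)
Lemma dissipative_trans k l h (s : system k) (t : system l) (u : system h) g d :
  0 < g -> 0 < d -> dissipative s t g -> dissipative t u d ->
  dissipative s u (g + d).
Proof.
move=> g0 d0 [X [pX dX]] [Y [pY dY]].
have [[sX qX] [sY qY]] := (pX, pY).
(* These are the weights of [sqnormD_le], which splits the output distance, and they satisfy $\alpha
   g^2 + \beta d^2 = (g + d)^2$. *)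
pose al := (g + d) / g; pose be := (g + d) / d.
have al0 : 0 < al by rewrite divr_gt0// addr_gt0.
have be0 : 0 < be by rewrite divr_gt0// addr_gt0.
pose i2 : 'M[R]_(k + l, l) := col_mx 0 1%:M.
pose i1 : 'M[R]_(l + h, l) := col_mx 1%:M 0.
pose j1 : 'M[R]_(k + l, k + h) := block_mx 1%:M 0 0 0.
pose j3 : 'M[R]_(l + h, k + h) := block_mx 0 0 0 1%:M.
have i2E (e : 'cV[R]_l) : i2 *m e = col_mx 0 e by rewrite mul_col_mx mul0mx mul1mx.
have i1E (e : 'cV[R]_l) : i1 *m e = col_mx e 0 by rewrite mul_col_mx mul0mx mul1mx.
have j1E (x : 'cV[R]_k) (z : 'cV[R]_h) : j1 *m col_mx x z = col_mx x 0.
  by rewrite mul_block_col !mul0mx mul1mx !addr0.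
have j3E (x : 'cV[R]_k) (z : 'cV[R]_h) : j3 *m col_mx x z = col_mx 0 z.
  by rewrite mul_block_col !mul0mx mul1mx !add0r.
pose Y22 := al *: (i2^T *m X *m i2) + be *: (i1^T *m Y *m i1).
have Y22E e e' : bil Y22 e e' = al * bil X (i2 *m e) (i2 *m e') + be * bil Y (i1 *m e) (i1 *m e').
  by rewrite bilDm !bilZm !bil_conj.
have pY22 : posdef Y22.
  split; first by rewrite /Y22 linearD/= !linearZ/= !trmx_mul !trmxK sX sY !mulmxA.
  move=> e e0; rewrite quadE bilDm !bilZm !bil_conj.
  apply: ltr_pwDl; last by rewrite mulr_ge0 ?(ltW be0)// posdef_ge0.
  rewrite mulr_gt0//; apply: qX; rewrite i2E; apply: contraNneq e0 => /eqP.
  by rewrite col_mx_eq0 => /andP[_].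
(* [Y22] is the Hessian of the weighted sum in the middle state and [G] its coupling to the outer
   states. So [L *m z] is the minimiser, [P1 *m z] and [P2 *m z] are the two pairs of states at it,
   and [orth] is the first-order condition. *)
pose G := al *: (i2^T *m X *m j1) + be *: (i1^T *m Y *m j3).
pose L := - (invmx Y22 *m G).
pose P1 := j1 + i2 *m L; pose P2 := j3 + i1 *m L.
have orth e z : al * bil X (i2 *m e) (P1 *m z) + be * bil Y (i1 *m e) (P2 *m z) = 0.
  have -> : al * bil X (i2 *m e) (P1 *m z) + be * bil Y (i1 *m e) (P2 *m z) =
     (e^T *m (al *: (i2^T *m X *m P1) + be *: (i1^T *m Y *m P2)) *m z) 0 0.
    rewrite mulmxDr mulmxDl mxE -!scalemxAr -!scalemxAl [in RHS]mxE.
    by rewrite [X in _ = _ + X]mxE /bil !trmx_mul !mulmxA.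
  have -> : al *: (i2^T *m X *m P1) + be *: (i1^T *m Y *m P2) = G + Y22 *m L.
    rewrite /P1 /P2 /G /Y22 !mulmxDr mulmxDl !scalerDr -!scalemxAl !mulmxA.
    by rewrite !addrA; congr (_ + _); rewrite -!addrA; congr (_ + _); rewrite addrC.
  by rewrite /L mulmxN mulKVmx ?posdef_unitmx// subrr mulmx0 mul0mx mxE.
pose Z := al *: (P1^T *m X *m P1) + be *: (P2^T *m Y *m P2).
have sZ : Z^T = Z by rewrite /Z linearD/= !linearZ/= !trmx_mul !trmxK sX sY !mulmxA.
have ZE z z' : bil Z z z' = al * bil X (P1 *m z) (P1 *m z') + be * bil Y (P2 *m z) (P2 *m z').
  by rewrite /Z bilDm !bilZm !bil_conj.
have P1E (x : 'cV[R]_k) (z : 'cV[R]_h) : P1 *m col_mx x z = col_mx x (L *m col_mx x z).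
  by rewrite /P1 mulmxDl j1E -mulmxA i2E add_col_mx addr0 add0r.
have P2E (x : 'cV[R]_k) (z : 'cV[R]_h) : P2 *m col_mx x z = col_mx (L *m col_mx x z) z.
  by rewrite /P2 mulmxDl j3E -mulmxA i1E add_col_mx addr0 add0r.
exists Z; split.
  split => // z; rewrite -[z]vsubmxK; set x := usubmx z; set y := dsubmx z => z0.
  rewrite quadE ZE lt_def; apply/andP; split; last first.
    by rewrite addr_ge0// mulr_ge0 ?posdef_ge0 ?ltW.
  apply: contraNneq z0 => e.
  have h1 := posdef_ge0 (P1 *m col_mx x y) pX.
  have h2 := posdef_ge0 (P2 *m col_mx x y) pY.
  have /(posdef_eq0 pX) : bil X (P1 *m col_mx x y) (P1 *m col_mx x y) <= 0 by nra.
  have /(posdef_eq0 pY) : bil Y (P2 *m col_mx x y) (P2 *m col_mx x y) <= 0 by nra.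
  rewrite P1E P2E => /eqP; rewrite col_mx_eq0 => /andP[_ y0] /eqP.
  by rewrite !col_mx_eq0 y0 => /andP[-> _].
move=> x z v; pose y := L *m col_mx x z.
have := dX x y v; have := dY y z v.
set dx := drift s x v; set dy := drift t y v; set dz := drift u z v.
set nx := fun i => sysN s i *m x; set ny := fun i => sysN t i *m y; set nz := fun i => sysN u i *m z.
(* The middle drift need not follow the minimiser. Its deviation [e0] lies in the direction of the
   middle state, so by [orth] it drops out of the derivative. *)
pose e0 := dy - L *m col_mx dx dz.
have E1 : col_mx dx dy = P1 *m col_mx dx dz + i2 *m e0.
  by rewrite P1E i2E add_col_mx addr0 /e0 addrC subrK.
have E2 : col_mx dy dz = P2 *m col_mx dx dz + i1 *m e0.
  by rewrite P2E i1E add_col_mx addr0 /e0 addrC subrK.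
(* The same deviation for the noise does not drop out, but it enters as [noise_form Y22 e], which is
   nonnegative and hence only helps. *)
have [e Fe] : exists e : 'I_q -> 'cV[R]_l, forall i,
    col_mx (nx i) (ny i) = P1 *m col_mx (nx i) (nz i) + i2 *m e i /\
    col_mx (ny i) (nz i) = P2 *m col_mx (nx i) (nz i) + i1 *m e i.
  exists (fun i => ny i - L *m col_mx (nx i) (nz i)) => i.
  by rewrite P1E P2E i2E i1E !add_col_mx !addr0 addrC subrK.
have F1 i := (Fe i).1; have F2 i := (Fe i).2.
rewrite -(P1E x z) -(P2E x z).
have D : al * (2 * bil X (P1 *m col_mx x z) (col_mx dx dy)) +
    be * (2 * bil Y (P2 *m col_mx x z) (col_mx dy dz)) =
    2 * bil Z (col_mx x z) (col_mx dx dz).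
  rewrite E1 E2 !bilDr ZE.
  have := orth e0 (col_mx x z); rewrite (bilC _ _ sX) (bilC _ _ sY); lra.
have Nf : al * noise_form X (fun i => col_mx (nx i) (ny i)) +
    be * noise_form Y (fun i => col_mx (ny i) (nz i)) =
    noise_form Z (fun i => col_mx (nx i) (nz i)) + noise_form Y22 e.
  rewrite /noise_form !mulr_sumr -!big_split/=; apply: eq_bigr => i _.
  rewrite !mulr_sumr -!big_split/=; apply: eq_bigr => j _.
  rewrite !F1 !F2 !bilDr !bilDl ZE Y22E.
  have O1 := orth (e i) (col_mx (nx j) (nz j)).
  have := orth (e j) (col_mx (nx i) (nz i)); rewrite (bilC _ _ sX) (bilC _ _ sY) => O2.
  exact: cross_terms O1 O2.
have N0 := Kpsd e pY22.
have Cs : sqnorm (sysC s *m x - sysC u *m z) <=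
    al * sqnorm (sysC s *m x - sysC t *m y) + be * sqnorm (sysC t *m y - sysC u *m z).
  have -> : sysC s *m x - sysC u *m z =
      (sysC s *m x - sysC t *m y) + (sysC t *m y - sysC u *m z) by rewrite addrA subrK.
  exact: sqnormD_le.
move=> hY hX; have I1 := ler_wpM2l (ltW al0) hX; have I2 := ler_wpM2l (ltW be0) hY.
have G1 : al * g ^+ 2 + be * d ^+ 2 = (g + d) ^+ 2.
  by rewrite /al /be; field; rewrite !gt_eqF.
have -> : (g + d) ^+ 2 * sqnorm v = al * (g ^+ 2 * sqnorm v) + be * (d ^+ 2 * sqnorm v).
  by rewrite -G1; ring.
move: I1 I2; rewrite !mulrDr -D; move: Nf N0 Cs; lra.
Qed.

End Dissipation.

Section Truncation.
Context {R : realType} {q m p : nat} (K : 'M[R]_q).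
Hypothesis Kpsd : forall k (X : 'M[R]_k) a, posdef X -> 0 <= noise_form K X a.
Notation system := (@system R q m p).

Definition truncate {k l} (E : 'M[R]_(l, k)) (s : system k) : system l :=
  System (E *m sysA s *m E^T) (fun i => E *m sysN s i *m E^T) (E *m sysB s) (sysC s *m E^T).

Lemma truncateA k l (E : 'M[R]_(l, k)) s (y : 'cV[R]_l) :
  sysA (truncate E s) *m y = E *m (sysA s *m (E^T *m y)).
Proof. by rewrite /= !mulmxA. Qed.

Lemma truncateN k l (E : 'M[R]_(l, k)) s i (y : 'cV[R]_l) :
  sysN (truncate E s) i *m y = E *m (sysN s i *m (E^T *m y)).
Proof. by rewrite /= !mulmxA. Qed.

Lemma truncateC k l (E : 'M[R]_(l, k)) s (y : 'cV[R]_l) :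
  sysC (truncate E s) *m y = sysC s *m (E^T *m y).
Proof. by rewrite /= !mulmxA. Qed.

Lemma drift_truncate k l (E : 'M[R]_(l, k)) s y v :
  drift (truncate E s) y v = E *m drift s (E^T *m y) v.
Proof. by rewrite /drift/= mulmxDr !mulmxA. Qed.

Definition observability_ineq {k} (s : system k) (Q : 'M[R]_k) : Prop :=
  forall x, 2 * bil Q x (sysA s *m x) + noise_form K Q (fun i => sysN s i *m x)
    + sqnorm (sysC s *m x) <= 0.

(** [X] acts as the inverse of a controllability Gramian: started from zero, the expectation of
    [quad X] at the final state is at most the input energy. *)
Definition controllability_ineq {k} (s : system k) (X : 'M[R]_k) : Prop :=
  forall x v, 2 * bil X x (drift s x v) + noise_form K X (fun i => sysN s i *m x)
    <= sqnorm v.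

Definition projc {k l} (E : 'M[R]_(l, k)) : 'M[R]_k := 1%:M - E^T *m E.

Lemma projcE k l (E : 'M[R]_(l, k)) (x : 'cV[R]_k) : E^T *m (E *m x) = x - projc E *m x.
Proof. by rewrite /projc mulmxBl mul1mx subKr mulmxA. Qed.

Lemma noise_formD k (X : 'M[R]_k) a b : X^T = X ->
  (forall i j, bil X (a i) (b j) = 0) ->
  noise_form K X (fun i => a i + b i) = noise_form K X a + noise_form K X b.
Proof.
move=> sX ab; rewrite /noise_form -big_split/=; apply: eq_bigr => i _.
rewrite -big_split/=; apply: eq_bigr => j _.
by rewrite /= bilDr !bilDl ab (bilC (b i) (a j) sX) ab addr0 add0r mulrDr.
Qed.

Section OneTruncation.
Context {k l : nat} (s : system k) (E : 'M[R]_(l, k)) (X : 'M[R]_k).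
Hypotheses (pX : posdef X) (EX : E *m X *m projc E = 0).

Lemma bil_projc (y : 'cV[R]_l) w : bil X (E^T *m y) (projc E *m w) = 0.
Proof.
rewrite /bil trmx_mul trmxK -!mulmxA (mulmxA X) (mulmxA E) (mulmxA E).
by rewrite EX mul0mx mulmx0 mxE.
Qed.

(** What the truncation drops from [w] is [X]-orthogonal to the lifted state [E^T *m y]. Hence the
    drift terms of the truncated inequalities are those of the full ones at the lifted state. *)
Lemma bil_truncate (y : 'cV[R]_l) (w : 'cV[R]_k) :
  bil (E *m X *m E^T) y (E *m w) = bil X (E^T *m y) w.
Proof.
rewrite -[X in bil (X *m _ *m _)]trmxK bil_conj projcE bilDr bilNr.
by rewrite bil_projc oppr0 addr0.
Qed.

(** The form splits into the kept and the dropped components without mixed terms, and the dropped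
    part is nonnegative. This loss is why truncation preserves inequalities and not equations. *)
Lemma noise_form_truncate (w : 'I_q -> 'cV[R]_k) :
  noise_form K (E *m X *m E^T) (fun i => E *m w i) <= noise_form K X w.
Proof.
have -> : noise_form K X w = noise_form K X (fun i => E^T *m (E *m w i) + projc E *m w i).
  by congr noise_form; apply/funext => i; rewrite projcE subrK.
rewrite noise_formD; [|by case: pX|by move=> i j; exact: bil_projc].
have -> : noise_form K (E *m X *m E^T) (fun i => E *m w i) =
    noise_form K X (fun i => E^T *m (E *m w i)).
  rewrite /noise_form; apply: eq_bigr => i _; apply: eq_bigr => j _.
  by rewrite -[X in bil (X *m _ *m _)]trmxK bil_conj.
by rewrite lerDl; exact: Kpsd.
Qed.

Lemma observability_truncate : observability_ineq s X ->
  observability_ineq (truncate E s) (E *m X *m E^T).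
Proof.
move=> h y; apply: le_trans (h (E^T *m y)).
rewrite truncateA truncateC bil_truncate lerD2r lerD2l.
by under [X in noise_form _ _ X]eq_fun do rewrite truncateN; exact: noise_form_truncate.
Qed.

Lemma controllability_truncate : controllability_ineq s X ->
  controllability_ineq (truncate E s) (E *m X *m E^T).
Proof.
move=> h y v; apply: le_trans (h (E^T *m y) v).
rewrite drift_truncate bil_truncate lerD2l.
by under [X in noise_form _ _ X]eq_fun do rewrite truncateN; exact: noise_form_truncate.
Qed.

End OneTruncation.

(* Storage function [Q(x - E^T y) + th^2 X(x + E^T y)]. *)
Lemma truncate_dissipative k l (s : system k) (E : 'M[R]_(l, k)) Q X th :
  0 < th -> E *m E^T = 1%:M -> posdef Q -> posdef X ->
  E *m Q *m projc E = 0 -> th ^+ 2 *: (X *m projc E) = Q *m projc E ->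
  observability_ineq s Q -> controllability_ineq s X ->
  dissipative K s (truncate E s) (2 * th).
Proof.
move=> th0 EE pQ pX EQ QX hQ hX; have [[sQ _] [sX _]] := (pQ, pX).
pose L1 : 'M[R]_(k, k + l) := row_mx 1%:M (- E^T).
pose L2 : 'M[R]_(k, k + l) := row_mx 1%:M E^T.
pose Z := L1^T *m Q *m L1 + th ^+ 2 *: (L2^T *m X *m L2).
have L1E (x : 'cV[R]_k) y : L1 *m col_mx x y = x - E^T *m y.
  by rewrite mul_row_col mul1mx mulNmx.
have L2E (x : 'cV[R]_k) y : L2 *m col_mx x y = x + E^T *m y.
  by rewrite mul_row_col mul1mx.
have ZE x y x' y' : bil Z (col_mx x y) (col_mx x' y') =
   bil Q (x - E^T *m y) (x' - E^T *m y') + th ^+ 2 * bil X (x + E^T *m y) (x' + E^T *m y').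
  by rewrite bilDm bilZm !bil_conj !L1E !L2E.
have th2 : 0 < th ^+ 2 by rewrite exprn_gt0.
have QXw y w : th ^+ 2 * bil X y (projc E *m w) = bil Q y (projc E *m w).
  by rewrite /bil -!mulmxA (mulmxA Q) -QX -scalemxAl -scalemxAr (mulmxA X) [RHS]mxE.
exists Z; split.
  split; first by rewrite /Z linearD/= linearZ/= !trmx_mul !trmxK sQ sX !mulmxA.
  move=> z; rewrite -[z]vsubmxK; set x := usubmx z; set y := dsubmx z => z0.
  rewrite quadE ZE lt_def; apply/andP; split; last first.
    by rewrite addr_ge0// ?mulr_ge0 ?posdef_ge0 ?ltW.
  apply: contraNneq z0 => e.
  have h1 := posdef_ge0 (x - E^T *m y) pQ; have h2 := posdef_ge0 (x + E^T *m y) pX.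
  have /(posdef_eq0 pQ) e1 : bil Q (x - E^T *m y) (x - E^T *m y) <= 0 by nra.
  have /(posdef_eq0 pX) e2 : bil X (x + E^T *m y) (x + E^T *m y) <= 0 by nra.
  have x0 : x = 0.
    have : 2%:R *: x = (x - E^T *m y) + (x + E^T *m y).
      by rewrite addrACA addNr addr0 scaler_nat mulr2n.
    rewrite e1 e2 addr0.
    by move/eqP; rewrite scaler_eq0 pnatr_eq0/= => /eqP.
  have y0 : y = 0.
    by move: e2; rewrite x0 add0r => e2; rewrite -[y]mul1mx -EE -mulmxA e2 mulmx0.
  by rewrite x0 y0 col_mx0.
move=> x y v; pose xh := E^T *m y.
(* [c0] and [c i] are what truncation discards from the drift and the noise at the lifted state
   [xh]. They lie in the range of [projc E], where $th^2 X$ and $Q$ agree and which is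
   $Q$-orthogonal to [xh]. *)
pose c0 := projc E *m (drift s xh v); pose c i := projc E *m (sysN s i *m xh).
have D2 : E^T *m drift (truncate E s) y v = drift s xh v - c0 by rewrite drift_truncate projcE.
have N2 i : E^T *m (sysN (truncate E s) i *m y) = sysN s i *m xh - c i.
  by rewrite truncateN projcE.
have Qc w : bil Q xh (projc E *m w) = 0 by exact: bil_projc.
rewrite ZE D2 -/xh.
(* The difference $x - \hat x$ moves without input and the sum $x + \hat x$ with input $2v$, up to
   the defect with opposite signs. The factor 2 here is the one in the gain $2\,th$. *)
have Em : drift s x v - (drift s xh v - c0) = sysA s *m (x - xh) + c0.
  rewrite /drift mulmxBr opprB addrA addrAC; congr (_ + c0).
  by rewrite opprD addrACA subrr addr0.
have Ep : drift s x v + (drift s xh v - c0) = drift s (x + xh) (2%:R *: v) - c0.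
  rewrite /drift addrA mulmxDr -scalemxAr scaler_nat mulr2n; congr (_ - c0).
  by rewrite addrACA.
rewrite Em Ep.
have hm := hQ (x - xh).
have hp := hX (x + xh) (2%:R *: v).
have cross i j : bil Q (sysN s i *m xh) (c j) = bil Q (c i) (c j).
  by rewrite -[sysN s i *m xh](subrK (c i)) bilDl -N2 bil_projc// add0r.
have [a [b [w [aE bE wE]]]] : exists a b w : 'I_q -> 'cV[R]_k,
    [/\ forall i, sysN s i *m (x - xh) = a i, forall i, sysN s i *m (x + xh) = b i &
        forall i, c i = w i].
  by exists (fun i => sysN s i *m (x - xh)), (fun i => sysN s i *m (x + xh)), c.
have QXc u i : th ^+ 2 * bil X u (w i) = bil Q u (w i) by rewrite -wE QXw.
have Qb i j : bil Q (b i) (w j) = bil Q (a i) (w j) + 2 * bil Q (w i) (w j).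
  rewrite -bE -aE -!wE -cross mulmxDr mulmxBr bilDl bilDl bilNl; ring.
(* The noise defect contributes $2\langle a, w\rangle + \langle w, w\rangle$ from the difference and
   $-2\langle b, w\rangle + \langle w, w\rangle$ from the sum, all in the $Q$-form. Since $\langle
   b, w\rangle = \langle a, w\rangle + 2\langle w, w\rangle$, the total is $-2\langle w, w\rangle$,
   which has the good sign. *)
have Nf : noise_form K Z (fun i => col_mx (sysN s i *m x) (sysN (truncate E s) i *m y)) =
    noise_form K Q a + th ^+ 2 * noise_form K X b - 2 * noise_form K Q w.
  have n1 i : sysN s i *m x - (sysN s i *m xh - c i) = a i + w i.
    by rewrite -aE -wE mulmxBr opprB addrA addrAC.
  have n2 i : sysN s i *m x + (sysN s i *m xh - c i) = b i - w i.
    by rewrite -bE -wE mulmxDr addrA.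
  rewrite /noise_form !mulr_sumr -sumrN -!big_split/=; apply: eq_bigr => i _.
  rewrite !mulr_sumr -sumrN -!big_split/=; apply: eq_bigr => j _.
  rewrite ZE !N2 !n1 !n2 !bilDr !bilDl !bilNr !bilNl !mulrDr !mulrN.
  have := Qb i j; have := Qb j i; have := QXc (b i) j; have := QXc (b j) i.
  have := QXc (w i) j; rewrite (bilC (w i) (b j) sX) (bilC (w i) (a j) sQ).
  rewrite (bilC (w j) (w i) sQ); set k1 := K i j.
  set q1 := bil Q (b i) (w j); set q2 := bil Q (b j) (w i).
  move=> h1 h2 h3 h4 h5; rewrite {}h4 in h2; rewrite {}h5 in h3.
  have e1 t u : th ^+ 2 * t = u -> th ^+ 2 * (k1 * t) = k1 * u.
    by move=> <-; rewrite mulrCA.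
  move/e1 : h1 => h1; move/e1 : h2 => h2; move/e1 : h3 => h3.
  lra.
have N0 := Kpsd w pQ.
rewrite Nf.
have nA : (fun i => sysN s i *m (x - xh)) = a by apply/funext => i; exact: aE.
have nB : (fun i => sysN s i *m (x + xh)) = b by apply/funext => i; exact: bE.
rewrite nA in hm; rewrite nB in hp.
have sq2 : sqnorm (2%:R *: v) = 4 * sqnorm v.
  by rewrite /sqnorm mulr_sumr; apply: eq_bigr => i _; rewrite mxE; ring.
have Qx : bil Q (x - xh) c0 - th ^+ 2 * bil X (x + xh) c0 = 0.
  by rewrite QXw !bilDl bilNl Qc oppr0 subrr.
have Cx : sysC s *m x - sysC (truncate E s) *m y = sysC s *m (x - xh).
  by rewrite truncateC mulmxBr.
rewrite Cx (bilDr Q) (bilDr X (x + xh) (drift s (x + xh) (2%:R *: v)) (- c0)) bilNr.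
move: hm hp; rewrite sq2 => hm /(ler_wpM2l (ltW th2)) hp.
move: Qx hm hp N0; lra.
Qed.

End Truncation.

(** * Removing the coordinates of a balanced system one at a time *)

Section CoordinateTruncation.
Context {R : realType} {q m p : nat} (K : 'M[R]_q).
Hypothesis Kpsd : forall k (X : 'M[R]_k) a, posdef X -> 0 <= noise_form K X a.
Notation system := (@system R q m p).

Definition coord_proj {r k} (le_rk : (r <= k)%N) : 'M[R]_(r, k) :=
  rowsub (widen_ord le_rk) 1%:M.

(** The diagonal is indexed by [nat], so that one sequence serves every truncation order and the
    leading block of [diagn f k] is again of this form. *)
Definition diagn (f : nat -> R) k : 'M[R]_k := diag (fun i : 'I_k => f i).

Lemma coord_projE r k (le_rk : (r <= k)%N) i j :
  coord_proj le_rk i j = (i == j :> nat)%:R.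
Proof. by rewrite !mxE. Qed.

Lemma coord_proj_mul r k l (le_rk : (r <= k)%N) (A : 'M[R]_(k, l)) :
  coord_proj le_rk *m A = rowsub (widen_ord le_rk) A.
Proof. by rewrite mul_rowsub_mx mul1mx. Qed.

Lemma mul_coord_projT r k l (le_rk : (r <= k)%N) (A : 'M[R]_(l, k)) :
  A *m (coord_proj le_rk)^T = colsub (widen_ord le_rk) A.
Proof. by rewrite /coord_proj trmx_mxsub trmx1 mulmx_colsub mulmx1. Qed.

Lemma coord_proj_unit r k (le_rk : (r <= k)%N) :
  coord_proj le_rk *m (coord_proj le_rk)^T = 1%:M.
Proof.
rewrite mul_coord_projT; apply/matrixP => i j; rewrite !mxE.
by congr (nat_of_bool _)%:R.
Qed.

Lemma coord_proj_comp r k n (le_rk : (r <= k)%N) (le_kn : (k <= n)%N) (le_rn : (r <= n)%N) :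
  coord_proj le_rk *m coord_proj le_kn = coord_proj le_rn.
Proof.
by rewrite coord_proj_mul; apply/matrixP => i j; rewrite [LHS]mxE !coord_projE.
Qed.

Lemma coord_proj_diag r k (le_rk : (r <= k)%N) f :
  coord_proj le_rk *m diagn f k = diagn f r *m coord_proj le_rk.
Proof.
rewrite coord_proj_mul mul_diag_mx; apply/matrixP => i j.
by rewrite !mxE /= -mulr_natr.
Qed.

Lemma coord_proj_diag_projc r k (le_rk : (r <= k)%N) f :
  coord_proj le_rk *m diagn f k *m projc (coord_proj le_rk) = 0.
Proof.
rewrite coord_proj_diag -mulmxA /projc mulmxBr mulmx1 mulmxA coord_proj_unit.
by rewrite mul1mx subrr mulmx0.
Qed.

Lemma diagn_truncate r k (le_rk : (r <= k)%N) f :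
  coord_proj le_rk *m diagn f k *m (coord_proj le_rk)^T = diagn f r.
Proof. by rewrite coord_proj_diag -mulmxA coord_proj_unit mulmx1. Qed.

Lemma posdef_diagn (f : nat -> R) k : (forall i, (i < k)%N -> 0 < f i) -> posdef (diagn f k).
Proof.
move=> f0; split; first by rewrite /diagn /diag tr_diag_mx.
move=> x x0; rewrite quadE.
have -> : bil (diagn f k) x x = \sum_(i < k) f i * x i 0 ^+ 2.
  rewrite /bil mul_mx_diag mxE; apply: eq_bigr => i _; rewrite !mxE; ring.
have [i xi] : exists i, x i 0 != 0.
  apply/existsP; apply: contraNT x0; rewrite negb_exists => /forallP h.
  apply/eqP/colP => i; rewrite [RHS]mxE; have := h i; rewrite negbK => /eqP.
  by [].
rewrite (bigD1 i)//= ltr_pwDl//; first by rewrite mulr_gt0 ?f0// exprn_even_gt0.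
by apply: sumr_ge0 => j _; rewrite mulr_ge0 ?sqr_ge0// ltW// f0.
Qed.

Lemma truncate_comp k l h (E : 'M[R]_(l, k)) (E' : 'M[R]_(h, l)) (s : system k) :
  truncate E' (truncate E s) = truncate (E' *m E) s.
Proof.
rewrite /truncate /=; congr System; rewrite ?trmx_mul ?mulmxA//.
by apply/funext => i; rewrite ?mulmxA.
Qed.

(** [projc] is here the projection onto the last coordinate, the only place where the two diagonals
    have to match. *)
Lemma projc_last k (f g : nat -> R) (th : R) : th ^+ 2 * g k = f k ->
  th ^+ 2 *: (diagn g k.+1 *m projc (coord_proj (leqnSn k))) =
  diagn f k.+1 *m projc (coord_proj (leqnSn k)).
Proof.
move=> e; rewrite !mul_diag_mx; apply/matrixP => i j.
have [ik|ki] := ltnP i k; last first.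
  have ik : (i : nat) = k by apply/eqP; rewrite eqn_leq ki -ltnS ltn_ord.
  by rewrite !mxE ik mulrA e.
suff P0 : projc (coord_proj (leqnSn k)) i j = 0 by rewrite [LHS]mxE [X in _ * X]mxE [RHS]mxE P0 !mulr0.
rewrite /projc mxE [X in _ + X]mxE [X in _ - X]mxE (bigD1 (Ordinal ik))//= big1.
  by rewrite [X in _ - (X * _ + _)]mxE !coord_projE/= eqxx mul1r addr0 mxE -val_eqE subrr.
move=> l; rewrite -val_eqE/= => li; rewrite mxE coord_projE/=.
by rewrite (negbTE li) mul0r.
Qed.

(** Induction on the number of states, removing the last one first. The truncated system satisfies
    both inequalities with the leading diagonal blocks, so the induction hypothesis applies to it
    and [dissipative_trans] adds the gains. *)
Lemma balanced_truncation_dissipative (f g th : nat -> R) k (s : system k) :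
  (forall i, (i < k)%N -> [/\ 0 < f i, 0 < g i, 0 < th i & th i ^+ 2 * g i = f i]) ->
  observability_ineq K s (diagn f k) -> controllability_ineq K s (diagn g k) ->
  forall r (lt_rk : (r < k)%N),
  dissipative K s (truncate (coord_proj (ltnW lt_rk)) s) (2 * \sum_(r <= i < k) th i).
Proof.
elim: k s => [//|k IH] s H hf hg r lt_rk.
have [f0 g0 th0 e] := H k (ltnSn k).
have pf : posdef (diagn f k.+1) by apply: posdef_diagn => i /H[].
have pg : posdef (diagn g k.+1) by apply: posdef_diagn => i /H[].
have EE := coord_proj_unit (leqnSn k).
have step : dissipative K s (truncate (coord_proj (leqnSn k)) s) (2 * th k).
  apply: (truncate_dissipative Kpsd th0 EE pf pg) => //.
    exact: coord_proj_diag_projc.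
  exact: projc_last.
have : (r <= k)%N by rewrite -ltnS.
rewrite leq_eqVlt => /predU1P[rk|rk].
  subst r; rewrite big_nat1.
  by rewrite (_ : ltnW lt_rk = leqnSn k)//; exact: eq_irrelevance.
have fo := observability_truncate Kpsd pf (coord_proj_diag_projc (leqnSn k) f) hf.
have go := controllability_truncate Kpsd pg (coord_proj_diag_projc (leqnSn k) g) hg.
rewrite diagn_truncate in fo; rewrite diagn_truncate in go.
have := IH _ (fun i ik => H i (ltnW ik)) fo go r rk.
rewrite truncate_comp (coord_proj_comp _ _ (ltnW lt_rk)) => tl.
rewrite big_nat_recr/=; last exact: ltnW.
rewrite addrC mulrDr; apply: dissipative_trans step tl => //; first by rewrite mulr_gt0.
rewrite mulr_gt0// big_ltn// ltr_pwDl//; first by have [] := H r lt_rk.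
by rewrite big_nat_cond; apply: sumr_ge0 => i /andP[/andP[_ ik] _]; have [_ _ /ltW] := H i (ltnW ik).
Qed.

(** Storage functions pull back along a change of the first state; inputs and outputs are
    untouched. *)
Lemma dissipative_coord k l (s s' : system k) (t : system l) (S : 'M[R]_k) gam :
  S \in unitmx -> S *m sysA s = sysA s' *m S ->
  (forall i, S *m sysN s i = sysN s' i *m S) -> S *m sysB s = sysB s' ->
  sysC s = sysC s' *m S -> dissipative K s' t gam -> dissipative K s t gam.
Proof.
move=> uS hA hN hB hC [X [pX dX]].
pose L : 'M[R]_(k + l) := block_mx S 0 0 1%:M.
have LE (x : 'cV[R]_k) (y : 'cV[R]_l) : L *m col_mx x y = col_mx (S *m x) y.
  by rewrite mul_block_col !mul0mx mul1mx addr0 add0r.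
exists (L^T *m X *m L); split.
  apply: posdef_conj => // z; rewrite -[z]vsubmxK LE => /eqP.
  rewrite col_mx_eq0 => /andP[/eqP Sx /eqP ->].
  by rewrite -[usubmx z](mulKmx uS) Sx mulmx0 col_mx0.
move=> x y v; rewrite bil_conj !LE.
have -> : S *m drift s x v = drift s' (S *m x) v.
  by rewrite /drift mulmxDr !mulmxA hA hB.
rewrite hC -[sysC s' *m S *m x]mulmxA; have := dX (S *m x) y v; congr (_ + _ <= _).
apply: eq_bigr => i _; apply: eq_bigr => j _.
by rewrite /= bil_conj !LE !mulmxA !hN.
Qed.

End CoordinateTruncation.

(** * The loop closed by the Riccati feedback *)

Section ClosedLoop.
Context {R : realType} {n m p q r : nat}.
Variables (K : 'M[R]_q) (A : 'M[R]_n) (N : 'I_q -> 'M[R]_n) (B : 'M[R]_(n, m))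
  (C : 'M[R]_(p, n)) (P Q S : 'M[R]_n) (sigma : 'I_n -> R).
Hypothesis Kpsd : forall k (X : 'M[R]_k) a, posdef X -> 0 <= noise_form K X a.

Lemma bil_lyapunov (X : 'M[R]_n) x : X^T = X ->
  bil (A^T *m X + X *m A) x x = 2 * bil X x (A *m x).
Proof.
move=> sX; rewrite bilDm.
have -> : bil (X *m A) x x = bil X x (A *m x) by rewrite /bil !mulmxA.
have -> : bil (A^T *m X) x x = bil X (A *m x) x by rewrite /bil trmx_mul !mulmxA.
by rewrite (bilC _ x sX); ring.
Qed.

Lemma bil_noise_term (X : 'M[R]_n) x :
  bil (noise_term K N X) x x = noise_form K X (fun i => N i *m x).
Proof.
rewrite /bil /noise_term mulmx_sumr mulmx_suml summxE; apply: eq_bigr => i _.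
rewrite mulmx_sumr mulmx_suml summxE; apply: eq_bigr => j _.
by rewrite -scalemxAr -scalemxAl mxE /bil trmx_mul !mulmxA.
Qed.

Lemma bil_gram l (M : 'M[R]_(l, n)) x : bil (M^T *m M) x x = sqnorm (M *m x).
Proof. by rewrite sqnormE /bil trmx_mul !mulmxA mulmx1. Qed.

Lemma bil_input (X : 'M[R]_n) x (w : 'cV[R]_m) : X^T = X ->
  bil X x (B *m w) = bil 1%:M (B^T *m X *m x) w.
Proof. by move=> sX; rewrite /bil !trmx_mul trmxK sX mulmx1 !mulmxA. Qed.

Lemma bil_input_gram (X : 'M[R]_n) x : X^T = X ->
  bil (X *m B *m B^T *m X) x x = sqnorm (B^T *m X *m x).
Proof.
by move=> sX; rewrite -bil_gram trmx_mul trmxK sX !mulmxA.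
Qed.

Lemma riccati_eq_form x : Q^T = Q -> riccati_eq K A N B C Q ->
  2 * bil Q x (A *m x) + noise_form K Q (fun i => N i *m x) =
  sqnorm (B^T *m Q *m x) - sqnorm (C *m x).
Proof.
move=> sQ /(congr1 (fun X => bil X x x)) /=.
rewrite [RHS]/bil mulmx0 mul0mx mxE.
have bilBm X Y : bil (X - Y) x x = bil X x x - bil Y x x.
  by rewrite -scaleN1r bilDm bilZm mulN1r.
rewrite bilBm bil_input_gram// 2!bilDm bil_lyapunov// bil_noise_term bil_gram; lra.
Qed.

Lemma riccati_ineq_form x : P^T = P -> riccati_ineq K A N B C P ->
  2 * bil (invmx P) x (A *m x) + noise_form K (invmx P) (fun i => N i *m x) <=
  sqnorm (C *m x) - sqnorm (B^T *m invmx P *m x).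
Proof.
move=> sP [_ /(_ x)]; have sV : (invmx P)^T = invmx P by rewrite trmx_inv sP.
rewrite quadE bilDm bil_input_gram//.
have bilBm X Y : bil (X - Y) x x = bil X x x - bil Y x x.
  by rewrite -scaleN1r bilDm bilZm mulN1r.
rewrite bilBm bilDm bil_lyapunov// bil_noise_term bil_gram; lra.
Qed.

(* The loop closed by [u = v - B^T Q x], with output [u; y]: the normalised
   coprime factorisation of the original system. *)
Definition closed_loop : @system R q m (m + p) n :=
  System (A - B *m B^T *m Q) N B (col_mx (- (B^T *m Q)) C).

Lemma sqnorm_col k l (x : 'cV[R]_k) (y : 'cV[R]_l) :
  sqnorm (col_mx x y) = sqnorm x + sqnorm y.
Proof.
rewrite /sqnorm big_split_ord/=; congr (_ + _); apply: eq_bigr => i _.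
  by rewrite col_mxEu.
by rewrite col_mxEd.
Qed.

Lemma sqnormN k (x : 'cV[R]_k) : sqnorm (- x) = sqnorm x.
Proof. by apply: eq_bigr => i _; rewrite mxE sqrrN. Qed.

Lemma sqnormD k (x y : 'cV[R]_k) : sqnorm (x + y) = sqnorm x + 2 * bil 1%:M x y + sqnorm y.
Proof.
rewrite !sqnormE bilDl !bilDr (bilC y x) ?trmx1//; ring.
Qed.

(** The feedback subtracts $2 |B^T Q x|^2$ from the drift of $x^T Q x$: one half cancels the
    quadratic Riccati term, the other half pays for the output component $-B^T Q x$. *)
Lemma closed_loop_observability : Q^T = Q -> riccati_eq K A N B C Q ->
  observability_ineq K closed_loop Q.
Proof.
move=> sQ ric x; rewrite /= mul_col_mx sqnorm_col mulNmx sqnormN.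
have := riccati_eq_form x sQ ric.
rewrite mulmxBl -[B *m B^T *m Q *m x]mulmxA -[B *m _ *m _]mulmxA bilDr bilNr.
rewrite bil_input// !mulmxA -sqnormE; lra.
Qed.

Lemma closed_loop_controllability : Q^T = Q -> P^T = P ->
  riccati_eq K A N B C Q -> riccati_ineq K A N B C P ->
  controllability_ineq K closed_loop (invmx P + Q).
Proof.
move=> sQ sP ric rin x v; rewrite /drift/=.
have sV : (invmx P)^T = invmx P by rewrite trmx_inv sP.
have sX : (invmx P + Q)^T = invmx P + Q by rewrite linearD/= sV sQ.
have h1 := riccati_eq_form x sQ ric; have h2 := riccati_ineq_form x sP rin.
have Nf : noise_form K (invmx P + Q) (fun i => N i *m x) =
    noise_form K (invmx P) (fun i => N i *m x) + noise_form K Q (fun i => N i *m x).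
  rewrite /noise_form -big_split/=; apply: eq_bigr => i _.
  by rewrite -big_split/=; apply: eq_bigr => j _; rewrite bilDm mulrDr.
set b := B^T *m Q *m x in h1; set c := B^T *m invmx P *m x in h2.
(* Absorbing the feedback into the input leaves the open-loop drift, to which both Riccati relations
   apply. *)
have dr : (A - B *m B^T *m Q) *m x + B *m v = A *m x + B *m (v - b).
  by rewrite mulmxBl mulmxBr /b !mulmxA addrAC addrA.
rewrite dr Nf bilDr bilDm (bil_input x (v - b) sX).
have -> : B^T *m (invmx P + Q) *m x = c + b by rewrite mulmxDr mulmxDl.
(* The completed square: exactly the slack left when the two relations are added. *)
have s1 := sqnorm_ge0 (v - (c + b)).
rewrite sqnormD sqnormN bilNr (bilC v (c + b)) ?trmx1// in s1.
have s2 := sqnormD c b.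
rewrite [bil 1%:M (c + b) (v - b)]bilDr bilNr.
have e3 : bil 1%:M (c + b) b = bil 1%:M c b + sqnorm b by rewrite bilDl -sqnormE.
rewrite e3; rewrite s2 in s1; lra.
Qed.

Lemma invmx_congr : S \in unitmx -> P \in unitmx ->
  S *m P *m S^T = diag sigma -> (forall i, 0 < sigma i) ->
  (invmx S)^T *m invmx P *m invmx S = diag (fun i => (sigma i)^-1).
Proof.
move=> uS uP eP s0; set X := LHS.
have XD : X *m diag sigma = 1%:M.
  rewrite -eP /X -!mulmxA mulKmx// (mulmxA (invmx P)) mulVmx// mul1mx.
  by rewrite -trmx_mul mulmxV// trmx1.
have DD : diag sigma *m diag (fun i => (sigma i)^-1) = 1%:M.
  rewrite mul_diag_mx; apply/matrixP => i j; rewrite !mxE mulrnAr.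
  by rewrite mulfV// gt_eqF.
by rewrite -[X]mulmx1 -DD mulmxA XD mul1mx.
Qed.

Definition coordinates (T : 'M[R]_n) (s : @system R q m (m + p) n) :=
  System (T *m sysA s *m invmx T) (fun i => T *m sysN s i *m invmx T) (T *m sysB s)
    (sysC s *m invmx T).

Lemma observability_coord (T X : 'M[R]_n) s : T \in unitmx ->
  observability_ineq K s X ->
  observability_ineq K (coordinates T s) ((invmx T)^T *m X *m invmx T).
Proof.
move=> uT h x; have := h (invmx T *m x); congr (_ <= _); rewrite /= bil_conj.
rewrite !mulmxA mulVmx// mul1mx; congr (_ + _ + _).
apply: eq_bigr => i _; apply: eq_bigr => j _.
by rewrite /= bil_conj !mulmxA mulVmx// !mul1mx.
Qed.

Lemma controllability_coord (T X : 'M[R]_n) s : T \in unitmx ->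
  controllability_ineq K s X ->
  controllability_ineq K (coordinates T s) ((invmx T)^T *m X *m invmx T).
Proof.
move=> uT h x v; have := h (invmx T *m x) v; congr (_ <= _); rewrite /drift/= bil_conj.
rewrite mulmxDr !mulmxA mulVmx// !mul1mx; congr (_ + _).
apply: eq_bigr => i _; apply: eq_bigr => j _.
by rewrite /= bil_conj !mulmxA mulVmx// !mul1mx.
Qed.

Variable (lt_rn : (r < n)%N).
Let Ar := trunc_state (ltnW lt_rn) S A.
Let Nr i := trunc_state (ltnW lt_rn) S (N i).
Let Br := trunc_input (ltnW lt_rn) S B.
Let Cr := trunc_output (ltnW lt_rn) S C.
Let Sr := trunc_diag (ltnW lt_rn) sigma.

Definition reduced_loop : @system R q m (m + p) r :=
  System (Ar - Br *m Br^T *m Sr) Nr Br (col_mx (- (Br^T *m Sr)) Cr).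

Lemma trunc_stateE (M : 'M[R]_n) :
  trunc_state (ltnW lt_rn) S M =
  coord_proj (ltnW lt_rn) *m (S *m M *m invmx S) *m (coord_proj (ltnW lt_rn))^T.
Proof. by rewrite coord_proj_mul mul_coord_projT; apply/matrixP => i j; rewrite !mxE. Qed.

(** Closing the loop commutes with truncation: in balancing coordinates [Q] is diagonal, so it
    commutes with dropping coordinates and the feedback $B^T Q$ truncates to $B_r^T \Sigma_r$. *)
Lemma reduced_loopE : S \in unitmx -> (invmx S)^T *m Q *m invmx S = diag sigma ->
  truncate (coord_proj (ltnW lt_rn)) (coordinates S closed_loop) = reduced_loop.
Proof.
move=> uS eQ; set E := coord_proj _.
have BrE : Br = E *m (S *m B) by rewrite coord_proj_mul.
have SrE : diag sigma *m E^T = E^T *m Sr.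
  rewrite /diag mul_diag_mx mul_mx_diag; apply/matrixP => i j; rewrite !mxE.
  rewrite mulrC; case: eqP => [<-//|]; by rewrite !mul0r.
have BS : Br^T *m Sr = B^T *m Q *m invmx S *m E^T.
  rewrite BrE !trmx_mul -[_ *m E^T *m Sr]mulmxA -SrE -eQ !mulmxA.
  by rewrite -(mulmxA B^T S^T) -trmx_mul mulVmx// trmx1 mulmx1.
rewrite /truncate /reduced_loop /=; congr System.
- rewrite /Ar trunc_stateE -/E -[Br *m _ *m _]mulmxA BS BrE.
  by rewrite mulmxBr mulmxBl mulmxBr mulmxBl !mulmxA.
- by apply/funext => i; rewrite /Nr trunc_stateE.
- by rewrite BrE.
- rewrite !mul_col_mx BS !mulNmx; congr col_mx.
  by rewrite /Cr /trunc_output mul_coord_projT.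
Qed.

Lemma closed_loop_dissipative : posdef P -> posdef Q ->
  riccati_eq K A N B C Q -> riccati_ineq K A N B C P ->
  sqrt_eigenvalues (P *m Q) sigma -> balancing S P Q sigma ->
  dissipative K closed_loop reduced_loop
    (2 * \sum_(k < n | (r <= k)%N) sigma k / Num.sqrt (1 + sigma k ^+ 2)).
Proof.
move=> pP pQ ric rin [s0 _ _] [uS eP eQ].
(* Extension of [sigma] to all of [nat]; the default 1 keeps every value positive. *)
pose sg i := oapp sigma 1 (insub i : option 'I_n).
have sgE (i : 'I_n) : sg i = sigma i by rewrite /sg valK.
have sg0 i : 0 < sg i by rewrite /sg; case: insubP => //= *; exact: s0.
pose th i := sg i / Num.sqrt (1 + sg i ^+ 2).
(* The diagonal of $P^{-1} + Q$ in balancing coordinates; [th] is determined by $th_i^2 g_i =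
   \sigma_i$. *)
pose g i := (sg i)^-1 + sg i.
have D1 i : 0 < 1 + sg i ^+ 2 by rewrite ltr_wpDr ?sqr_ge0.
have Hs i : (i < n)%N -> [/\ 0 < sg i, 0 < g i, 0 < th i & th i ^+ 2 * g i = sg i].
  move=> _; split => //; first by rewrite addr_gt0 ?invr_gt0.
    by rewrite divr_gt0 ?sqrtr_gt0.
  rewrite /th /g exprMn exprVn sqr_sqrtr ?ltW//.
  by field; rewrite !gt_eqF.
have [[sP _] [sQ _]] := (pP, pQ).
have dQ : (invmx S)^T *m Q *m invmx S = diagn sg n.
  by rewrite eQ; congr diag_mx; apply/rowP => i; rewrite !mxE sgE.
have dX : (invmx S)^T *m (invmx P + Q) *m invmx S = diagn g n.
  rewrite mulmxDr mulmxDl eQ invmx_congr ?(posdef_unitmx pP)//.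
  apply/matrixP => i j; rewrite !mxE -mulrnDl; congr (_ *+ _).
  by rewrite /g sgE.
have o1 := observability_coord uS (closed_loop_observability sQ ric).
have c1 := controllability_coord uS (closed_loop_controllability sQ sP ric rin).
rewrite dQ in o1; rewrite dX in c1.
have := balanced_truncation_dissipative Kpsd Hs o1 c1 lt_rn.
rewrite reduced_loopE// big_geq_mkord.
rewrite (eq_bigr (fun k : 'I_n => sigma k / Num.sqrt (1 + sigma k ^+ 2))); last first.
  by move=> i _; rewrite /th sgE.
apply: (dissipative_coord uS) => //= [|i|].
- by rewrite mulmxKV.
- by rewrite mulmxKV.
- by rewrite mulmxKV.
Qed.

End ClosedLoop.

(** * Energy balance along trajectories *)

Section SquareIntegrableProcesses.
Context {R : realType} {d : measure_display} {Omega : measurableType d}.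
Variables (Pr : probability Omega R) (F : R -> set (set Omega)).
Hypothesis hF : usual_filtration Pr F.
Let mu := time_prob Pr.
Variable T : R.

Definition L2scal (a : R -> Omega -> R) : Prop :=
  [/\ forall t, upto T t -> measurable_wrt (F t) (a t),
      measurable_fun (upto T `*` setT) (fun z : R * Omega => a z.1 z.2) &
      sqint mu (cut (upto T) a)].

Definition L2proc {k} (x : R -> Omega -> 'cV[R]_k) : Prop :=
  forall i, L2scal (fun t w => x t w i 0).

Let sF t : upto T t -> sigma_algebra setT (F t).
Proof. by move=> /uptoP/andP[t0 _]; exact: (@filtration_sigma _ _ _ _ _ hF t t0). Qed.

Lemma L2scal0 : L2scal (fun _ _ => 0).
Proof.
split => //; first by move=> t tT; exact: measurable_wrt_cst (sF tT).
by rewrite (_ : cut _ _ = fun=> 0); [exact: sqint0|apply/funext => z; rewrite /cut mulr0].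
Qed.

Lemma L2scalD a b : L2scal a -> L2scal b -> L2scal (fun t w => a t w + b t w).
Proof.
move=> [wa ma ia] [wb mb ib]; split.
- by move=> t tT; apply: measurable_wrtD; [exact: sF|exact: wa|exact: wb].
- exact: measurable_funD.
- by rewrite cutD; exact: sqintD.
Qed.

Lemma L2scalZ c a : L2scal a -> L2scal (fun t w => c * a t w).
Proof.
move=> [wa ma ia]; split.
- move=> t tT; apply: measurable_wrtM; [exact: sF|exact: measurable_wrt_cst (sF tT)|exact: wa].
- exact: measurable_funM.
- by rewrite cutZ; exact: sqintZ.
Qed.

Lemma L2scal_sum I (s : seq I) (a : I -> R -> Omega -> R) :
  (forall i, L2scal (a i)) -> L2scal (fun t w => \sum_(i <- s) a i t w).
Proof.
move=> ha; elim: s => [|i s IH].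
  by under eq_fun do under eq_fun do rewrite big_nil; exact: L2scal0.
by under eq_fun do under eq_fun do rewrite big_cons; exact: L2scalD.
Qed.

Lemma L2procD k (x y : R -> Omega -> 'cV[R]_k) : L2proc x -> L2proc y ->
  L2proc (fun t w => x t w + y t w).
Proof.
move=> hx hy i; rewrite (_ : (fun t w => _) = fun t w => x t w i 0 + y t w i 0).
  exact: L2scalD.
by apply/funext => t; apply/funext => w; rewrite mxE.
Qed.

Lemma L2procM k l (M : 'M[R]_(l, k)) (x : R -> Omega -> 'cV[R]_k) : L2proc x ->
  L2proc (fun t w => M *m x t w).
Proof.
move=> hx i; rewrite (_ : (fun t w => _) = fun t w => \sum_j M i j * x t w j 0).
  by apply: L2scal_sum => j; exact: L2scalZ.
by apply/funext => t; apply/funext => w; rewrite mxE.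
Qed.

Lemma L2procN k (x : R -> Omega -> 'cV[R]_k) : L2proc x -> L2proc (fun t w => - x t w).
Proof.
move=> hx; rewrite (_ : (fun t w => _) = fun t w => (- 1%:M) *m x t w).
  exact: L2procM.
by apply/funext => t; apply/funext => w; rewrite mulNmx mul1mx.
Qed.

Lemma L2proc_col k l (x : R -> Omega -> 'cV[R]_k) (y : R -> Omega -> 'cV[R]_l) :
  L2proc x -> L2proc y -> L2proc (fun t w => col_mx (x t w) (y t w)).
Proof.
move=> hx hy i; case: (split_ordP i) => j ->.
  rewrite (_ : (fun t w => _) = fun t w => x t w j 0)//.
  by apply/funext => t; apply/funext => w; rewrite col_mxEu.
rewrite (_ : (fun t w => _) = fun t w => y t w j 0)//.
by apply/funext => t; apply/funext => w; rewrite col_mxEd.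
Qed.

(** Joint measurability alone: on the half-line the reduced state is not known in advance to be
    square integrable, yet its error norm has to be a limit over horizons. *)
Definition measurable_paths (D : set R) {k} (x : R -> Omega -> 'cV[R]_k) : Prop :=
  forall i, measurable_fun (D `*` setT) (fun z : R * Omega => x z.1 z.2 i 0).

Lemma measurable_sqnorm (D : set R) k (x : R -> Omega -> 'cV[R]_k) :
  measurable_paths D x ->
  measurable_fun (D `*` setT) (fun z : R * Omega => sqnorm (x z.1 z.2)).
Proof. by move=> mx; apply: measurable_sum => i; exact: measurable_funX. Qed.

Lemma L2sq_cut (D : set R) k (x : R -> Omega -> 'cV[R]_k) : measurable D ->
  measurable_paths D x ->
  L2sq Pr D x = (\int[mu]_z (cut D (fun s w => sqnorm (x s w)) z)%:E)%E.
Proof.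
move=> mD mx; rewrite /L2sq integral_cut//; first exact: measurable_sqnorm.
by move=> s w; exact: sqnorm_ge0.
Qed.

Lemma cut_sqnorm (D : set R) k (x : R -> Omega -> 'cV[R]_k) :
  cut D (fun s w => sqnorm (x s w)) = fun z => \sum_i cut D (fun s w => x s w i 0) z ^+ 2.
Proof.
apply/funext => z; rewrite /cut /sqnorm mulr_sumr; apply: eq_bigr => i _.
by rewrite exprMn indicE; case: (_ \in _); rewrite ?expr1n ?expr0n.
Qed.

Lemma L2procI k (x : R -> Omega -> 'cV[R]_k) : adapted_process F (upto T) x ->
  (L2sq Pr (upto T) x < +oo)%E -> L2proc x.
Proof.
move=> ax fx i; have [wx mx] := ax i.
have mxs j : measurable_fun (upto T `*` setT) (fun z : R * Omega => x z.1 z.2 j 0).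
  by have [] := ax j.
have mU := @measurable_upto R T.
split => //; split; first exact: measurable_cut.
move: fx; rewrite L2sq_cut//; apply: le_lt_trans; apply: ge0_le_integral => //.
- by move=> z _; rewrite lee_fin sqr_ge0.
- by apply/measurable_EFinP; apply: measurable_funX; exact: measurable_cut.
- by apply/measurable_EFinP; apply: measurable_cut => //; exact: measurable_sqnorm.
- move=> z _; rewrite lee_fin cut_sqnorm (bigD1 i)//= lerDl.
  by apply: sumr_ge0 => j _; exact: sqr_ge0.
Qed.

Definition L2val k (x : R -> Omega -> 'cV[R]_k) : R :=
  \int[mu]_z cut (upto T) (fun s w => sqnorm (x s w)) z.

Lemma L2proc_sqnorm k (x : R -> Omega -> 'cV[R]_k) : L2proc x ->
  mu.-integrable setT (fun z => (cut (upto T) (fun s w => sqnorm (x s w)) z)%:E).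
Proof.
move=> hx; rewrite cut_sqnorm; under eq_fun do rewrite -sumEFin.
apply: integrable_sum => // i _.
by apply: sqint_integrable_sqr; have [] := hx i.
Qed.

Lemma L2sq_val k (x : R -> Omega -> 'cV[R]_k) : L2proc x ->
  L2sq Pr (upto T) x = (L2val x)%:E.
Proof.
move=> hx; have mx i : measurable_fun (upto T `*` setT) (fun z : R * Omega => x z.1 z.2 i 0).
  by have [] := hx i.
rewrite L2sq_cut//; last exact: measurable_upto.
rewrite /L2val /Rintegral fineK//.
exact: integrable_fin_num (L2proc_sqnorm hx).
Qed.

End SquareIntegrableProcesses.

(** * Expectation of a quadratic form of an Ito process *)

Section QuadraticMoment.
Context {R : realType} {d : measure_display} {Omega : measurableType d}.
Variables (Pr : probability Omega R) (F : R -> set (set Omega)).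
Variables (q : nat) (K : 'M[R]_q) (W : R -> Omega -> 'cV[R]_q).
Hypotheses (hF : usual_filtration Pr F) (hW : wiener Pr F K W).
Let mu := time_prob Pr.
Variable T : R.
Hypothesis T0 : 0 < T.

Section Formula.
Variables (k : nat) (z a : R -> Omega -> 'cV[R]_k) (G : 'I_q -> R -> Omega -> 'cV[R]_k).
Hypotheses (hz : L2proc Pr F T z) (ha : L2proc Pr F T a)
  (hG : forall i, L2proc Pr F T (G i)).
Hypothesis dz : forall l, ito_process Pr F W T (fun s w => a s w l 0)
  (fun i s w => G i s w l 0) (fun s w => z s w l 0).

(** The drift that Ito's formula assigns to $z^T X z$ when $dz = a\,dt + \sum_i G_i\,dW_i$. *)
Definition generator (X : 'M[R]_k) (s : R) (w : Omega) : R :=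
  2 * bil X (z s w) (a s w) + noise_form K X (fun i => G i s w).

Let Z l := cut (upto T) (fun s w => z s w l 0).
Let A l := cut (upto T) (fun s w => a s w l 0).
Let H i l := cut (upto T) (fun s w => G i s w l 0).

(** The same expression over pairs of coordinates, symmetrised to match the right-hand side of
    [second_moment]. *)
Let terms (X : 'M[R]_k) y : R := \sum_l \sum_h X l h *
  (A l y * Z h y + A h y * Z l y + \sum_i \sum_j K i j * (H i l y * H j h y)).

Let cut_generator X : X^T = X -> cut (upto T) (generator X) = terms X.
Proof.
move=> sX; apply/funext => y; rewrite /generator /terms /A /Z /H /cut.
set c := \1_(upto T) y.1.
have cc : c * c = c by rewrite /c indicE; case: (_ \in _); rewrite ?mulr1 ?mulr0.
set x := z y.1 y.2; set b := a y.1 y.2.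
have -> : 2 * bil X x b = bil X b x + bil X x b by rewrite (bilC b x sX); ring.
have -> : noise_form K X (fun i => G i y.1 y.2) = \sum_l \sum_h X l h *
    \sum_i \sum_j K i j * (G i y.1 y.2 l 0 * G j y.1 y.2 h 0).
  transitivity (\sum_i \sum_j \sum_l \sum_h X l h *
      (K i j * (G i y.1 y.2 l 0 * G j y.1 y.2 h 0))).
    apply: eq_bigr => i _; apply: eq_bigr => j _; rewrite bil_sum mulr_sumr.
    apply: eq_bigr => l _; rewrite mulr_sumr; apply: eq_bigr => h _; ring.
  under eq_bigr do rewrite exchange_big/=.
  rewrite exchange_big/=; apply: eq_bigr => l _.
  under eq_bigr do rewrite exchange_big/=.
  rewrite exchange_big/=; apply: eq_bigr => h _.
  by rewrite mulr_sumr; apply: eq_bigr => i _; rewrite mulr_sumr.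
rewrite !bil_sum -!big_split/= mulr_sumr; apply: eq_bigr => l _.
rewrite -!big_split/= mulr_sumr; apply: eq_bigr => h _.
have -> : \sum_i \sum_j K i j * (c * G i y.1 y.2 l 0 * (c * G j y.1 y.2 h 0)) =
    c * \sum_i \sum_j K i j * (G i y.1 y.2 l 0 * G j y.1 y.2 h 0).
  rewrite mulr_sumr; apply: eq_bigr => i _; rewrite mulr_sumr; apply: eq_bigr => j _.
  by rewrite -{3}cc; ring.
have e u v : c * u * (c * v) = c * (u * v) by rewrite -{3}cc; ring.
by rewrite !e; ring.
Qed.

Let hA l : sqint mu (A l). Proof. by have [] := ha l. Qed.
Let hZ l : sqint mu (Z l). Proof. by have [] := hz l. Qed.
Let hH i l : sqint mu (H i l). Proof. by have [] := hG i l. Qed.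

Let L1 (f : R * Omega -> R) := mu.-integrable setT (fun y => (f y)%:E).

Let L1D f g : L1 f -> L1 g -> L1 (fun y => f y + g y).
Proof. by move=> hf hg; have := integrableD measurableT hf hg; apply: eq_integrable. Qed.

Let L1Z c f : L1 f -> L1 (fun y => c * f y).
Proof. by move=> hf; have := integrableZl measurableT c hf; apply: eq_integrable. Qed.

Let L1_sum I (s : seq I) (f : I -> R * Omega -> R) : (forall i, L1 (f i)) ->
  L1 (fun y => \sum_(i <- s) f i y).
Proof.
move=> hf; rewrite /L1; under eq_fun do rewrite -sumEFin.
by apply: integrable_sum => // i _; exact: hf.
Qed.

Let L1_noise l h : L1 (fun y => \sum_i \sum_j K i j * (H i l y * H j h y)).
Proof. by apply: L1_sum => i; apply: L1_sum => j; apply: L1Z; exact: sqint_mul. Qed.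

Let L1_AZ l h : L1 (fun y => A l y * Z h y). Proof. exact: sqint_mul. Qed.

Let L1_pair l h : L1 (fun y => A l y * Z h y + A h y * Z l y).
Proof. exact: L1D. Qed.

Lemma generator_integrable X : X^T = X ->
  mu.-integrable setT (fun y => (cut (upto T) (generator X) y)%:E).
Proof.
move=> sX; rewrite cut_generator//; apply: L1_sum => l; apply: L1_sum => h.
by apply: L1Z; apply: L1D.
Qed.

Lemma quad_integrable X : Pr.-integrable setT (fun w => (quad X (z T w))%:E).
Proof.
have hzT l : sqint Pr (fun w => z T w l 0).
  by have [] := second_moment hF hW T0 (dz l) (dz l).
have -> : (fun w => (quad X (z T w))%:E) =
    fun w => (\sum_l \sum_h (X l h * (z T w l 0 * z T w h 0))%:E)%E.
  apply/funext => w; rewrite quadE bil_sum -sumEFin; apply: eq_bigr => l _.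
  by rewrite -sumEFin.
apply: integrable_sum => // l _; apply: integrable_sum => // h _.
have := integrableZl measurableT (X l h) (sqint_mul (hzT l) (hzT h)).
exact: eq_integrable.
Qed.

Lemma quad_moment X : X^T = X ->
  \int[Pr]_w quad X (z T w) = \int[mu]_y cut (upto T) (generator X) y.
Proof.
move=> sX; rewrite cut_generator// /terms.
have zz l h := second_moment hF hW T0 (dz l) (dz h).
have hzT l : sqint Pr (fun w => z T w l 0) by have [] := zz l l.
transitivity (\sum_l \sum_h X l h * ip Pr (fun w => z T w l 0) (fun w => z T w h 0)).
  have E : (fun w => quad X (z T w)) =
      fun w => \sum_l \sum_h X l h * (z T w l 0 * z T w h 0).
    by apply/funext => w; rewrite quadE bil_sum.
  have i1 l h : Pr.-integrable setT (fun w => (X l h * (z T w l 0 * z T w h 0))%:E).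
    have := integrableZl measurableT (X l h) (sqint_mul (hzT l) (hzT h)).
    exact: eq_integrable.
  rewrite E Rintegral_sum; last first.
    move=> l; under eq_fun do rewrite -sumEFin.
    by apply: integrable_sum => // h _; exact: i1.
  apply: eq_bigr => l _; rewrite Rintegral_sum; last by move=> h; exact: i1.
  apply: eq_bigr => h _.
  by rewrite RintegralZl//; exact: sqint_mul.
have iT l h : L1 (fun y => X l h * (A l y * Z h y + A h y * Z l y +
     \sum_i \sum_j K i j * (H i l y * H j h y))).
  by apply: L1Z; apply: L1D.
rewrite Rintegral_sum; last by move=> l; exact: L1_sum.
apply: eq_bigr => l _; rewrite Rintegral_sum; last by move=> h; exact: iT.
apply: eq_bigr => h _.
rewrite RintegralZl//; last exact: L1D.
have [_ _ ->] := zz l h; congr (_ * _).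
rewrite (RintegralD measurableT (L1_pair l h) (L1_noise l h)).
rewrite (RintegralD measurableT (L1_AZ l h) (L1_AZ h l)).
congr (_ + _); rewrite Rintegral_sum; last first.
  by move=> i; apply: L1_sum => j; apply: L1Z; exact: sqint_mul.
apply: eq_bigr => i _; rewrite Rintegral_sum; last first.
  by move=> j; apply: L1Z; exact: sqint_mul.
apply: eq_bigr => j _; rewrite RintegralZl//; exact: sqint_mul.
Qed.

End Formula.
End QuadraticMoment.

Section FiniteHorizon.
Context {R : realType} {d : measure_display} {Omega : measurableType d}.
Variables (Pr : probability Omega R) (F : R -> set (set Omega)).
Variables (q : nat) (K : 'M[R]_q) (W : R -> Omega -> 'cV[R]_q).
Hypotheses (hF : usual_filtration Pr F) (hW : wiener Pr F K W).
Let mu := time_prob Pr.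
Variable T : R.
Hypothesis T0 : 0 < T.

Lemma sde_L2proc k (A : 'M[R]_k) N f x0 x : sde_solution Pr F W (upto T) A N f x0 x ->
  L2proc Pr F T x.
Proof. by move=> [ax _ fx _]; apply: L2procI => //; apply: fx; exact: upto_horizon. Qed.

Lemma sde_ito_process k (A : 'M[R]_k) N f x : sde_solution Pr F W (upto T) A N f 0 x ->
  L2proc Pr F T f ->
  forall l, ito_process Pr F W T (fun s w => (A *m x s w + f s w) l 0)
    (fun i s w => (N i *m x s w) l 0) (fun s w => x s w l 0).
Proof.
move=> dx hf l; have hx := sde_L2proc dx; have [_ _ _ ex] := dx.
have [wa ma ia] := L2procD hF (L2procM hF A hx) hf l.
have [wx mx ix] := hx l.
split => //.
- by move=> i; have [] := L2procM hF (N i) hx l.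
- split => // t tT; have /uptoP/andP[t0 _] := tT.
  exact: measurable_wrt_fun (filtration_measurable hF t0) (wx t tT).
move=> t tT; have [J [IJ eJ]] := ex t tT.
exists (fun i w => J i w l 0); split => //.
by apply: filterS eJ => w ->; rewrite add0r mxE summxE mxE.
Qed.

Lemma ito_process_col k l (a1 x1 : R -> Omega -> 'cV[R]_k) (a2 x2 : R -> Omega -> 'cV[R]_l)
    (G1 : 'I_q -> R -> Omega -> 'cV[R]_k) (G2 : 'I_q -> R -> Omega -> 'cV[R]_l) :
  (forall h, ito_process Pr F W T (fun s w => a1 s w h 0) (fun i s w => G1 i s w h 0)
    (fun s w => x1 s w h 0)) ->
  (forall h, ito_process Pr F W T (fun s w => a2 s w h 0) (fun i s w => G2 i s w h 0)
    (fun s w => x2 s w h 0)) ->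
  forall h, ito_process Pr F W T (fun s w => col_mx (a1 s w) (a2 s w) h 0)
    (fun i s w => col_mx (G1 i s w) (G2 i s w) h 0)
    (fun s w => col_mx (x1 s w) (x2 s w) h 0).
Proof.
move=> h1 h2 h; case: (split_ordP h) => j ->.
  by have := h1 j; congr (ito_process _ _ _ _ _ _ _);
    do ?[apply/funext => ?]; rewrite col_mxEu.
by have := h2 j; congr (ito_process _ _ _ _ _ _ _);
  do ?[apply/funext => ?]; rewrite col_mxEd.
Qed.

Section Bound.
Context {n r m p : nat}.
Variables (A : 'M[R]_n) (N : 'I_q -> 'M[R]_n) (B : 'M[R]_(n, m)) (C : 'M[R]_(p, n))
  (Q : 'M[R]_n).
Variables (Ar : 'M[R]_r) (Nr : 'I_q -> 'M[R]_r) (Br : 'M[R]_(r, m)) (Cr : 'M[R]_(p, r))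
  (Sr : 'M[R]_r) (gam : R).
Let s : @system R q m (m + p) n :=
  System (A - B *m B^T *m Q) N B (col_mx (- (B^T *m Q)) C).
Let t : @system R q m (m + p) r :=
  System (Ar - Br *m Br^T *m Sr) Nr Br (col_mx (- (Br^T *m Sr)) Cr).
Hypotheses (pQ : posdef Q) (ric : riccati_eq K A N B C Q) (dis : dissipative K s t gam).
Variables (u : R -> Omega -> 'cV[R]_m) (x : R -> Omega -> 'cV[R]_n)
  (xr : R -> Omega -> 'cV[R]_r).
Let ur := reduced_control B Q Br Sr x xr u.
Let e := vstack (vsub u ur) (vsub (output C x) (output Cr xr)).
Hypotheses (hu : in_L2 Pr F (upto T) u) (dx : state Pr F W (upto T) A N B 0 u x)
  (dxr : state Pr F W (upto T) Ar Nr Br 0 ur xr).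

Let v (tau : R) (w : Omega) := B^T *m Q *m x tau w + u tau w.

Let Lu : L2proc Pr F T u. Proof. by case: hu => au fu; exact: L2procI. Qed.
Let Lx : L2proc Pr F T x. Proof. exact: sde_L2proc dx. Qed.
Let Lxr : L2proc Pr F T xr. Proof. exact: sde_L2proc dxr. Qed.
Let Lv : L2proc Pr F T v. Proof. by apply: L2procD => //; exact: L2procM. Qed.
Let Lur : L2proc Pr F T ur.
Proof.
apply: L2procD => //; apply: L2procD => //; last exact: L2procM.
by apply: L2procN => //; exact: L2procM.
Qed.
Let Ly : L2proc Pr F T (output C x). Proof. exact: L2procM. Qed.

Lemma L2proc_input_output : L2proc Pr F T (vstack u (output C x)).
Proof. exact: L2proc_col. Qed.

Lemma L2proc_error : L2proc Pr F T e.
Proof.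
apply: L2proc_col.
  by apply: L2procD => //; exact: L2procN.
by apply: L2procD => //; apply: L2procN => //; exact: L2procM.
Qed.

Let drift_s tau w : drift s (x tau w) (v tau w) = A *m x tau w + B *m u tau w.
Proof.
rewrite /drift/= mulmxBl /v mulmxDr !mulmxA addrA; congr (_ + _).
by rewrite subrK.
Qed.

Let drift_t tau w : drift t (xr tau w) (v tau w) = Ar *m xr tau w + Br *m ur tau w.
Proof.
have -> : Br *m ur tau w = - (Br *m Br^T *m Sr *m xr tau w) + Br *m v tau w.
  by rewrite /ur /reduced_control -addrA mulmxDr mulmxN !mulmxA.
by rewrite /drift/= mulmxBl addrA.
Qed.

Let output_error tau w : sysC s *m x tau w - sysC t *m xr tau w = e tau w.
Proof.
rewrite /= !mul_col_mx opp_col_mx add_col_mx; congr col_mx.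
by rewrite /vsub /ur /reduced_control !mulNmx !opprD !opprK [RHS]addrC subrK addrC.
Qed.

Let dxs l : ito_process Pr F W T (fun tau w => drift s (x tau w) (v tau w) l 0)
   (fun i tau w => (N i *m x tau w) l 0) (fun tau w => x tau w l 0).
Proof.
have Bu : L2proc Pr F T (fun tau w => B *m u tau w) by exact: L2procM.
have := sde_ito_process dx Bu l; congr (ito_process _ _ _ _ _ _ _).
by apply/funext => tau; apply/funext => w; rewrite drift_s.
Qed.

Let dxt l : ito_process Pr F W T (fun tau w => drift t (xr tau w) (v tau w) l 0)
   (fun i tau w => (Nr i *m xr tau w) l 0) (fun tau w => xr tau w l 0).
Proof.
have Bu : L2proc Pr F T (fun tau w => Br *m ur tau w) by exact: L2procM.
have := sde_ito_process dxr Bu l; congr (ito_process _ _ _ _ _ _ _).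
by apply/funext => tau; apply/funext => w; rewrite drift_t.
Qed.

Let Lds : L2proc Pr F T (fun tau w => drift s (x tau w) (v tau w)).
Proof. by apply: L2procD => //; exact: L2procM. Qed.

Let Ldt : L2proc Pr F T (fun tau w => drift t (xr tau w) (v tau w)).
Proof. by apply: L2procD => //; exact: L2procM. Qed.

Lemma terminal_integrable : Pr.-integrable setT (fun w => (quad Q (x T w))%:E).
Proof.
have LN i : L2proc Pr F T (fun tau w => N i *m x tau w) by exact: L2procM.
exact: (quad_integrable hF hW T0 dxs).
Qed.

Let val_v : L2val Pr T v =
  L2val Pr T (vstack u (output C x)) + \int[Pr]_w quad Q (x T w).
Proof.
have [sQ _] := pQ.
have LN i : L2proc Pr F T (fun tau w => N i *m x tau w) by exact: L2procM.
rewrite (quad_moment hF hW T0 Lx Lds LN dxs sQ).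
have iG := generator_integrable K Lx Lds LN sQ.
have iu := L2proc_sqnorm L2proc_input_output.
rewrite /L2val -(RintegralD measurableT iu iG); apply: eq_Rintegral => z _.
rewrite /cut -mulrDr; congr (_ * _); rewrite /generator drift_s /vstack sqnorm_col.
rewrite [bil Q _ (_ + _)]bilDr (bil_input B)// /v sqnormD /output.
by have := riccati_eq_form (x z.1 z.2) sQ ric; lra.
Qed.

(** The storage function of the pair starts at zero and has nonnegative expectation at [T], so its
    generator has nonnegative integral; dissipativity bounds that generator pointwise by $\gamma^2
    |v|^2 - |e|^2$. *)
Lemma error_bound : L2val Pr T e <=
  gam ^+ 2 * (L2val Pr T (vstack u (output C x)) + \int[Pr]_w quad Q (x T w)).
Proof.
rewrite -val_v; have [X [pX hX]] := dis; have [sX _] := pX.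
have Lz := L2proc_col Lx Lxr; have La := L2proc_col Lds Ldt.
have LG i : L2proc Pr F T (fun tau w => col_mx (N i *m x tau w) (Nr i *m xr tau w)).
  by apply: L2proc_col; exact: L2procM.
have dz := ito_process_col dxs dxt.
have V0 : 0 <= \int[Pr]_w quad X (col_mx (x T w) (xr T w)).
  by apply: Rintegral_ge0 => w _; rewrite quadE posdef_ge0.
have iG := generator_integrable K Lz La LG sX.
rewrite (quad_moment hF hW T0 Lz La LG dz sX) in V0.
have iv := L2proc_sqnorm Lv; have ie := L2proc_sqnorm L2proc_error.
have igv : mu.-integrable setT
    (fun z => (gam ^+ 2 * cut (upto T) (fun tau w => sqnorm (v tau w)) z)%:E).
  by have := integrableZl measurableT (gam ^+ 2) iv; apply: eq_integrable.
rewrite -subr_ge0; apply: le_trans V0 _; rewrite /L2val -RintegralZl//.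
rewrite -(RintegralB measurableT igv ie).
apply: le_Rintegral => //.
  by have := integrableB measurableT igv ie; apply: eq_integrable.
move=> z _; rewrite /cut mulrCA -mulrBr; apply: ler_wpM2l; first by rewrite indicE ler0n.
have := hX (x z.1 z.2) (xr z.1 z.2) (v z.1 z.2); rewrite output_error.
exact.
Qed.

Lemma error_bound_ereal :
  (L2sq Pr (upto T) e <= (gam ^+ 2)%:E *
     (L2sq Pr (upto T) (vstack u (output C x)) + 'E_Pr[fun w => quad Q (x T w)]))%E.
Proof.
rewrite (L2sq_val L2proc_error) (L2sq_val L2proc_input_output) unlock.
have fE := integrable_fin_num measurableT terminal_integrable.
by rewrite -(fineK fE) -EFinD -EFinM lee_fin; exact: error_bound.
Qed.

End Bound.
End FiniteHorizon.

Lemma sqrte_le_mul {R : realType} (g : R) (a c : \bar R) : 0 <= g -> (0 <= c)%E ->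
  (a <= (g ^+ 2)%:E * c)%E -> (sqrte a <= g%:E * sqrte c)%E.
Proof.
move=> g0 c0 h; have gc : (0 <= (g ^+ 2)%:E * c)%E by rewrite mule_ge0// lee_fin sqr_ge0.
have -> : (g%:E * sqrte c = sqrte ((g ^+ 2)%:E * c))%E.
  by rewrite sqrteM ?lee_fin ?sqr_ge0//= sqrtr_sqr ger0_norm.
by rewrite lee_sqrt.
Qed.

(** * From finite horizons to the half-line *)

Section Horizons.
Context {R : realType} {d : measure_display} {Omega : measurableType d}.
Variables (Pr : probability Omega R) (F : R -> set (set Omega)).
Let mu := time_prob Pr.

Lemma L2sq_ge0 (D : set R) k (x : R -> Omega -> 'cV[R]_k) : (0 <= L2sq Pr D x)%E.
Proof.
apply: integral_ge0 => w _; apply: integral_ge0 => s _; rewrite lee_fin.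
exact: sqnorm_ge0.
Qed.

Lemma upto_halfline (T : R) : upto T `<=` halfline.
Proof. by move=> t /uptoP/andP[t0 _]; rewrite /halfline/= in_itv/= t0. Qed.

Lemma upto_le (S T : R) : S <= T -> upto S `<=` upto T.
Proof. by move=> ST t /uptoP/andP[t0 tS]; apply/uptoP; rewrite t0 (le_trans tS). Qed.

Lemma measurable_path (D : set R) k (x : R -> Omega -> 'cV[R]_k) :
  adapted_process F D x ->
  measurable_paths D x.
Proof. by move=> ax i; have [] := ax i. Qed.

Lemma measurable_pathS (D E : set R) k (x : R -> Omega -> 'cV[R]_k) : measurable D ->
  E `<=` D ->
  measurable_paths D x ->
  measurable_paths E x.
Proof.
move=> mD ED mx i; apply: measurable_funS (mx i); first exact: measurableX.
by move=> z [/= /ED ? _].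
Qed.

Lemma adaptedS (D E : set R) k (x : R -> Omega -> 'cV[R]_k) : measurable D ->
  E `<=` D -> adapted_process F D x -> adapted_process F E x.
Proof.
move=> mD ED ax i; have [wx _] := ax i; split; first by move=> t /ED; exact: wx.
exact: measurable_pathS mD ED (measurable_path ax) i.
Qed.

Lemma L2sq_prod (D : set R) k (x : R -> Omega -> 'cV[R]_k) : measurable D ->
  measurable_paths D x ->
  L2sq Pr D x = (\int[mu]_(z in D `*` setT) (sqnorm (x z.1 z.2))%:E)%E.
Proof.
move=> mD mx; rewrite L2sq_cut// [RHS]integral_mkcond; apply: eq_integral => z _.
rewrite patchE /cut indicE.
have -> : (z \in D `*` (setT : set Omega)) = (z.1 \in D).
  by apply/idP/idP => /set_mem; rewrite /setX/= => h; apply: mem_set => //; case: h.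
by case: (_ \in _); rewrite ?mul1r ?mul0r.
Qed.

Lemma L2sqS (D E : set R) k (x : R -> Omega -> 'cV[R]_k) : measurable D -> measurable E ->
  E `<=` D ->
  measurable_paths D x ->
  (L2sq Pr E x <= L2sq Pr D x)%E.
Proof.
move=> mD mE ED mx; have mxE := measurable_pathS mD ED mx.
rewrite !L2sq_prod//; apply: ge0_subset_integral.
- exact: measurableX.
- exact: measurableX.
- by apply/measurable_EFinP; exact: measurable_sqnorm.
- by move=> z _; rewrite lee_fin sqnorm_ge0.
- by move=> z [/= /ED ? _].
Qed.

(** Monotone convergence along integer horizons. *)
Lemma L2sq_halfline_le k (x : R -> Omega -> 'cV[R]_k) (c : \bar R) :
  measurable_paths halfline x ->
  (forall j : nat, (L2sq Pr (upto j%:R) x <= c)%E) ->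
  (L2sq Pr halfline x <= c)%E.
Proof.
move=> mx hc; have mH := @measurable_halfline R; have mU := @measurable_upto R.
have mxj j := measurable_pathS mH (@upto_halfline j%:R) mx.
pose D (j : nat) : set (R * Omega) := upto j%:R `*` setT.
have UD : halfline `*` setT = \bigcup_j D j.
  apply/seteqP; split => z; last by move=> [j _ [/= /upto_halfline ? _]].
  rewrite /halfline => -[/=]; rewrite in_itv/= andbT => z0 _.
  have [j hj] : exists j : nat, z.1 <= j%:R.
    by exists (Num.bound z.1); exact: ltW (archi_boundP z0).
  by exists j => //; split => //; apply/uptoP; rewrite z0 hj.
rewrite L2sq_prod// UD.
have L : (fun j => \int[mu]_(z in D j) (sqnorm (x z.1 z.2))%:E)%E @ \oo -->
    (\int[mu]_(z in \bigcup_j D j) (sqnorm (x z.1 z.2))%:E)%E.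
  apply: ge0_nondecreasing_set_cvg_integral.
  - move=> i j ij; apply/subsetPset => z [/= zi _]; split => //.
    by apply: upto_le zi; rewrite ler_nat.
  - by move=> j; exact: measurableX (mU _) measurableT.
  - by move=> j; apply/measurable_EFinP; exact: measurable_sqnorm.
  - by move=> j z _; rewrite lee_fin sqnorm_ge0.
by apply: (cvge_to_le L); apply: nearW => j; rewrite -L2sq_prod.
Qed.

(** Otherwise the second moment would exceed [eps] at all times after [S], and by Tonelli the energy
    on the half-line would be infinite. *)
Lemma L2sq_terminal k (x : R -> Omega -> 'cV[R]_k) (S eps : R) :
  measurable_paths halfline x ->
  (L2sq Pr halfline x < +oo)%E -> 0 <= S -> 0 < eps ->
  exists2 T, S < T & (\int[Pr]_w (sqnorm (x T w))%:E <= eps%:E)%E.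
Proof.
move=> mx fx S0 eps0; apply: contrapT => no.
have late t : S < t -> (eps%:E <= \int[Pr]_w (sqnorm (x t w))%:E)%E.
  by move=> St; rewrite leNgt; apply/negP => /ltW h; apply: no; exists t.
move: fx; rewrite L2sq_cut//; last exact: measurable_halfline.
pose f (z : R * Omega) : \bar R := (cut halfline (fun s w => sqnorm (x s w)) z)%:E.
have mf : measurable_fun setT f.
  apply/measurable_EFinP; apply: measurable_cut; first exact: measurable_halfline.
  exact: measurable_sqnorm.
have f0 z : (0 <= f z)%E.
  by rewrite lee_fin mulr_ge0 ?sqnorm_ge0// indicE ler0n.
rewrite (@fubini_tonelli1 _ _ _ _ _ lebesgue_measure Pr f mf f0).
apply/negP; rewrite -leNgt.
have mS : measurable (`]S, +oo[%classic : set R) by exact: measurable_itv.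
have i0 s : (0 <= (\1_(`]S, +oo[%classic : set R) s)%:E :> \bar R)%E.
  by rewrite lee_fin indicE ler0n.
have mi : measurable_fun setT (fun s => (\1_(`]S, +oo[%classic : set R) s)%:E : \bar R).
  by apply/measurable_EFinP; exact: measurable_indic.
have <- : (\int[lebesgue_measure]_s (eps%:E * (\1_(`]S, +oo[%classic : set R) s)%:E) = +oo)%E.
  rewrite ge0_integralZl//; last by rewrite lee_fin ltW.
  rewrite integral_indic// setIT.
  have L : lebesgue_measure (`]S, +oo[%classic : set R) = +oo%E.
    by rewrite lebesgue_measure_itv/= ltry.
  by transitivity (eps%:E * +oo)%E; [congr (_ * _)%E|rewrite gt0_muley// lte_fin].
apply: ge0_le_integral => //.
- by move=> s _; rewrite mule_ge0// lee_fin ltW.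
- exact: measurable_funeM.
- exact: measurable_fun_fubini_tonelli_F.
move=> s _; rewrite /fubini_F /f /cut/=; have [sS|sS] := boolP (s \in `]S, +oo[%classic); last first.
  by rewrite indicE (negbTE sS) mule0; apply: integral_ge0 => w _; exact: (f0 (s, w)).
have -> : \1_(`]S, +oo[%classic : set R) s = 1 :> R by rewrite indicE sS.
rewrite mule1.
move/set_mem : sS; rewrite /= in_itv/= andbT => sS.
have -> : \1_halfline s = 1 :> R.
  by rewrite indicE mem_set// /halfline/= in_itv/= (le_trans S0 (ltW sS)).
by under eq_integral do rewrite mul1r; exact: late.
Qed.

(** A crude constant suffices, because it only multiplies a terminal term that is made arbitrarily
    small. *)
Lemma quad_le_sqnorm k (Q : 'M[R]_k) y : quad Q y <= (\sum_i \sum_j `|Q i j|) * sqnorm y.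
Proof.
rewrite quadE bil_sum mulr_suml; apply: ler_sum => i _; rewrite mulr_suml; apply: ler_sum => j _.
apply: le_trans (ler_norm _) _; rewrite normrM ler_wpM2l//.
have le_sq l : y l 0 ^+ 2 <= sqnorm y.
  by rewrite /sqnorm (bigD1 l)//= lerDl; apply: sumr_ge0 => *; exact: sqr_ge0.
have := le_sq i; have := le_sq j; have := sqr_ge0 (`|y i 0| - `|y j 0|).
rewrite normrM -[y i 0 ^+ 2]real_normK ?num_real// -[y j 0 ^+ 2]real_normK ?num_real//.
nra.
Qed.

End Horizons.

Section Restriction.
Context {R : realType} {d : measure_display} {Omega : measurableType d}.
Variables (Pr : probability Omega R) (F : R -> set (set Omega)).
Variables (q : nat) (W : R -> Omega -> 'cV[R]_q).

Lemma in_L2_upto m (u : R -> Omega -> 'cV[R]_m) (T : R) :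
  in_L2 Pr F halfline u -> in_L2 Pr F (upto T) u.
Proof.
move=> [au fu]; have mH := @measurable_halfline R.
split; first exact: adaptedS mH (@upto_halfline R T) au.
apply: le_lt_trans fu; apply: L2sqS => //; first exact: measurable_upto.
  exact: upto_halfline.
exact: measurable_path au.
Qed.

Lemma sde_solution_upto k (A : 'M[R]_k) N f x0 x (T : R) :
  sde_solution Pr F W halfline A N f x0 x -> sde_solution Pr F W (upto T) A N f x0 x.
Proof.
move=> [ax cx fx ex]; split.
- exact: adaptedS (@measurable_halfline R) (@upto_halfline R T) ax.
- apply: filterS cx => w cw i.
  exact: continuous_subspaceW (@upto_halfline R T) (cw i).
- by move=> t /upto_halfline; exact: fx.
- by move=> t /upto_halfline; exact: ex.
Qed.

Lemma measurable_pathD (D : set R) k (x y : R -> Omega -> 'cV[R]_k) :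
  measurable_paths D x ->
  measurable_paths D y ->
  measurable_paths D (fun t w => x t w + y t w).
Proof. by move=> mx my i; under eq_fun do rewrite mxE; exact: measurable_funD. Qed.

Lemma measurable_pathM (D : set R) k l (M : 'M[R]_(l, k)) (x : R -> Omega -> 'cV[R]_k) :
  measurable_paths D x ->
  measurable_paths D (fun t w => M *m x t w).
Proof.
move=> mx i; under eq_fun do rewrite mxE.
by apply: measurable_sum => j; exact: measurable_funM.
Qed.

Lemma measurable_pathN (D : set R) k (x : R -> Omega -> 'cV[R]_k) :
  measurable_paths D x ->
  measurable_paths D (fun t w => - x t w).
Proof.
move=> mx i; under eq_fun do rewrite mxE -mulN1r.
exact: measurable_funM.
Qed.

Lemma measurable_path_col (D : set R) k l (x : R -> Omega -> 'cV[R]_k)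
    (y : R -> Omega -> 'cV[R]_l) :
  measurable_paths D x ->
  measurable_paths D y ->
  measurable_paths D (vstack x y).
Proof.
move=> mx my i; rewrite /vstack; case: (split_ordP i) => j ->.
  by under eq_fun do rewrite col_mxEu; exact: mx.
by under eq_fun do rewrite col_mxEd; exact: my.
Qed.

Lemma expectation_quad_le k (Q : 'M[R]_k) (X : Omega -> 'cV[R]_k) (c : R) :
  posdef Q -> (forall i, measurable_fun setT (fun w => X w i 0)) ->
  (\int[Pr]_w (sqnorm (X w))%:E <= c%:E)%E ->
  ('E_Pr[fun w => quad Q (X w)] <= ((\sum_i \sum_j `|Q i j|) * c)%:E)%E.
Proof.
move=> pQ mX hc; set a := \sum_i _.
have a0 : 0 <= a by apply: sumr_ge0 => i _; apply: sumr_ge0.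
have ms : measurable_fun setT (fun w => sqnorm (X w)).
  by apply: measurable_sum => i; exact: measurable_funX.
have q0 w : (0 <= (quad Q (X w))%:E)%E by rewrite lee_fin quadE posdef_ge0.
have s0 w : (0 <= (sqnorm (X w))%:E)%E by rewrite lee_fin sqnorm_ge0.
rewrite EFinM unlock; apply: le_trans (lee_wpmul2l _ hc); last by rewrite lee_fin.
rewrite -ge0_integralZl//; last first.
  by apply/measurable_EFinP.
apply: ge0_le_integral => //.
- apply/measurable_EFinP; rewrite (_ : (fun w => _) = fun w =>
    \sum_i \sum_j Q i j * (X w i 0 * X w j 0)).
    apply: measurable_sum => i; apply: measurable_sum => j.
    by apply: measurable_funM => //; exact: measurable_funM.
  by apply/funext => w; rewrite quadE bil_sum.
- by apply: measurable_funeM; apply/measurable_EFinP.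
- by move=> w _; rewrite -EFinM lee_fin; exact: quad_le_sqnorm.
Qed.

End Restriction.

Theorem theorem5p1
    (R : realType) (d : measure_display) (Omega : measurableType d)
    (Pr : probability Omega R) (F : R -> set (set Omega))
    (n m p q r : nat) (K : 'M[R]_q) (W : R -> Omega -> 'cV[R]_q)
    (A : 'M[R]_n) (N : 'I_q -> 'M[R]_n) (B : 'M[R]_(n, m)) (C : 'M[R]_(p, n))
    (P Q Sb : 'M[R]_n) (sigma : 'I_n -> R)
    (hF : usual_filtration Pr F)
    (hW : wiener Pr F K W)
    (hstab : stabilizable Pr F W A B N)
    (hobs : observable Pr F W A C N)
    (hP : posdef P) (hPineq : riccati_ineq K A N B C P)
    (hQ : posdef Q) (hQstab : stabilizing_solution Pr F W K A N B C Q)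
    (hr : (1 <= r)%N) (hrn : (r < n)%N)
    (hsigma : sqrt_eigenvalues (P *m Q) sigma)
    (hSb : balancing Sb P Q sigma) :
  let Ar := trunc_state (ltnW hrn) Sb A in
  let Nr := fun i => trunc_state (ltnW hrn) Sb (N i) in
  let Br := trunc_input (ltnW hrn) Sb B in
  let Cr := trunc_output (ltnW hrn) Sb C in
  let Sr := trunc_diag (ltnW hrn) sigma in
  let bound : R :=
    2 * \sum_(k < n | (r <= k)%N) sigma k / Num.sqrt (1 + sigma k ^+ 2) in
  (forall (T : R) (u : R -> Omega -> 'cV[R]_m) (x : R -> Omega -> 'cV[R]_n)
      (xr : R -> Omega -> 'cV[R]_r),
    0 < T ->
    in_L2 Pr F (upto T) u ->
    state Pr F W (upto T) A N B 0 u x ->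
    let ur := reduced_control B Q Br Sr x xr u in
    state Pr F W (upto T) Ar Nr Br 0 ur xr ->
    (L2norm Pr (upto T) (vstack (vsub u ur) (vsub (output C x) (output Cr xr)))
     <= bound%:E * sqrte (L2sq Pr (upto T) (vstack u (output C x))
                          + 'E_Pr[fun w => quad Q (x T w)]))%E)
  /\
  (forall (u : R -> Omega -> 'cV[R]_m) (x : R -> Omega -> 'cV[R]_n)
      (xr : R -> Omega -> 'cV[R]_r),
    in_L2 Pr F halfline u ->
    state Pr F W halfline A N B 0 u x ->
    in_L2 Pr F halfline x ->
    let ur := reduced_control B Q Br Sr x xr u in
    state Pr F W halfline Ar Nr Br 0 ur xr ->
    (L2norm Pr halfline (vstack (vsub u ur)
                                 (vsub (output C x) (output Cr xr)))
     <= bound%:E * L2norm Pr halfline (vstack u (output C x)))%E).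
Proof.
move=> Ar Nr Br Cr Sr bound.
have Kpsd k (X : 'M[R]_k) a : posdef X -> 0 <= noise_form K X a.
  exact: (psd_covariance hF hW).
have [ric _] := hQstab.
have dis := closed_loop_dissipative Kpsd hrn hP hQ ric hPineq hsigma hSb.
rewrite -/bound in dis.
have bound0 : 0 <= bound.
  have [s0 _ _] := hsigma.
  by rewrite mulr_ge0// sumr_ge0// => k _; rewrite divr_ge0 ?sqrtr_ge0// ltW.
have fin (T : R) u x xr : 0 < T -> in_L2 Pr F (upto T) u ->
    state Pr F W (upto T) A N B 0 u x ->
    let ur := reduced_control B Q Br Sr x xr u in
    state Pr F W (upto T) Ar Nr Br 0 ur xr ->
    (L2sq Pr (upto T) (vstack (vsub u ur) (vsub (output C x) (output Cr xr)))
     <= (bound ^+ 2)%:E * (L2sq Pr (upto T) (vstack u (output C x))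
                          + 'E_Pr[fun w => quad Q (x T w)]))%E.
  by move=> T0 hu dx ur dxr; exact: (error_bound_ereal hF hW T0 hQ ric dis hu dx dxr).
have EQ0 x (T : R) : (0 <= 'E_Pr[fun w : Omega => quad Q (x T w : 'cV[R]_n)])%E.
  by rewrite unlock; apply: integral_ge0 => w _; rewrite lee_fin quadE posdef_ge0.
split=> [T u x xr T0 hu dx ur dxr|u x xr hu dx [ax fx] ur dxr].
  by apply: sqrte_le_mul => //; [rewrite adde_ge0// L2sq_ge0|exact: fin].
apply: sqrte_le_mul => //; first exact: L2sq_ge0.
set e := vstack _ _; set c := L2sq Pr halfline (vstack u (output C x)).
have mH := @measurable_halfline R.
have mx := measurable_path ax; have mu := measurable_path hu.1.
have mxr : measurable_paths halfline xr by case: dxr => /measurable_path.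
have mur : measurable_paths halfline ur.
  exact: measurable_pathD (measurable_pathD (measurable_pathN
    (measurable_pathM (Br^T *m Sr) mxr)) (measurable_pathM (B^T *m Q) mx)) mu.
have me : measurable_paths halfline e.
  exact: measurable_path_col (measurable_pathD mu (measurable_pathN mur))
    (measurable_pathD (measurable_pathM C mx) (measurable_pathN (measurable_pathM Cr mxr))).
have muy := measurable_path_col mu (measurable_pathM C mx).
have finT (T : R) : 0 < T ->
    (L2sq Pr (upto T) e <= (bound ^+ 2)%:E * (c + 'E_Pr[fun w => quad Q (x T w)]))%E.
  move=> T0; apply: le_trans (fin T u x xr T0 (in_L2_upto T hu) (sde_solution_upto T dx)
    (sde_solution_upto T dxr)) _.
  apply: lee_wpmul2l; first by rewrite lee_fin sqr_ge0.
  apply: leeD (lexx _).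
  exact: L2sqS mH (measurable_upto T) (@upto_halfline R T) muy.
(* The integer horizon [j] need not have a small terminal term, so it is enlarged to some [T] that
   does, at the price of an arbitrary [eps]; the error energy grows with the horizon. *)
apply: L2sq_halfline_le => // j; apply/lee_addgt0Pr => eps eps0.
pose a : R := \sum_i \sum_j `|Q i j|.
have a0 : 0 <= a by apply: sumr_ge0 => i _; apply: sumr_ge0.
(* The added 1 makes the divisor positive even if all weights vanish. With this tolerance the
   terminal term costs at most [eps] after multiplication by [bound ^+ 2]. *)
have b0 : 0 < bound ^+ 2 * a + 1 by rewrite ltr_wpDl// mulr_ge0 ?sqr_ge0.
have del0 : 0 < eps / (bound ^+ 2 * a + 1) by rewrite divr_gt0.
have [T jT smallT] := L2sq_terminal mx fx (ler0n R j) del0.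
have T0 : 0 < T by exact: le_lt_trans jT.
have TH : halfline T by rewrite /halfline/= in_itv/= ltW.
apply: (@le_trans _ _ (L2sq Pr (upto T) e)).
  apply: L2sqS; [exact: measurable_upto|exact: measurable_upto|exact/upto_le/ltW|].
  exact: measurable_pathS mH (@upto_halfline R T) me.
apply: le_trans (finT T T0) _.
have mxT i : measurable_fun setT (fun w => x T w i 0).
  have [wx _] := ax i.
  exact: measurable_wrt_fun (filtration_measurable hF (ltW T0)) (wx T TH).
have := expectation_quad_le hQ mxT smallT; rewrite -/a => hE.
rewrite ge0_muleDr ?L2sq_ge0//; apply: leeD => //.
apply: le_trans (lee_wpmul2l _ hE) _; first by rewrite lee_fin sqr_ge0.
rewrite -EFinM lee_fin !mulrA ler_pdivrMr// [eps * _]mulrC.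
by apply: ler_wpM2r; [exact: ltW|rewrite lerDl].
Qed.
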